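(* Let $c\geq 1$ be a constant and let $\Pi$ be an LCL problem. If there exists a randomized LOCAL algorithm that solves $\Pi$ on trees in $o(\log n)$ rounds with failure probability at most $1/n$, then there exists a randomized CONGEST algorithm that solves $\Pi$ on trees in $O(\log \log n)$ rounds with failure probability at most $1/n^c$.
   Context: An LCL (locally checkable labeling) problem is a tuple $\Pi=(\Sigma_{\mathrm{in}},\Sigma_{\mathrm{out}},C,r)$ where $\Sigma_{\mathrm{in}},\Sigma_{\mathrm{out}}$ are finite label sets, $r$ is a constant (checkability radius), and $C$ is a finite set of pairs $(H,v)$ where $H$ is a graph, $v$ a node of $H$ of radius at most $r$ in $H$, and every node-edge pair (half-edge) of $H$ carries a label from $\Sigma_{\mathrm{in}}$ and one from $\Sigma_{\mathrm{out}}$. Input graphs have maximum degree bounded by a constant $\Delta$. Solving $\Pi$: given input labels on half-edges, assign output labels to all half-edges so that the labeled radius-$r$ ball around every node is isomorphic to a labeled graph in $C$. LOCAL model: the connected $n$-node input graph is the network; synchronous rounds with arbitrarily large messages. CONGEST model: same with $O(\log n)$-bit messages. A randomized algorithm $\mathcal{A}(n)$ is given an upper bound $n$ on the number of nodes, has a deterministic running-time bound $t_{\mathcal{A}}(n)$, has no unique IDs, and each node uses at most $h_{\mathcal{A}}(n)\in\mathbb{N}$ random bits for some (arbitrary) finite function $h_{\mathcal{A}}$; its failure probability is the probability that the output violates $\Pi$ on a graph with at most $n$ nodes. *)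

(* Defs.v *)
From Stdlib Require Import Reals ClassicalEpsilon.
From HB Require Import structures.
From mathcomp Require Import all_boot.

Set Implicit Arguments.
Unset Strict Implicit.
Unset Printing Implicit Defensive.

Definition pb (P : Prop) : bool := if excluded_middle_informative P then true else false.

(* Graphs: a simple undirected graph on a finite vertex type V is a     *)
(* symmetric irreflexive relation e. Half-edges are pairs (v,u), e v u. *)

Definition deg (V : finType) (e : rel V) (v : V) : nat := #|[pred u | e v u]|.

Definition simple_graph (V : finType) (e : rel V) : Prop :=
  irreflexive e /\ symmetric e.

Definition connected_graph (V : finType) (e : rel V) : Prop :=
  forall x y : V, connect e x y.

Definition has_cycle (V : finType) (e : rel V) : Prop :=
  exists (x : V) (p : seq V),
    [/\ path e x p, uniq (x :: p), (2 <= size p)%N & e (last x p) x].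

Definition is_tree (V : finType) (e : rel V) : Prop :=
  [/\ simple_graph e, connected_graph e & ~ has_cycle e].

Definition max_deg_le (V : finType) (e : rel V) (D : nat) : Prop :=
  forall v, (deg e v <= D)%N.

Definition port_numbering (V : finType) (e : rel V) (pn : V -> V -> nat) : Prop :=
  forall v : V,
    (forall u, e v u -> (pn v u < deg e v)%N) /\
    (forall u w, e v u -> e v w -> pn v u = pn v w -> u = w).

Definition nbr_at (V : finType) (e : rel V) (pn : V -> V -> nat) (v : V) (p : nat)
  : option V := [pick u | e v u && (pn v u == p)].

Fixpoint within (V : finType) (e : rel V) (k : nat) (x y : V) : bool :=
  if k is k'.+1 then within e k' x y || [exists z, within e k' x z && e z y]
  else x == y.

(* a centered graph H (vertices 'I_n) with node v, carrying input and output
   labels on half-edges (values on non-edges are irrelevant) *)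
Record cgraph (Si So : Type) := CGraph {
  cg_n : nat;
  cg_adj : rel 'I_cg_n;
  cg_ctr : 'I_cg_n;
  cg_in : 'I_cg_n -> 'I_cg_n -> Si;
  cg_out : 'I_cg_n -> 'I_cg_n -> So }.
Arguments cg_n {Si So}.
Arguments cg_adj {Si So} c.
Arguments cg_ctr {Si So} c.
Arguments cg_in {Si So} c.
Arguments cg_out {Si So} c.

(* Pi = (Sigma_in, Sigma_out, C, r); the label sets are the type parameters *)
Record LCL (Si So : Type) := MkLCL {
  lcl_r : nat;
  lcl_C : seq (cgraph Si So) }.

Definition ball_iso (Si So : Type) (V : finType) (e : rel V)
    (inp : V -> V -> Si) (out : V -> V -> So) (r : nat) (v : V)
    (H : cgraph Si So) : Prop :=
  exists (f : V -> 'I_(cg_n H)) (g : 'I_(cg_n H) -> V),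
    [/\ forall u, within e r v u -> g (f u) = u,
        forall i, within e r v (g i) /\ f (g i) = i,
        f v = cg_ctr H,
        forall x y, within e r v x -> within e r v y ->
          e x y = cg_adj H (f x) (f y) &
        forall x y, within e r v x -> within e r v y -> e x y ->
          inp x y = cg_in H (f x) (f y) /\ out x y = cg_out H (f x) (f y)].

Definition lcl_valid (Si So : Type) (Pi : LCL Si So) (V : finType) (e : rel V)
    (inp : V -> V -> Si) (out : V -> V -> So) : Prop :=
  forall v : V, exists2 H, List.In H (lcl_C Pi) & ball_iso e inp out (lcl_r Pi) v H.

(* Randomized synchronous message-passing algorithms without IDs.
   The family A(n) is given by functions taking the bound n as first argument.
   A node knows n, its degree, the input labels of its half-edges (by port) and
   its a_bits n private random bits.  In every round it sends a message on each
   port (computed from its state) and updates its state from the messages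
   received on each port.  After a_time n rounds each node outputs a label for
   each of its ports.  Local computation and message/state types are
   unrestricted (LOCAL); CONGEST additionally bounds message size. *)
Record algo (Si So : Type) := Algo {
  a_St : Type;
  a_Msg : Type;
  a_time : nat -> nat;
  a_bits : nat -> nat;
  a_init : forall n : nat, nat -> (nat -> option Si) -> (a_bits n).-tuple bool -> a_St;
  a_send : nat -> a_St -> nat -> a_Msg;
  a_recv : nat -> a_St -> (nat -> option a_Msg) -> a_St;
  a_out : nat -> a_St -> nat -> So }.
Arguments a_St {Si So} a.
Arguments a_Msg {Si So} a.
Arguments a_time {Si So} a.
Arguments a_bits {Si So} a.
Arguments a_init {Si So} a.
Arguments a_send {Si So} a.
Arguments a_recv {Si So} a.
Arguments a_out {Si So} a.

Fixpoint exec (Si So : Type) (A : algo Si So) (n : nat) (V : finType) (e : rel V)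
    (pn : V -> V -> nat) (inp : V -> V -> Si)
    (beta : V -> (a_bits A n).-tuple bool) (k : nat) (v : V) {struct k} : a_St A :=
  match k with
  | 0 => a_init A n (deg e v) (fun p => omap (inp v) (nbr_at e pn v p)) (beta v)
  | k'.+1 =>
      a_recv A n (exec e pn inp beta k' v)
        (fun p => omap (fun u => a_send A n (exec e pn inp beta k' u) (pn u v))
                       (nbr_at e pn v p))
  end.

Definition outl (Si So : Type) (A : algo Si So) (n : nat) (V : finType) (e : rel V)
    (pn : V -> V -> nat) (inp : V -> V -> Si)
    (beta : V -> (a_bits A n).-tuple bool) (v u : V) : So :=
  a_out A n (@exec _ _ A n V e pn inp beta (a_time A n) v) (pn v u).
Arguments outl {Si So} A n {V} e pn inp beta v u.
Arguments exec {Si So} A n {V} e pn inp beta k v.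

Definition fail_prob (Si So : Type) (Pi : LCL Si So) (A : algo Si So) (n : nat)
    (V : finType) (e : rel V) (pn : V -> V -> nat) (inp : V -> V -> Si) : R :=
  Rdiv (INR #|[set beta : {ffun V -> (a_bits A n).-tuple bool} |
            pb (~ lcl_valid Pi e inp (outl A n e pn inp beta))]|)
       (INR #|{ffun V -> (a_bits A n).-tuple bool}|).

Definition solves_on_trees (Si So : Type) (D : nat) (Pi : LCL Si So)
    (A : algo Si So) (bnd : nat -> R) : Prop :=
  forall (n : nat) (V : finType) (e : rel V) (pn : V -> V -> nat) (inp : V -> V -> Si),
    (0 < #|V| <= n)%N -> is_tree e -> max_deg_le e D -> port_numbering e pn ->
    Rle (fail_prob Pi A n e pn inp) (bnd n).

Definition congest (Si So : Type) (A : algo Si So) : Prop :=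
  exists (B : nat) (enc : a_Msg A -> seq bool), injective enc /\
    forall n s p, (size (enc (a_send A n s p)) <= B * (trunc_log 2 n).+1)%N.

Definition little_o_log (t : nat -> nat) : Prop :=
  forall eps : R, Rlt 0 eps -> exists N : nat, forall n : nat, (N <= n)%N ->
    Rle (INR (t n)) (Rmult eps (ln (INR n))).

Definition big_O_loglog (t : nat -> nat) : Prop :=
  exists (K : R) (N : nat), forall n : nat, (N <= n)%N ->
    Rle (INR (t n)) (Rmult K (ln (ln (INR n)))).

(* Main.v *)
Require Import Defs.
From Stdlib Require Import Reals Lra Classical_Prop ClassicalEpsilon FunctionalExtensionality PropExtensionality.
From mathcomp Require Import all_boot zify.

(* Run the given algorithm with a constant parameter n0: a node then fails with probability at most
   1/n0, depending only on the random strings in a ball of constant radius R, and since the running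
   time is o(log n0) this beats any fixed power of the size of that ball.  So a correct sample of the
   random strings exists by the local lemma, and it has to be found in O(log log n) rounds.

   Random identifiers are first reduced to constantly many colours, proper up to distance 4R.  Colour
   by colour, variables are then sampled and kept as long as every event has small conditional
   probability; otherwise the variables nearby are frozen.  With high probability the frozen
   variables lie in pockets of O(log n) vertices, whose whole content (constantly many bits per
   vertex) therefore fits into one message.

   Inside a pocket, leaves are raked, and long chains of degree-2 vertices are cut at vertices far
   apart from each other.  Each event meets at most one cut vertex, so the variables around the cut
   vertices can be fixed at the cost of a constant factor; this decouples the pieces between them.
   All other vertices leave as leaves, after O(log log n) layers, so a piece has radius
   O(log log n) around the vertex of its last layer.  The local lemma provides a completion,
   and all vertices of a piece agree on one by choosing it as a function of the piece rooted there. *)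

Set Implicit Arguments.
Unset Strict Implicit.
Unset Printing Implicit Defensive.

Delimit Scope R_scope with Re.

(** * Balls, forests and leaves *)

(** A ball of radius O(log log n) can hold a higher power of log n many vertices, more than one
    message can describe. A pocket rules this out, but may have diameter of order log n, which is
    why it must be broken up once more. Fixing variables in stages works because of a chain of
    growing probability bounds: [1/n0] at the start, [1/thr1] after the sampling, [1/thr2] around
    the cut vertices, the last still admitting the local lemma. Probability is counting: at most
    [1/m] reads count times [m] at most the number of assignments.

    What a node computes in a phase is a function of a ball up to isomorphism, proved by transport
    along partial isomorphisms ([simf]); one simulation turns any sequence of such functions on
    forests into message passing. Vertices have no names, so a choice that several nodes must make
    alike is phrased in isomorphism-invariant data: colours around a cut vertex, port walks from a
    leader in a piece. *)

Lemma pbP (P : Prop) : reflect P (pb P).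
Proof. by rewrite /pb; case: excluded_middle_informative => h; constructor. Qed.

Lemma pb_iff (P Q : Prop) : (P <-> Q) -> pb P = pb Q.
Proof. by move=> h; apply/pbP/pbP => /h. Qed.

#[local] Arguments within : simpl never.

Section WithinDef.
Variables (V : finType) (e : rel V).

Lemma within0 x y : within e 0 x y = (x == y).
Proof. by []. Qed.

Lemma withinS k x y :
  within e k.+1 x y = within e k x y || [exists z, within e k x z && e z y].
Proof. by []. Qed.

End WithinDef.

#[local] Opaque within.

Section Within.
Variables (V : finType) (e : rel V).

Lemma within_refl k x : within e k x x.
Proof. by elim: k => [|k IH]; rewrite ?within0 // withinS IH. Qed.

Lemma withinW a b x y : a <= b -> within e a x y -> within e b x y.
Proof.
move=> /subnK <-; elim: (b - a) => //= k IH h.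
by rewrite addSn withinS IH.
Qed.

Lemma within_rcons k x y z : within e k x y -> e y z -> within e k.+1 x z.
Proof. by move=> h1 h2; rewrite withinS; apply/orP; right; apply/existsP; exists y; rewrite h1. Qed.

Lemma within_add a b x y z : within e a x y -> within e b y z -> within e (a + b) x z.
Proof.
move=> h; elim: b z => [|b IH] z; first by rewrite within0 => /eqP <-; rewrite addn0.
rewrite addnS withinS => /orP[/IH h1|/existsP[w /andP[/IH h1 h2]]]; first exact: (withinW _ h1).
exact: within_rcons h1 h2.
Qed.

Lemma within_edge x y : e x y -> within e 1 x y.
Proof. by move=> h; apply: within_rcons (within_refl 0 x) h. Qed.

Lemma within_cons k x y z : e x y -> within e k y z -> within e k.+1 x z.
Proof. by move=> /within_edge h /(within_add h). Qed.

Lemma within_split k x y : within e k.+1 x y ->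
  x = y \/ exists2 z, e x z & within e k z y.
Proof.
elim: k y => [|k IH] y.
  rewrite withinS within0 => /orP[/eqP ->|/existsP[z]]; first by left.
  by rewrite within0 => /andP[/eqP <- h]; right; exists y => //; apply: within_refl.
rewrite withinS => /orP[/IH[->|[z h1 h2]]|/existsP[z /andP[/IH[h1|[w h1 h2]] h3]]].
- by left.
- by right; exists z => //; apply: (withinW _ h2).
- by right; exists y; [rewrite h1|apply: within_refl].
- by right; exists w => //; apply: within_rcons h2 h3.
Qed.

Lemma within_last x p : path e x p -> within e (size p) x (last x p).
Proof.
elim: p x => [|y p IH] x /=; first by rewrite within_refl.
move=> /andP[h1 h2]; exact: within_cons h1 (IH _ h2).
Qed.

Lemma within_connect k x y : within e k x y -> connect e x y.
Proof.
elim: k y => [|k IH] y; first by rewrite within0 => /eqP ->.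
rewrite withinS => /orP[/IH //|/existsP[z /andP[/IH h1 h2]]].
exact: connect_trans h1 (connect1 h2).
Qed.

Hypothesis esym : symmetric e.

Lemma within_sym k x y : within e k x y = within e k y x.
Proof.
have h x1 y1 : within e k x1 y1 -> within e k y1 x1.
  elim: k x1 y1 => [|l IH] x1 y1; first by rewrite !within0 => /eqP ->.
  by move=> /within_split[->|[z h1 /IH h2]];
    [apply: within_refl|rewrite esym in h1; apply: within_rcons h2 h1].
by apply/idP/idP; apply: h.
Qed.

End Within.

Lemma within_sub (V : finType) (e e' : rel V) k x y : subrel e e' ->
  within e k x y -> within e' k x y.
Proof.
move=> h; elim: k y => //= k IH y; rewrite !withinS => /orP[/IH -> //|/existsP[z /andP[/IH h1 /h h2]]].
by apply/orP; right; apply/existsP; exists z; rewrite h1.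
Qed.

Definition induced (V : finType) (e : rel V) (p : pred V) : rel V :=
  fun x y => [&& e x y, p x & p y].

Lemma induced_sub (V : finType) (e : rel V) (p : pred V) : subrel (induced e p) e.
Proof. by move=> x y /and3P[]. Qed.

Lemma induced_sym (V : finType) (e : rel V) (p : pred V) :
  symmetric e -> symmetric (induced e p).
Proof. by move=> h x y; rewrite /induced h; case: (p x); case: (p y); rewrite ?andbF. Qed.

Lemma induced_irr (V : finType) (e : rel V) (p : pred V) :
  irreflexive e -> irreflexive (induced e p).
Proof. by move=> h x; rewrite /induced h. Qed.

(** The walk is split at its first vertex outside [p]. Later [p] is the complement of the cut
    set. *)
Lemma within_cut (V : finType) (e : rel V) (p : pred V) k x y : within e k x y ->
  within (induced e p) k x y \/
  exists i s, [/\ i <= k, ~~ p s, within e i x s & within e (k - i) s y].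
Proof.
elim: k x => [|k IH] x; first by left.
case hp: (p x); last first.
  by move=> h; right; exists 0, x; rewrite hp subn0 within_refl.
move=> /within_split[<-|[z h1 h2]]; first by left; apply: within_refl.
case hz: (p z); last first.
  right; exists 1, z; rewrite hz subn1; split => //; exact: within_edge.
case: (IH _ h2) => [h3|[i [s [h3 h4 h5 h6]]]].
  by left; apply: within_cons h3; rewrite /induced h1 hp hz.
right; exists i.+1, s; split => //; exact: within_cons h1 h5.
Qed.

Lemma card_bigcup_mul (I T : finType) (A : {set I}) (F : I -> {set T}) m q :
  (forall i, i \in A -> #|F i| * m <= q) -> #|\bigcup_(i in A) F i| * m <= #|A| * q.
Proof.
move=> h; rewrite -[X in _ <= X]sum_nat_const.
elim/big_rec2: _ => [|i n B hi IH]; first by rewrite cards0.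
by apply: (leq_trans (leq_mul (leq_card_setU _ _) (leqnn m))); rewrite mulnDl leq_add ?h.
Qed.

Lemma card_bigcup_le (I T : finType) (A : {set I}) (F : I -> {set T}) m :
  (forall i, i \in A -> #|F i| <= m) -> #|\bigcup_(i in A) F i| <= #|A| * m.
Proof.
move=> h; rewrite -[X in X <= _]muln1; apply: card_bigcup_mul => i /h.
by rewrite muln1.
Qed.

Section Ball.
Variables (V : finType) (e : rel V) (D : nat).
Hypothesis hD : max_deg_le e D.

(** A step multiplies the size by at most [D + 1]. The base [D + 2] is at least 2 even for [D = 0],
    so its powers can serve as thresholds throughout. *)
Lemma ball_card k x : #|[set y | within e k x y]| <= D.+2 ^ k.
Proof.
elim: k => [|k IH].
  rewrite expn0 (_ : [set _ | _] = [set x]) ?cards1 //.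
  by apply/setP => y; rewrite !inE within0 eq_sym.
apply: (@leq_trans (#|[set y | within e k x y]| * D.+1)); last first.
  by rewrite expnSr leq_mul.
have -> : [set y | within e k.+1 x y] =
  [set y | within e k x y] :|: \bigcup_(z in [set y | within e k x y]) [set y | e z y].
  apply/setP => y; rewrite !inE withinS; congr (_ || _).
  apply/existsP/bigcupP => [[z /andP[h1 h2]]|[z]]; first by exists z; rewrite ?inE.
  by rewrite !inE => h1 h2; exists z; rewrite h1.
apply: (leq_trans (leq_card_setU _ _)).
rewrite mulnS leq_add2l; apply: card_bigcup_le => z _.
by rewrite cardsE; apply: hD.
Qed.
End Ball.

Definition forest (V : finType) (e : rel V) : Prop := simple_graph e /\ ~ has_cycle e.

Lemma induced_forest (V : finType) (e : rel V) (p : pred V) : forest e -> forest (induced e p).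
Proof.
move=> [[h1 h2] h3]; split; first by split; [apply: induced_irr|apply: induced_sym].
move=> [x [q [h4 h5 h6 h7]]]; apply: h3; exists x, q; split => //.
  by apply: sub_path h4; apply: induced_sub.
exact: induced_sub h7.
Qed.

Section Forest.
Variables (V : finType) (e : rel V).
Hypothesis hf : forest e.

Lemma forest_sym : symmetric e. Proof. by case: hf => [[]]. Qed.
Lemma forest_irr : irreflexive e. Proof. by case: hf => [[]]. Qed.

(** A simple path between two neighbours of [x] that avoids [x] closes to a cycle through [x]. The
    facts about spheres below use acyclicity in this form. *)
Lemma forest_detour x y z : e x y -> e x z -> connect (induced e (predC1 x)) y z -> y = z.
Proof.
move=> hy hz /connectP[p0 h1 h2]; case: (shortenP h1) h2 => p h3 h4 _ h2.
case: hf => [[hi hs] hc]; apply/eqP/negPn/negP => hne.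
apply: hc; exists x, (y :: p).
have hx q w : path (induced e (predC1 x)) w q -> w != x -> x \notin w :: q.
  elim: q w => [|b q IH] w /=; first by rewrite inE eq_sym => _.
  move=> /andP[/and3P[_ _ h5] h6] h7; rewrite inE negb_or eq_sym h7 /=.
  exact: IH h6 h5.
split.
- by rewrite /= hy; apply: sub_path h3; apply: induced_sub.
- rewrite cons_uniq h4 andbT; apply: hx h3 _.
  by apply/eqP => h; move: hy; rewrite h hi.
- by case: p h3 h4 h2 => //= _ _ h; rewrite h eqxx in hne.
- by rewrite /= -h2 hs.
Qed.

Definition sphere (v : V) (i : nat) (x : V) : bool :=
  within e i v x && (if i is i'.+1 then ~~ within e i' v x else true).

Lemma sphere_within v i x : sphere v i x -> within e i v x.
Proof. by case/andP. Qed.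

Lemma within_sph v k x : within e k v x -> exists2 i, i <= k & sphere v i x.
Proof.
elim: k => [|k IH]; first by move=> h; exists 0 => //; rewrite /sphere h.
case h: (within e k v x).
  by move=> _; case: (IH h) => i h1 h2; exists i => //; lia.
by move=> h1; exists k.+1; rewrite // /sphere h1 h.
Qed.

Lemma sphere_lt v i j x : sphere v i x -> j < i -> ~~ within e j v x.
Proof.
case: i => // i /andP[_ h1 h2]; apply: contra h1; exact: withinW.
Qed.

Lemma sphere_uniq v i j x : sphere v i x -> sphere v j x -> i = j.
Proof.
move=> h1 h2; apply/eqP; rewrite eqn_leq; apply/andP; split; rewrite leqNgt; apply/negP => h.
  by move: (sphere_lt h1 h); rewrite (sphere_within h2).
by move: (sphere_lt h2 h); rewrite (sphere_within h1).
Qed.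

Lemma sph0 v x : sphere v 0 x = (v == x).
Proof. by rewrite /sphere andbT. Qed.

Lemma sphere_parent v i y : sphere v i.+1 y -> exists2 x, sphere v i x & e x y.
Proof.
rewrite /sphere withinS; move=> /andP[/orP[h|/existsP[z /andP[h1 h2]]] h3]; first by rewrite h in h3.
exists z => //; rewrite /sphere h1; case: i h1 h3 => // i h1 h3.
by apply/negP => h4; case/negP: h3; exact: within_rcons h4 h2.
Qed.

Lemma sphere_avoid v i y x : sphere v i y -> x != y -> (forall j, j < i -> ~~ within e j v x) ->
  connect (induced e (predC1 x)) v y.
Proof.
elim: i y => [|i IH] y; first by rewrite sph0 => /eqP ->.
move=> h1 h2 h3; case: (sphere_parent h1) => z h4 h5.
have hz : x != z.
  by apply/eqP => h; move: (h3 i (leqnn _)); rewrite h (sphere_within h4).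
apply: connect_trans (IH _ h4 hz _) (connect1 _).
  by move=> j h; apply: h3; lia.
by rewrite /induced h5 /= ![_ == x]eq_sym hz h2.
Qed.

Lemma connect_avoid2 v y z x : connect (induced e (predC1 x)) v y ->
  connect (induced e (predC1 x)) v z -> connect (induced e (predC1 x)) y z.
Proof.
move=> h1; apply: connect_trans.
by rewrite (sym_connect_sym (induced_sym _ forest_sym)).
Qed.

Lemma sphere_parent_uniq v i x1 x2 y : sphere v i.+1 y -> sphere v i x1 -> sphere v i x2 ->
  e x1 y -> e x2 y -> x1 = x2.
Proof.
move=> h0 h1 h2 h3 h4; apply: (@forest_detour y); rewrite 1?forest_sym //.
have h x : sphere v i x -> connect (induced e (predC1 y)) v x.
  move=> h5; apply: (sphere_avoid h5).
    by apply/eqP => h6; rewrite -h6 in h5; move: (sphere_uniq h0 h5); lia.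
  by move=> j h6; apply: sphere_lt h0 _; lia.
exact: connect_avoid2 (h _ h1) (h _ h2).
Qed.

(** An edge inside a sphere is impossible: [y] and the parent of [x] would be two neighbours of [x],
    both reachable from [v] without passing [x]. *)
Lemma sphere_edge v i x y : sphere v i x -> e x y -> sphere v i.+1 y \/ (exists2 j, i = j.+1 & sphere v j y).
Proof.
move=> h1 h2.
have h3 : within e i.+1 v y by apply: within_rcons (sphere_within h1) h2.
case: (within_sph h3) => j h4 h5.
have h6 : i <= j.+1.
  rewrite leqNgt; apply/negP => h6; case/negP: (sphere_lt h1 h6).
  by apply: within_rcons (sphere_within h5) _; rewrite forest_sym.
case: (ltngtP i j) => h7.
- by left; have -> : i.+1 = j by lia.
- by right; exists j => //; lia.
- subst j; case: i h1 h3 h4 h5 h6 => [|i] h1 h3 h4 h5 h6.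
    by move: h1 h5 h2; rewrite !sph0 => /eqP <- /eqP <-; rewrite forest_irr.
  exfalso; case: (sphere_parent h1) => w h8 h9.
  have hyw : y = w.
    apply: (@forest_detour x); rewrite 1?forest_sym //.
      by rewrite forest_sym.
    apply: (connect_avoid2 (sphere_avoid h5 _ _) (sphere_avoid h8 _ _)).
    + by apply/eqP => h; move: h2; rewrite h forest_irr.
    + by move=> j hj; apply: sphere_lt h1 _.
    + by apply/eqP => h; move: h9; rewrite h forest_irr.
    + by move=> j hj; apply: sphere_lt h1 _; lia.
  by rewrite hyw in h5; move: (sphere_uniq h5 h8); lia.
Qed.

End Forest.

Lemma connect_within_card (V : finType) (e : rel V) x y : connect e x y -> within e #|V| x y.
Proof.
move=> /connectP[p0 h1 h2]; case: (shortenP h1) h2 => p h3 h4 _ ->.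
apply: (withinW _ (within_last h3)).
by have := max_card (mem (x :: p)); rewrite (card_uniqP h4) /=; lia.
Qed.

Section Leaves.
Variables (V : finType) (e : rel V).
Hypothesis hf : forest e.

Definition deg_in (F : {set V}) (x : V) : nat := #|[set y in F | e x y]|.

(** A vertex farthest from [v] inside [F] has no neighbour farther out, so its neighbours in [F] are
    parents, and a parent is unique. *)
Lemma forest_leaf (F : {set V}) v : v \in F -> exists2 x, x \in F & deg_in F x <= 1.
Proof.
move=> hv; pose g := induced e (mem F); have hg : forest g by apply: induced_forest.
have hb i : [exists x, sphere g v i x] -> i <= #|V|.
  move=> /existsP[x h]; rewrite leqNgt; apply/negP => h1; case/negP: (sphere_lt h h1).
  exact: connect_within_card (within_connect (sphere_within h)).
have h0 : exists i, [exists x, sphere g v i x].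
  by exists 0; apply/existsP; exists v; rewrite sph0.
case: (ex_maxnP h0 hb) => i /existsP[x hx] hm.
have hxF : x \in F.
  case: i hx {hm} => [|i]; first by rewrite sph0 => /eqP <-.
  by move=> /sphere_parent[z _ /and3P[]].
exists x => //; rewrite leqNgt; apply/negP => /card_gt1P[y [z [h1 h2 h3]]].
have hp w : w \in [set y in F | e x y] -> exists2 j, i = j.+1 & sphere g v j w.
  rewrite inE => /andP[h4 h5]; have h6 : g x w by rewrite /g /induced h5 /= hxF.
  case: (sphere_edge hg hx h6) => // h7.
  by move: (hm i.+1); rewrite ltnn => h8; case: notF; apply: h8; apply/existsP; exists w.
case: (hp _ h1) => j1 h4 h5; case: (hp _ h2) => j2 h6 h7.
have h8 : j2 = j1 by lia.
subst j2 i; case/eqP: h3; move: h1 h2; rewrite !inE => /andP[h8 h9] /andP[h10 h11].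
apply: (sphere_parent_uniq hg hx h5 h7); rewrite (forest_sym hg) /g /induced ?h9 ?h11 /= hxF //.
Qed.

(** Induction by removing a leaf: the degree sum drops by at most 1 for the leaf and by at most 1
    for its neighbour. *)
Lemma forest_sum (F : {set V}) : \sum_(x in F) deg_in F x <= 2 * #|F|.
Proof.
move: {2}#|F| (leqnn #|F|) => n; elim: n F => [|n IH] F.
  by rewrite leqn0 cards_eq0 => /eqP ->; rewrite big_set0.
case: (set_0Vmem F) => [->|[v /forest_leaf[x hx h1]]] hn; first by rewrite big_set0.
rewrite (big_setD1 x) //=.
have hF : #|F| = #|F :\ x|.+1 by rewrite (cardsD1 x F) hx.
have : \sum_(i in F :\ x) deg_in F i = \sum_(i in F :\ x) deg_in (F :\ x) i + \sum_(i in F :\ x) e i x.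
  rewrite -big_split; apply: eq_bigr => y; rewrite inE => /andP[hy1 hy2].
  rewrite /deg_in (cardsD1 x) inE hx /= addnC; congr (_ + _).
  by apply: eq_card => z; rewrite !inE andbA.
move=> ->; have : \sum_(i in F :\ x) e i x <= deg_in F x.
  rewrite /deg_in -sum1_card big_mkcond [X in _ <= X]big_mkcond /=; apply: leq_sum => y _.
  by rewrite !inE (forest_sym hf y x); case: (y \in F); case: (e x y); case: (y != x).
by have := IH (F :\ x); lia.
Qed.

(** The average degree is at most 2, so the excess at branching vertices is paid for by vertices of
    degree at most 1, each of which falls short of 2 by at most 2. Hence there are at most twice as
    many branchings as leaves. *)
Lemma forest_ne2 (F : {set V}) :
  #|[set x in F | deg_in F x != 2]| <= 3 * #|[set x in F | deg_in F x <= 1]|.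
Proof.
have h : \sum_(x in F) (deg_in F x + ((deg_in F x <= 1) + (deg_in F x <= 1))) >= \sum_(x in F) (2 + (deg_in F x > 2)).
  by apply: leq_sum => x _; case: (deg_in F x) => [|[|[|]]] //= k; lia.
have hc (P : pred V) : \sum_(x in F) (P x : nat) = #|[set x in F | P x]|.
  rewrite -sum1_card big_mkcond [RHS]big_mkcond /=; apply: eq_bigr => x _.
  by rewrite !inE; case: (x \in F); case: (P x).
move: h; rewrite !big_split /= !hc sum_nat_const.
have : #|[set x in F | deg_in F x != 2]| <=
   #|[set x in F | deg_in F x <= 1]| + #|[set x in F | deg_in F x > 2]|.
  rewrite -cardsUI; apply: leq_trans (leq_addr _ _); apply: subset_leq_card.
  by apply/subsetP => x; rewrite !inE => /andP[-> /=]; lia.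
by have := forest_sum F; lia.
Qed.
End Leaves.

(** * Counting on finite product spaces and the local lemma *)

Lemma card_pair_sum (T1 T2 : finType) (P : T1 -> T2 -> bool) :
  #|[set u : T1 * T2 | P u.1 u.2]| = \sum_(a : T1) #|[set b | P a b]|.
Proof.
have -> : \sum_(a : T1) #|[set b | P a b]| = \sum_(a : T1) \sum_(b : T2) (P a b : nat).
  apply: eq_bigr => a _; rewrite -sum1_card big_mkcond /=; apply: eq_bigr => b _.
  by rewrite inE; case: (P a b).
rewrite pair_bigA /= -sum1_card big_mkcond /=; apply: eq_bigr => u _.
by rewrite inE; case: (P _ _).
Qed.

Section Prob.
Variables (V : finType) (W : finType).
Notation asg := {ffun V -> W}.

Definition depends_on (S : pred V) (E : asg -> bool) : Prop :=
  forall w w' : asg, (forall x, S x -> w x = w' x) -> E w = E w'.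

Definition mix (S : pred V) (w w' : asg) : asg := [ffun x => if S x then w x else w' x].

(* All probability below reduces to this: resampling outside a stopping set S is the involution
   (w, w') |-> (mix w w', mix w' w) on pairs of samples. *)
Lemma swap_card (S : asg -> pred V) (P : asg -> asg -> bool) :
  (forall w w' : asg, (forall x, S w x -> w x = w' x) -> S w' =1 S w) ->
  #|[set u : asg * asg | P u.1 u.2]| =
  #|[set u : asg * asg | P (mix (S u.1) u.1 u.2) (mix (S u.1) u.2 u.1)]|.
Proof.
move=> hS; pose f (u : asg * asg) := (mix (S u.1) u.1 u.2, mix (S u.1) u.2 u.1).
have hS1 w w' : S (mix (S w) w w') =1 S w.
  by apply: hS => x h; rewrite ffunE h.
have fK : involutive f.
  move=> [w w']; rewrite /f /=; congr pair; apply/ffunP => x; rewrite !ffunE hS1;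
  by case: (S w x).
rewrite -(card_imset _ (inv_inj fK)); apply: eq_card => u; rewrite inE.
apply/imsetP/idP => [[v h ->]|h]; last by exists (f u); rewrite ?inE ?fK.
by rewrite -[is_true _]/(is_true (P (f (f v)).1 (f (f v)).2)) fK; rewrite inE in h.
Qed.

Definition fill (r : V -> option W) (w : asg) : asg :=
  [ffun x => if r x is Some a then a else w x].

(** [Q] times the conditional probability of [E] given [r]. The fixed coordinates are overwritten
    rather than removed, so the denominator is always [Q]. *)
Definition cnt (E : asg -> bool) (r : V -> option W) : nat := #|[set w | E (fill r w)]|.

Notation Q := #|{: asg}|.

Lemma cnt_none E : cnt E (fun=> None) = #|[set w | E w]|.
Proof.
apply: eq_card => w; rewrite !inE; congr E; by apply/ffunP => x; rewrite ffunE.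
Qed.

Lemma depends_fill S E r : depends_on S E -> depends_on S (fun w => E (fill r w)).
Proof. by move=> h w w' hw; apply: h => x hx; rewrite !ffunE; case: (r x) => //; apply: hw. Qed.

Lemma cnt_ext S E r r' : depends_on S E -> (forall x, S x -> r x = r' x) -> cnt E r = cnt E r'.
Proof.
move=> h hr; apply: eq_card => w; rewrite !inE; apply: h => x hx.
by rewrite !ffunE hr.
Qed.

Lemma card_pairs (P1 P2 : pred asg) :
  #|[set u : asg * asg | P1 u.1 && P2 u.2]| = #|[set w | P1 w]| * #|[set w | P2 w]|.
Proof.
rewrite -cardsX; apply: eq_card => u; by rewrite !inE.
Qed.

Lemma card_pairs1 (P1 : pred asg) :
  #|[set u : asg * asg | P1 u.1]| = #|[set w | P1 w]| * Q.
Proof.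
have := card_pairs P1 predT; rewrite -cardsT => <-.
by apply: eq_card => u; rewrite !inE andbT.
Qed.

(** Resampling outside [S1] moves [E2] to the second of two independent samples, and the count of
    pairs factorises. *)
Lemma cnt_indep S1 S2 E1 E2 : depends_on S1 E1 -> depends_on S2 E2 ->
  (forall x, S1 x -> ~~ S2 x) ->
  #|[set w | E1 w && E2 w]| * Q = #|[set w | E1 w]| * #|[set w | E2 w]|.
Proof.
move=> h1 h2 h12; rewrite -card_pairs -card_pairs1.
rewrite (@swap_card (fun=> S1) (fun w w' => E1 w && E2 w)) //.
apply: eq_card => u; rewrite !inE; congr (_ && _).
  by apply: h1 => x hx; rewrite ffunE hx.
by apply: h2 => x hx; rewrite ffunE; case h: (S1 x) => //; move: (h12 _ h); rewrite hx.
Qed.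

(* Optional stopping, in counting form. *)
Lemma cnt_reveal (S : asg -> pred V) E r :
  (forall w w' : asg, (forall x, S w x -> w x = w' x) -> S w' =1 S w) ->
  \sum_(w : asg) cnt E (fun x => if r x is Some a then Some a else
                                 if S w x then Some (w x) else None) = cnt E r * Q.
Proof.
move=> hS; rewrite /cnt -card_pairs1 (@swap_card S (fun w w' => E (fill r w))) //.
rewrite (card_pair_sum (fun w w' => E (fill r (mix (S w) w w')))).
apply: eq_bigr => w _; apply: eq_card => w'; rewrite !inE; congr E.
by apply/ffunP => x; rewrite !ffunE; case: (r x) => //; case: (S w x).
Qed.

End Prob.

(** An event has the same probability in every product space that contains the variables it reads:
    exchanging the coordinates matched by [f] and [g] is an involution on pairs of assignments. *)
Lemma cnt_transfer (V V' W : finType) (f : V -> V') (g : V' -> V) (S : pred V) (S' : pred V')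
  (E : {ffun V -> W} -> bool) (E' : {ffun V' -> W} -> bool) :
  (forall x, S x -> S' (f x) /\ g (f x) = x) ->
  (forall x, S' x -> S (g x) /\ f (g x) = x) ->
  (forall (w : {ffun V -> W}) (w' : {ffun V' -> W}), (forall x, S x -> w x = w' (f x)) -> E w = E' w') ->
  #|[set w | E w]| * #|{ffun V' -> W}| = #|[set w | E' w]| * #|{ffun V -> W}|.
Proof.
move=> hf hg hE.
pose h (u : {ffun V -> W} * {ffun V' -> W}) : {ffun V -> W} * {ffun V' -> W} :=
  ([ffun x => if S x then u.2 (f x) else u.1 x], [ffun x => if S' x then u.1 (g x) else u.2 x]).
have hK : involutive h.
  move=> [w w']; rewrite /h /=; congr pair; apply/ffunP => x; rewrite !ffunE.
    by case hx: (S x); rewrite ?hx //; case: (hf _ hx) => -> ->.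
  by case hx: (S' x); rewrite ?hx //; case: (hg _ hx) => -> ->.
have e1 : #|[set w | E w]| * #|{ffun V' -> W}| =
   #|[set u : {ffun V -> W} * {ffun V' -> W} | E u.1]|.
  by rewrite -[#|{ffun V' -> W}|]cardsT -cardsX; apply: eq_card => u; rewrite !inE andbT.
have e2 : #|[set w | E' w]| * #|{ffun V -> W}| =
   #|[set u : {ffun V -> W} * {ffun V' -> W} | E' u.2]|.
  by rewrite mulnC -[#|{ffun V -> W}|]cardsT -cardsX; apply: eq_card => u; rewrite !inE.
rewrite e1 e2 -(card_imset _ (inv_inj hK)); apply: eq_card => u; rewrite inE.
have hh (v : {ffun V -> W} * {ffun V' -> W}) : E v.1 = E' (h v).2.
  by apply: hE => x hx; rewrite /h /= ffunE; case: (hf _ hx) => -> ->.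
apply/imsetP/idP => [[v h1 ->]|h1]; first by move: h1; rewrite inE hh.
by exists (h u); rewrite ?inE ?hK // hh hK.
Qed.

Section LLL.
Variables (V W I : finType) (B : I -> {ffun V -> W} -> bool) (S : I -> pred V) (n2 d : nat).
Notation Q := #|{ffun V -> W}|.
Hypothesis hdep : forall i, depends_on (S i) (B i).
Hypothesis hp : forall i, #|[set w | B i w]| * n2 <= Q.
Hypothesis hQ : 0 < Q.
Definition meets i j := [exists x, S i x && S j x].
Hypothesis hd : forall i, #|[set j | meets i j]| <= d.
Hypothesis hn : 4 * d <= n2.
Hypothesis hn2 : 2 < n2.

Let avoid (T : {set I}) : {set {ffun V -> W}} := [set w | [forall i in T, ~~ B i w]].

Lemma lll_avoidU1 T i : #|avoid T| = #|avoid (i |: T)| + #|avoid T :&: [set w | B i w]|.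
Proof.
rewrite -(cardsID [set w | B i w] (avoid T)) addnC; congr (_ + _).
apply: eq_card => w; rewrite !inE; apply/andP/idP.
  move=> [h1 /forall_inP h2]; apply/forall_inP => j; rewrite !inE => /orP[/eqP -> //|]; exact: h2.
move=> /forall_inP h; split; first by apply: h; rewrite setU11.
by apply/forall_inP => j hj; apply: h; rewrite !inE hj orbT.
Qed.

(** Given that [T] is avoided, [B i] has probability at most [2 / n2]. Without the events that share
    a variable with [i], the rest is independent of [B i]. Leaving them out at most doubles the
    avoiding set: by induction each of these at most [d] events takes away a fraction [2 / n2], and
    [4 * d <= n2]. *)
Lemma lll_step m (T : {set I}) i : #|T| <= m ->
  #|avoid T :&: [set w | B i w]| * n2 <= 2 * #|avoid T|.
Proof.
elim/ltn_ind: m T i => m IH T i hT.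
pose T2 := T :\: [set j | meets i j].
have hsub : avoid T \subset avoid T2.
  apply/subsetP => w; rewrite !inE => /forall_inP h; apply/forall_inP => j.
  by rewrite inE => /andP[_ hj]; apply: h.
have hindep : #|avoid T2 :&: [set w | B i w]| * n2 <= #|avoid T2|.
  have := @cnt_indep V W (S i) (fun x => ~~ S i x) (B i) (fun w => [forall i in T2, ~~ B i w]) (@hdep i).
  have hh : depends_on (fun x => ~~ S i x) (fun w => [forall i in T2, ~~ B i w]).
    move=> w w' hw; apply: eq_forallb_in => j; rewrite !inE => /andP[h1 _]; congr (~~ _).
    apply: (hdep (i := j)) => x hx; apply: hw; apply: contra h1 => h2.
    by apply/existsP; exists x; rewrite h2.
  move=> /(_ hh); have h0 x : S i x -> ~~ ~~ S i x by move=> ->.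
  move=> /(_ h0).
  have -> : #|[set w | B i w && [forall i0 in T2, ~~ B i0 w]]| = #|avoid T2 :&: [set w | B i w]|.
    by apply: eq_card => w; rewrite !inE andbC.
  move=> h1; have := hp i; rewrite -/(avoid T2) in h1 * => h2.
  rewrite -(leq_pmul2r hQ) mulnAC h1 mulnAC [X in _ <= X]mulnC.
  by rewrite leq_mul2r h2 orbT.
have hT2 : #|avoid T2| <= 2 * #|avoid T|.
  case: (set_0Vmem (T :&: [set j | meets i j])) => [h|[j0 hj0]].
    have -> : T2 = T; last by lia.
    rewrite /T2 -[RHS](setID T [set j | meets i j]) h set0U //.
  have hlt : #|T2| < #|T| by rewrite -(cardsID [set j | meets i j] T) /T2 -[X in X < _]add0n ltn_add2r card_gt0; apply/set0Pn; exists j0.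
  have hcov : avoid T2 \subset avoid T :|: \bigcup_(j in T :&: [set j | meets i j]) (avoid T2 :&: [set w | B j w]).
    apply/subsetP => w hw; rewrite inE; case: (boolP (w \in avoid T)) => //= h.
    move: h; rewrite inE negb_forall_in => /exists_inP[j hj]; rewrite negbK => hB.
    apply/bigcupP; exists j; last by rewrite inE hw inE.
    rewrite !inE hj /=; apply: contraT => hm; move: hw; rewrite inE => /forall_inP /(_ j).
    by rewrite !inE hm hj => /(_ isT); rewrite hB.
  have h1 := leq_trans (subset_leq_card hcov) (leq_card_setU _ _).
  have h2 : #|\bigcup_(j in T :&: [set j | meets i j]) (avoid T2 :&: [set w | B j w])| * n2 <=
            d * (2 * #|avoid T2|).
    have hgen (A : {set I}) : #|\bigcup_(j in A) (avoid T2 :&: [set w | B j w])| * n2 <= #|A| * (2 * #|avoid T2|).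
      rewrite -[X in _ <= X]sum_nat_const; elim/big_rec2: _ => [|j n X _ hX]; first by rewrite cards0.
      apply: leq_trans (leq_mul (leq_card_setU _ _) (leqnn n2)) _.
      by rewrite mulnDl leq_add // (IH #|T2|) // (leq_trans hlt hT).
    apply: (leq_trans (hgen _)); rewrite leq_mul2r; apply/orP; right.
    apply: leq_trans (hd i); apply: subset_leq_card; exact: subsetIr.
  have h3 : 2 * (#|\bigcup_(j in T :&: [set j | meets i j]) (avoid T2 :&: [set w | B j w])| * n2) <= n2 * #|avoid T2| by nia.
  nia.
have h4 : #|avoid T :&: [set w | B i w]| <= #|avoid T2 :&: [set w | B i w]|.
  by apply: subset_leq_card; apply: setSI.
nia.
Qed.

(** The conditional probability [2 / n2] is below 1, so adding the events one at a time never
    empties the avoiding set. *)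
Lemma lll : exists w, forall i, ~~ B i w.
Proof.
have h : forall (s : seq I), 0 < #|avoid [set i | i \in s]|.
  elim=> [|i s IH].
    rewrite (_ : avoid _ = setT) ?cardsT //; apply/setP => w; rewrite !inE.
    by apply/forall_inP => j; rewrite inE.
  rewrite (_ : [set j | j \in i :: s] = i |: [set j | j \in s]); last first.
    by apply/setP => j; rewrite !inE.
  have := lll_avoidU1 [set j | j \in s] i.
  have := lll_step i (leqnn #|[set j | j \in s]|).
  nia.
move: (h (enum I)); rewrite card_gt0 => /set0Pn[w]; rewrite inE => /forall_inP hw.
by exists w => i; apply: hw; rewrite inE mem_enum.
Qed.
End LLL.

(** * Partial isomorphisms and the bad events of the given algorithm *)

(** The part of [port_numbering] that survives deleting vertices: in an induced subgraph the degrees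
    shrink while the ports stay. *)
Definition pinj (V : finType) (e : rel V) (pn : V -> V -> nat) : Prop :=
  forall v u w, e v u -> e v w -> pn v u = pn v w -> u = w.

Lemma nbr_atP (V : finType) (e : rel V) (pn : V -> V -> nat) v u p : pinj e pn ->
  reflect (e v u /\ pn v u = p) (nbr_at e pn v p == Some u).
Proof.
move=> hp; rewrite /nbr_at; case: pickP => [w /andP[h1 /eqP h2]|h].
  apply: (iffP eqP) => [[<-] //|[h3 h4]]; congr Some; apply: (hp v) => //; congruence.
by apply: (iffP eqP) => // -[h1 h2]; move: (h u); rewrite h1 h2 eqxx.
Qed.

Lemma nbr_at_Some (V : finType) (e : rel V) (pn : V -> V -> nat) v p u :
  nbr_at e pn v p = Some u -> e v u /\ pn v u = p.
Proof. by rewrite /nbr_at; case: pickP => // w /andP[h1 /eqP h2] [<-]. Qed.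

Lemma nbr_at_pn (V : finType) (e : rel V) (pn : V -> V -> nat) v u : pinj e pn ->
  e v u -> nbr_at e pn v (pn v u) = Some u.
Proof. by move=> hp h; apply/eqP/nbr_atP. Qed.

(** An isomorphism of two labelled balls of radius [k] that respects ports. The maps are total, with
    arbitrary values outside the balls. Locality is always stated as: vertices related by [simf]
    compute the same value. *)
Record simf (L : Type) (V V' : finType) (e : rel V) (pn : V -> V -> nat) (lab : V -> L)
  (e' : rel V') (pn' : V' -> V' -> nat) (lab' : V' -> L)
  (k : nat) (f : V -> V') (g : V' -> V) (v : V) (v' : V') : Prop := Simf {
  sim_ctr : f v = v';
  sim_fwd : forall x, within e k v x -> within e' k v' (f x) /\ g (f x) = x;
  sim_bwd : forall x, within e' k v' x -> within e k v (g x) /\ f (g x) = x;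
  sim_lab : forall x, within e k v x -> lab' (f x) = lab x;
  sim_adj : forall x y, within e k v x -> within e k v y -> e' (f x) (f y) = e x y;
  sim_pn : forall x y, within e k v x -> within e k v y -> e x y -> pn' (f x) (f y) = pn x y }.

Section Sim.
Variables (L : Type) (V V' : finType) (e : rel V) (pn : V -> V -> nat) (lab : V -> L).
Variables (e' : rel V') (pn' : V' -> V' -> nat) (lab' : V' -> L).
Variables (k : nat) (f : V -> V') (g : V' -> V) (v : V) (v' : V').
Hypothesis hs : simf e pn lab e' pn' lab' k f g v v'.

Lemma sim_back : g v' = v.
Proof. by rewrite -(sim_ctr hs); case: (sim_fwd hs (within_refl e k v)). Qed.

Lemma sim_inv : simf e' pn' lab' e pn lab k g f v' v.
Proof.
split; [exact: sim_back|exact: sim_bwd hs|exact: sim_fwd hs|..].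
- by move=> x h; case: (sim_bwd hs h) => h1 h2; rewrite -{2}h2 (sim_lab hs).
- move=> x y h h'; case: (sim_bwd hs h) (sim_bwd hs h') => h1 h2 [h3 h4].
  by rewrite -{2}h2 -{2}h4 (sim_adj hs).
- move=> x y h h' h0; case: (sim_bwd hs h) (sim_bwd hs h') => h1 h2 [h3 h4].
  by rewrite -{2}h2 -{2}h4 (sim_pn hs) // -(sim_adj hs) // h2 h4.
Qed.

Lemma sim_dist a b x y : a + b <= k -> within e a v x -> within e b x y ->
  within e' b (f x) (f y).
Proof.
move=> hk hx; elim: b hk y => [|b IH] hk y; first by rewrite !within0 => /eqP ->.
rewrite withinS => /orP[h|/existsP[z /andP[h1 h2]]].
  by apply: (withinW (leqnSn b)); apply: IH => //; lia.
apply: within_rcons (IH _ _ h1) _; first by lia.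
have hz : within e (a + b) v z by apply: within_add hx h1.
rewrite (sim_adj hs) //; first by apply: (withinW _ hz); lia.
by apply: (withinW _ (within_rcons hz h2)); lia.
Qed.
End Sim.

Section Sim2.
Variables (L : Type) (V V' : finType) (e : rel V) (pn : V -> V -> nat) (lab : V -> L).
Variables (e' : rel V') (pn' : V' -> V' -> nat) (lab' : V' -> L).
Variables (k : nat) (f : V -> V') (g : V' -> V) (v : V) (v' : V').
Hypothesis hs : simf e pn lab e' pn' lab' k f g v v'.

Lemma sim_restrict a b x : within e a v x -> a + b <= k ->
  simf e pn lab e' pn' lab' b f g x (f x).
Proof.
move=> hx hk.
have hw y : within e b x y -> within e k v y.
  by move=> h; apply: (withinW hk); apply: within_add hx h.
split => //.
- move=> y h; split; first by apply: (sim_dist hs hk hx h).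
  by case: (sim_fwd hs (hw _ h)).
- move=> y h.
  have hx' : within e' a v' (f x).
    by rewrite -(sim_ctr hs); apply: (@sim_dist _ _ _ _ _ _ _ _ _ _ _ _ _ _ hs 0 a) => //;
    rewrite ?within_refl //; lia.
  have := sim_dist (sim_inv hs) hk hx' h.
  have hxk : within e k v x by apply: (withinW _ hx); lia.
  case: (sim_fwd hs hxk) => _ ->; split => //.
  by case: (sim_bwd hs (withinW hk (within_add hx' h))).
- by move=> y /hw h; rewrite (sim_lab hs).
- by move=> y z /hw h /hw h'; rewrite (sim_adj hs).
- by move=> y z /hw h /hw h'; apply: (sim_pn hs).
Qed.

Lemma sim_weaken b : b <= k -> simf e pn lab e' pn' lab' b f g v v'.
Proof.
move=> hb; have := @sim_restrict 0 b v (within_refl _ _ _) hb.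
by rewrite (sim_ctr hs).
Qed.

Lemma sim_relabel (L2 : Type) (l2 : V -> L2) (l2' : V' -> L2) b : b <= k ->
  (forall x, within e b v x -> l2' (f x) = l2 x) -> simf e pn l2 e' pn' l2' b f g v v'.
Proof. by move=> hb h; case: (sim_weaken hb) => *; split. Qed.

Lemma sim_nbr a x p : pinj e pn -> pinj e' pn' -> within e a v x -> a < k ->
  nbr_at e' pn' (f x) p = omap f (nbr_at e pn x p).
Proof.
move=> h1 h2 hx ha.
have hxk : within e k v x by apply: (withinW _ hx); lia.
case h: (nbr_at e pn x p) => [u|] /=.
  case: (nbr_at_Some h) => h3 h4; apply/eqP/nbr_atP => //.
  have hu : within e k v u by apply: (withinW _ (within_rcons hx h3)); lia.
  by rewrite (sim_adj hs) // (sim_pn hs).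
case h': (nbr_at e' pn' (f x) p) => [u'|] //; exfalso.
case: (nbr_at_Some h') => h3 h4.
have hs' := sim_restrict hx (b := 1) ltac:(lia).
have := sim_bwd hs' (within_edge h3) => -[h5 h6].
have hu := withinW ha (eq_rect _ (fun m => within e m v (g u')) (within_add hx h5) _ (addn1 a)).
have h7 : e x (g u') by rewrite -(sim_adj hs) ?h6.
have : nbr_at e pn x p == Some (g u') by apply/nbr_atP => //; split=> //; rewrite -(sim_pn hs) ?h6.
by rewrite h.
Qed.

End Sim2.

Lemma sim_id (L : Type) (V : finType) (e e' : rel V) (pn : V -> V -> nat) (lab : V -> L) k v :
  subrel e' e ->
  (forall x y, within e k v x -> within e k v y -> e x y -> e' x y) ->
  simf e pn lab e' pn lab k id id v v.
Proof.
move=> h1 h2.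
have hw j x : j <= k -> within e j v x -> within e' j v x.
  elim: j x => [|j IH] x hj; first by rewrite !within0.
  rewrite withinS => /orP[/IH h|/existsP[y /andP[h3 h4]]].
    by apply: (withinW (leqnSn j)); apply: (h _); lia.
  apply: within_rcons (IH _ _ h3) _; first by lia.
  apply: (h2 _ _ _ _ h4); first by apply: (withinW _ h3); lia.
  by apply: withinW (within_rcons h3 h4).
split => //.
- by move=> x h; split => //; apply: hw.
- by move=> x h; split => //; apply: within_sub h.
- move=> x y h3 h4; apply/idP/idP; [exact: h1|exact: h2].
Qed.

Section Bad.
Variables (Si So : Type) (Pi : LCL Si So) (A : algo Si So) (n0 : nat).
Notation W := ((a_bits A n0).-tuple bool).
Notation inf := (nat * (nat -> option Si))%type.

(** The run of [A n0] with degrees and inputs supplied as labels instead of being read off the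
    graph: inside a pocket a vertex must still act according to its degree in the whole tree. *)
Fixpoint xrun (V : finType) (e : rel V) (pn : V -> V -> nat) (I : V -> inf) (w : V -> W)
  (k : nat) (v : V) {struct k} : a_St A :=
  match k with
  | 0 => a_init A n0 (I v).1 (I v).2 (w v)
  | k'.+1 =>
      a_recv A n0 (xrun e pn I w k' v)
        (fun p => omap (fun u => a_send A n0 (xrun e pn I w k' u) (pn u v)) (nbr_at e pn v p))
  end.

Definition xout (V : finType) (e : rel V) (pn : V -> V -> nat) (I : V -> inf) (w : V -> W)
  (v : V) (p : nat) : So := a_out A n0 (xrun e pn I w (a_time A n0) v) p.

(** Inputs looked up by port are optional values, so the allowed balls are lifted to match them. *)
Definition some_cg (H : cgraph Si So) : cgraph (option Si) So :=
  CGraph (cg_adj H) (cg_ctr H) (fun x y => Some (cg_in H x y)) (cg_out H).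

Definition bad (V : finType) (e : rel V) (pn : V -> V -> nat) (I : V -> inf) (w : V -> W)
  (v : V) : bool :=
  pb (~ exists2 H, List.In H (lcl_C Pi) &
     ball_iso e (fun x y => (I x).2 (pn x y)) (fun x y => xout e pn I w x (pn x y))
       (lcl_r Pi) v (some_cg H)).

(** [lcl_r Pi] for the checked ball and [a_time A n0] for the runs of its vertices; the summand 1
    keeps the radius positive. *)
Definition bad_rad := a_time A n0 + lcl_r Pi + 1.

Lemma xrun_sim (V V' : finType) e pn e' pn' (I : V -> inf) (I' : V' -> inf)
  (w : V -> W) (w' : V' -> W) K f g v v' :
  symmetric e -> pinj e pn -> pinj e' pn' ->
  simf e pn (fun x => (I x, w x)) e' pn' (fun x => (I' x, w' x)) K f g v v' ->
  forall k a x, within e a v x -> a + k <= K ->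
  xrun e' pn' I' w' k (f x) = xrun e pn I w k x.
Proof.
move=> h0 h1 h2 hs; elim=> [|k IH] a x hx hk /=.
  have ha : a <= K by lia.
  by have [-> ->] := sim_lab hs (withinW ha hx).
rewrite (IH a) //; last by lia.
congr a_recv; apply: functional_extensionality => p.
rewrite (sim_nbr hs p h1 h2 hx); last by lia.
case h: (nbr_at e pn x p) => [u|] //=; congr Some.
case: (nbr_at_Some h) => h3 h4; have hu := within_rcons hx h3.
rewrite (IH _ _ hu); last by lia.
congr a_send; apply: (sim_pn hs); last by rewrite h0.
  by apply: (withinW _ hu); lia.
by apply: (withinW _ hx); lia.
Qed.

Lemma ball_iso_sim (Ti To : Type) (V V' : finType) (e : rel V) pn (e' : rel V') pn' (L : Type)
  (l : V -> L) (l' : V' -> L) (inp : V -> V -> Ti) (out : V -> V -> To) inp' out' r f g v v' H :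
  simf e pn l e' pn' l' r f g v v' ->
  (forall x y, within e r v x -> within e r v y -> e x y ->
     inp' (f x) (f y) = inp x y /\ out' (f x) (f y) = out x y) ->
  ball_iso e inp out r v H -> ball_iso e' inp' out' r v' H.
Proof.
move=> hs hio [F [G [h1 h2 h3 h4 h5]]].
exists (F \o g), (f \o G); split => /=.
- by move=> u hu; case: (sim_bwd hs hu) => h6 h7; rewrite h1.
- move=> i; case: (h2 i) => h6 h7; case: (sim_fwd hs h6) => h8 h9.
  by rewrite h9.
- by rewrite (sim_back hs).
- move=> x y hx hy; case: (sim_bwd hs hx) (sim_bwd hs hy) => h6 h7 [h8 h9].
  by rewrite -h4 // -(sim_adj hs) // h7 h9.
- move=> x y hx hy; case: (sim_bwd hs hx) (sim_bwd hs hy) => h6 h7 [h8 h9] he.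
  have he' : e (g x) (g y) by rewrite -(sim_adj hs) // h7 h9.
  by case: (hio _ _ h6 h8 he'); rewrite h7 h9 => -> ->; apply: h5.
Qed.

Lemma bad_sim (V V' : finType) e pn e' pn' (I : V -> inf) (I' : V' -> inf)
  (w : V -> W) (w' : V' -> W) f g v v' :
  symmetric e -> symmetric e' -> pinj e pn -> pinj e' pn' ->
  simf e pn (fun x => (I x, w x)) e' pn' (fun x => (I' x, w' x)) bad_rad f g v v' ->
  bad e pn I w v = bad e' pn' I' w' v'.
Proof.
have main (V1 V2 : finType) e1 pn1 e2 pn2 (I1 : V1 -> inf) (I2 : V2 -> inf)
  (w1 : V1 -> W) (w2 : V2 -> W) f1 g1 v1 v2 H :
  symmetric e1 -> pinj e1 pn1 -> pinj e2 pn2 ->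
  simf e1 pn1 (fun x => (I1 x, w1 x)) e2 pn2 (fun x => (I2 x, w2 x)) bad_rad f1 g1 v1 v2 ->
  ball_iso e1 (fun x y => (I1 x).2 (pn1 x y)) (fun x y => xout e1 pn1 I1 w1 x (pn1 x y)) (lcl_r Pi) v1 H ->
  ball_iso e2 (fun x y => (I2 x).2 (pn2 x y)) (fun x y => xout e2 pn2 I2 w2 x (pn2 x y)) (lcl_r Pi) v2 H.
  move=> h1 h2 h3 hs; have hr : lcl_r Pi <= bad_rad by rewrite /bad_rad; lia.
  apply: (ball_iso_sim (sim_weaken hs hr)) => x y hx hy he.
  have hx' := withinW hr hx; have hy' := withinW hr hy.
  rewrite (sim_pn hs) //; have [-> _] := sim_lab hs hx'; split => //.
  rewrite /xout (xrun_sim h1 h2 h3 hs hx) // /bad_rad; lia.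
move=> h1 h2 h3 h4 hs; apply: pb_iff; split => hn [H hH hb]; apply: hn; exists H => //.
  by apply: main hb; [..|exact: (sim_inv hs)].
by apply: main hb; [..|exact: hs].
Qed.

Lemma bad_local (V : finType) e pn (I : V -> inf) (w w' : V -> W) v :
  symmetric e -> pinj e pn -> (forall x, within e bad_rad v x -> w x = w' x) ->
  bad e pn I w v = bad e pn I w' v.
Proof.
move=> h1 h2 h3; apply: (@bad_sim _ _ _ _ _ _ _ _ _ _ id id) => //.
have hs : simf e pn (fun=> tt) e pn (fun=> tt) bad_rad id id v v by apply: sim_id.
by apply: (sim_relabel hs) => // x h; rewrite h3.
Qed.

Definition sinfo (V : finType) (e : rel V) pn (inp : V -> V -> Si) (v : V) : inf :=
  (deg e v, fun p => omap (inp v) (nbr_at e pn v p)).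

Lemma bad_valid (V : finType) (e : rel V) pn (inp : V -> V -> Si) (w : V -> W) : pinj e pn ->
  lcl_valid Pi e inp (fun x y => xout e pn (sinfo e pn inp) w x (pn x y)) <->
  (forall v, ~~ bad e pn (sinfo e pn inp) w v).
Proof.
move=> hp; set I := sinfo e pn inp.
have hi x y : e x y -> (I x).2 (pn x y) = Some (inp x y).
  by move=> h; rewrite /I /= nbr_at_pn.
split=> h v.
  apply/negP => /pbP; apply; case: (h v) => H h1 [f [g [h2 h3 h4 h5 h6]]]; exists H => //.
  exists f, g; split => // x y hx hy he; case: (h6 x y hx hy he) => h7 h8.
  by rewrite hi //= h7.
move: (h v) => /pbP hn; apply: Classical_Prop.NNPP => hn2; apply: hn => -[H h1 [f [g [h2 h3 h4 h5 h6]]]].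
apply: hn2; exists H => //; exists f, g; split => // x y hx hy he.
by case: (h6 x y hx hy he); rewrite hi // => -[->] ->.
Qed.
End Bad.

Lemma port_pinj (V : finType) (e : rel V) pn : port_numbering e pn -> pinj e pn.
Proof. by move=> h v u w h1 h2 h3; case: (h v) => _; apply. Qed.

Lemma tree_forest (V : finType) (e : rel V) : is_tree e -> forest e.
Proof. by case. Qed.

(** * The ball around a vertex as a small tree of its own *)

Section Subtree.
Variables (V : finType) (e : rel V) (pn : V -> V -> nat) (D k : nat) (v : V).
Hypotheses (ht : is_tree e) (hD : max_deg_le e D) (hpn : port_numbering e pn).

(** Radius [k + 1], so that the vertices up to distance [k] keep all their neighbours and hence
    their degree. *)
Definition ball_type : finType := {x : V | within e k.+1 v x}.
Definition ball_ctr : ball_type := exist _ v (within_refl e k.+1 v).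
Definition ball_edge : rel ball_type := fun a b => e (val a) (val b).
(** At the rim neighbours are lost and the old ports may exceed the new degree; there the ports are
    numbered afresh. *)
Definition ball_port (a b : ball_type) : nat :=
  if within e k v (val a) then pn (val a) (val b) else index b (enum [pred c | ball_edge a c]).
Definition to_ball (x : V) : ball_type := insubd ball_ctr x.

Lemma to_ballK x : within e k.+1 v x -> val (to_ball x) = x.
Proof. by move=> h; rewrite /to_ball val_insubd h. Qed.

Lemma st_card : 0 < #|ball_type| <= D.+2 ^ k.+1.
Proof.
apply/andP; split; first by apply/card_gt0P; exists ball_ctr.
rewrite card_sig; apply: leq_trans (ball_card hD k.+1 v); apply: eq_leq.
by apply: eq_card => x; rewrite !inE.
Qed.

Lemma st_within j a b : within ball_edge j a b -> within e j (val a) (val b).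
Proof.
elim: j b => [|j IH] b; first by rewrite !within0 => /eqP ->.
rewrite !withinS => /orP[/IH -> //|/existsP[c /andP[/IH h1 h2]]].
by apply/orP; right; apply/existsP; exists (val c); rewrite h1.
Qed.

Lemma st_within2 j x : j <= k.+1 -> within e j v x -> within ball_edge j ball_ctr (to_ball x).
Proof.
elim: j x => [|j IH] x hj.
  by rewrite !within0 => /eqP <-; rewrite -val_eqE /= to_ballK ?within_refl.
rewrite withinS => /orP[h|/existsP[y /andP[h1 h2]]].
  by apply: (withinW (leqnSn j)); apply: IH => //; lia.
apply: within_rcons (IH _ _ h1) _; first by lia.
have h3 : within e k.+1 v y by apply: (withinW _ h1); lia.
have h4 : within e k.+1 v x by apply: (withinW _ (within_rcons h1 h2)); lia.
by rewrite /ball_edge !to_ballK.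
Qed.

Lemma st_tree : is_tree ball_edge.
Proof.
case: (ht) => [[hi hs] hc hn]; split.
- by split => [a|a b]; rewrite /ball_edge ?hi // hs.
- have hs' : symmetric ball_edge by move=> a b; rewrite /ball_edge hs.
  have h0 b : connect ball_edge ball_ctr b.
    have := st_within2 (leqnn _) (valP b); rewrite /to_ball valKd; exact: within_connect.
  move=> a b; apply: connect_trans (h0 b).
  by rewrite (sym_connect_sym hs').
- move=> [a [p [h1 h2 h3 h4]]]; apply: hn; exists (val a), (map val p); split.
  + by rewrite path_map.
  + by rewrite -map_cons (map_inj_uniq val_inj).
  + by rewrite size_map.
  + by rewrite last_map.
Qed.

Lemma st_deg_le : max_deg_le ball_edge D.
Proof.
move=> a; apply: leq_trans (hD (val a)); rewrite /deg -(card_image val_inj); apply: subset_leq_card.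
by apply/subsetP => x /imageP[b h ->].
Qed.

Lemma st_deg x : within e k v x -> deg ball_edge (to_ball x) = deg e x.
Proof.
move=> hx; have hx' : within e k.+1 v x by apply: (withinW _ hx).
rewrite /deg -(card_image val_inj); apply: eq_card => y; rewrite inE.
apply/imageP/idP => [[b h ->]|h]; first by move: h; rewrite inE /ball_edge to_ballK.
have hy := within_rcons hx h.
by exists (to_ball y); rewrite ?to_ballK // inE /ball_edge !to_ballK.
Qed.

Lemma st_port : port_numbering ball_edge ball_port.
Proof.
move=> a; rewrite /ball_port; case: (boolP (within e k v (val a))) => ha.
  have haa : a = to_ball (val a) by rewrite /to_ball valKd.
  case: (hpn (val a)) => h1 h2; split.
    by move=> b hb; rewrite haa st_deg // -haa; apply: h1.
  by move=> b c hb hc h; apply: val_inj; apply: h2.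
split.
  by move=> b hb; rewrite /deg cardE index_mem mem_enum.
move=> b c hb hc h; rewrite -(@nth_index _ a b (enum [pred c | ball_edge a c])) ?mem_enum // h.
by rewrite nth_index // mem_enum.
Qed.

Lemma st_nbr x p : within e k v x ->
  nbr_at ball_edge ball_port (to_ball x) p = omap to_ball (nbr_at e pn x p).
Proof.
move=> hx; have hx' : within e k.+1 v x by apply: (withinW _ hx).
have h1 := port_pinj st_port; have h2 := port_pinj hpn.
case h: (nbr_at e pn x p) => [u|] /=.
  case: (nbr_at_Some h) => h3 h4; have hu := within_rcons hx h3.
  by apply/eqP/nbr_atP => //; rewrite /ball_edge /ball_port !to_ballK // hx.
case h': (nbr_at ball_edge ball_port (to_ball x) p) => [b|] //; exfalso.
case: (nbr_at_Some h'); rewrite /ball_edge /ball_port !to_ballK // hx => h3 h4.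
suff : nbr_at e pn x p == Some (val b) by rewrite h.
by apply/nbr_atP.
Qed.

Lemma st_sim (Si : Type) (inp : V -> V -> Si) :
  simf e pn (sinfo e pn inp) ball_edge ball_port (sinfo ball_edge ball_port (fun a b => inp (val a) (val b))) k to_ball val v ball_ctr.
Proof.
have hw x : within e k v x -> within e k.+1 v x by apply: withinW.
split.
- by apply: val_inj; rewrite to_ballK // within_refl.
- by move=> x hx; split; [apply: st_within2|rewrite to_ballK ?hw].
- by move=> a /st_within ha; split => //; rewrite /to_ball valKd.
- move=> x hx; rewrite /sinfo st_deg //; congr pair; apply: functional_extensionality => p.
  rewrite st_nbr //; case h: (nbr_at e pn x p) => [u|] //=; case: (nbr_at_Some h) => h1 _.
  by rewrite (to_ballK (hw _ hx)) (to_ballK (within_rcons hx h1)).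
- by move=> x y hx hy; rewrite /ball_edge !to_ballK ?hw.
- by move=> x y hx hy _; rewrite /ball_port !to_ballK ?hw // hx.
Qed.
End Subtree.

Section BadProb.
Variables (Si So : Type) (D : nat) (Pi : LCL Si So) (A : algo Si So) (n0 : nat).
Notation W := ((a_bits A n0).-tuple bool).

Definition fails_rarely : Prop := forall (V : finType) (e : rel V) pn (inp : V -> V -> Si),
  0 < #|V| <= n0 -> is_tree e -> max_deg_le e D -> port_numbering e pn ->
  #|[set beta : {ffun V -> W} | pb (~ lcl_valid Pi e inp (outl A n0 e pn inp beta))]| * n0
    <= #|{ffun V -> W}|.

Lemma xrun_exec (V : finType) (e : rel V) pn (inp : V -> V -> Si) (w : V -> W) k v :
  xrun e pn (sinfo e pn inp) w k v = exec A n0 e pn inp w k v.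
Proof.
elim: k v => [|k IH] v //=; rewrite IH; congr a_recv.
apply: functional_extensionality => p; case: (nbr_at _ _ _ _) => //= u; by rewrite IH.
Qed.

Hypothesis hA : fails_rarely.
Hypothesis hn0 : D.+2 ^ (bad_rad Pi A n0).+1 <= n0.

(** The guarantee for parameter [n0] concerns only trees with at most [n0] vertices, while [V] may
    be much larger. The event reads only a ball, which is such a tree, and its probability is
    transferred from there. *)
Lemma bad_prob (V : finType) (e : rel V) pn (inp : V -> V -> Si) v :
  is_tree e -> max_deg_le e D -> port_numbering e pn ->
  #|[set w : {ffun V -> W} | bad Pi e pn (sinfo e pn inp) w v]| * n0 <= #|{ffun V -> W}|.
Proof.
move=> ht hD hpn; set k := bad_rad Pi A n0.
pose V' := ball_type e k v; pose E' := @ball_edge V e k v; pose P' := @ball_port V e pn k v.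
pose inp' (a b : V') := inp (val a) (val b).
have ht' : is_tree E' by apply: st_tree.
have hpn' : port_numbering E' P' by apply: st_port.
have hs : simf e pn (sinfo e pn inp) E' P' (sinfo E' P' inp') k (@to_ball V e k v) val v (@ball_ctr V e k v).
  exact: st_sim.
have hbad (w : {ffun V -> W}) (w' : {ffun V' -> W}) :
  (forall x, within e k v x -> w x = w' (@to_ball V e k v x)) ->
  bad Pi e pn (sinfo e pn inp) w v = bad Pi E' P' (sinfo E' P' inp') w' (@ball_ctr V e k v).
  move=> hw; apply: (bad_sim (f := @to_ball V e k v) (g := val)).
  - by case: ht => [[]].
  - by case: ht' => [[]].
  - exact: port_pinj.
  - exact: port_pinj.
  by apply: (sim_relabel hs) => // x hx; rewrite (sim_lab hs) // hw.
have := @cnt_transfer V V' W _ _ (within e k v) (within E' k (@ball_ctr V e k v)) _ _ (sim_fwd hs) (sim_bwd hs) hbad.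
set nb := #|[set w : {ffun V -> W} | _]|; set nb' := #|[set w : {ffun V' -> W} | _]| => h1.
have hc : nb' * n0 <= #|{ffun V' -> W}|.
  have hcard : 0 < #|{: V'}| <= n0.
    by case/andP: (@st_card V e D k v hD) => h2 h3; rewrite h2 (leq_trans h3).
  apply: leq_trans (hA inp' hcard ht' (@st_deg_le V e D k v hD) hpn'); rewrite leq_mul2r; apply/orP; right.
  apply: subset_leq_card; apply/subsetP => w; rewrite !inE => hb; apply/pbP => hv.
  have : ~~ bad Pi E' P' (sinfo E' P' inp') w (ball_ctr e k v); last by rewrite hb.
  have hvv : lcl_valid Pi E' inp' (fun x y => xout E' P' (sinfo E' P' inp') w x (P' x y)).
    rewrite (_ : (fun x y => _) = outl A n0 E' P' inp' w) //.
    apply: functional_extensionality => x; apply: functional_extensionality => y.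
    by rewrite /outl -xrun_exec.
  by apply (bad_valid Pi inp' w (port_pinj hpn')).
have hpos : 0 < #|{ffun V' -> W}|.
  by apply/card_gt0P; exists [ffun=> [tuple of nseq (a_bits A n0) false]].
rewrite -(leq_pmul2r hpos) mulnAC h1 mulnAC [X in _ <= X]mulnC leq_mul2r hc orbT //.
Qed.
End BadProb.

(** * Pre-shattering *)

Section PreShatter.
Variables (V W : finType) (e : rel V) (R n1 : nat) (B : V -> {ffun V -> W} -> bool).
Variables (c : V -> nat) (w : V -> W).
Notation Q := #|{ffun V -> W}|.

Definition unlikely (n : nat) (r : V -> option W) (v : V) : bool := cnt (B v) r * n <= Q.

Definition upd (r : V -> option W) (u : V) (a : W) : V -> option W :=
  fun x => if x == u then Some a else r x.

(* the values fixed so far, and which variables are frozen *)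
Definition pstate : Type := ((V -> option W) * (V -> bool))%type.

Definition tries (j : nat) (s : pstate) (u : V) : bool := (c u == j) && ~~ s.2 u.

Definition trips (j : nat) (s : pstate) (u : V) : bool :=
  tries j s u && [exists v, within e R u v && ~~ unlikely n1 (upd s.1 u (w u)) v].

Definition pstep (j : nat) (s : pstate) : pstate :=
  (fun u => if tries j s u && ~~ trips j s u then Some (w u) else s.1 u,
   fun x => s.2 x || [exists u, within e (2 * R) u x && trips j s u]).

Fixpoint prun (j : nat) : pstate :=
  if j is j'.+1 then pstep j' (prun j') else (fun=> None, fun=> false).

(** Includes variables that were tried and rejected: the run depends on their samples too, so a
    stopping set must contain them. *)
Fixpoint revealed (j : nat) (u : V) : bool :=
  if j is j'.+1 then revealed j' u || tries j' (prun j') u else false.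

(** The tentative value that makes [v] too likely is not kept in the state; this records that it
    occurred. *)
Fixpoint tripped (j : nat) (v : V) : bool :=
  if j is j'.+1 then tripped j' v ||
    [exists u, [&& within e R u v, tries j' (prun j') u & ~~ unlikely n1 (upd (prun j').1 u (w u)) v]]
  else false.

End PreShatter.

Section PreShatterInv.
Variables (V W : finType) (e : rel V) (R n0 n1 : nat) (B : V -> {ffun V -> W} -> bool).
Variables (c : V -> nat).
Notation Q := #|{ffun V -> W}|.
Hypothesis hsym : symmetric e.
Hypothesis hdep : forall v, depends_on (within e R v) (B v).
Hypothesis hcol : forall x y, within e (2 * R) x y -> c x = c y -> x = y.
Hypothesis hn : n1 <= n0.
Hypothesis hp : forall v, #|[set w | B v w]| * n0 <= Q.
Variable w : V -> W.

Notation run := (prun e R n1 B c w).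
Notation rv := (revealed e R n1 B c w).
Notation tp := (tripped e R n1 B c w).
Notation unlikely := (unlikely B n1).

Lemma ball2 x y v : within e R v x -> within e R v y -> within e (2 * R) x y.
Proof. by rewrite (within_sym hsym) => h1 h2; rewrite mul2n -addnn; apply: within_add h1 h2. Qed.

(** Equal colours are more than [2 * R] apart, so a step tries at most one variable of an event, and
    keeps it only if the event stays unlikely. *)
Lemma prun_unlikely j v : unlikely (run j).1 v.
Proof.
elim: j v => [|j IH] v.
  by rewrite /unlikely /= cnt_none; apply: leq_trans (hp v); rewrite leq_mul2l hn orbT.
case: (pickP [pred u | [&& within e R v u, tries c j (run j) u & ~~ trips e R n1 B c w j (run j) u]]) => [u0 /and3P[h1 h2 h3]|h0].
  have : unlikely (upd (run j).1 u0 (w u0)) v.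
    move: h3; rewrite /trips h2 negb_exists => /forallP /(_ v).
    by rewrite (within_sym hsym) h1 /= negbK.
  rewrite /unlikely (@cnt_ext _ _ (within e R v) _ _ (run j.+1).1) // => x hx /=.
  rewrite /upd; case: (x =P u0) => [->|hne]; first by rewrite h2 h3.
  case: ifP => // /andP[h4 _]; case: hne; apply: hcol (ball2 hx h1) _.
  by move: h2 h4 => /andP[/eqP -> _] /andP[/eqP ->].
rewrite /unlikely (@cnt_ext _ _ (within e R v) _ _ (run j).1) //; first exact: IH.
by move=> x hx /=; case: ifP => // h; move: (h0 x); rewrite /= hx h.
Qed.

Lemma prun_val j u a : (run j).1 u = Some a -> a = w u /\ rv j u.
Proof.
elim: j => [|j IH] //=; case: ifP => [/andP[h _] [<-]|_ /IH[-> ->]] //.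
by rewrite h orbT.
Qed.

(* A trip freezes everything near it, so an event that can still trip sees only values that were kept. *)
Lemma frozen_or_set j v : (forall x, within e R v x -> (run j).2 x) \/
  (forall x, within e R v x -> rv j x -> (run j).1 x = Some (w x)).
Proof.
elim: j => [|j IH]; first by right.
case: IH => [IH|IH]; first by left => x hx /=; rewrite IH.
case: (pickP [pred u | within e R v u && trips e R n1 B c w j (run j) u]) => [u0 /andP[h1 h2]|h0].
  left => x hx /=; apply/orP; right; apply/existsP; exists u0; rewrite h2 andbT.
  exact: ball2 h1 hx.
right => x hx /= /orP[/IH h|h]; first by rewrite h //; case: ifP.
by move: (h0 x); rewrite /= hx /= h => ->.
Qed.

(** Turns the moment of the trip into a statement about the final revealed set: before the trip
    every revealed variable near [v] had kept its sample, and after it the ball of [v] is frozen, so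
    nothing more is revealed there. *)
Lemma tripped_spec j v : tp j v ->
  (forall x, within e R v x -> (run j).2 x) /\
  ~~ unlikely (fun x => if rv j x then Some (w x) else None) v.
Proof.
elim: j => [|j IH] //= /orP[/IH[h1 h2]|/existsP[u /and3P[h1 h2 h3]]].
  split; first by move=> x hx; rewrite h1.
  move: h2; rewrite /unlikely (@cnt_ext _ _ (within e R v) _ _ (fun x => if rv j x then Some (w x) else None)) //.
  by move=> x hx; rewrite /tries h1 // andbF orbF.
rewrite (within_sym hsym) in h1.
have ht : trips e R n1 B c w j (run j) u.
  by rewrite /trips h2; apply/existsP; exists v; rewrite (within_sym hsym) h1 h3.
split.
  move=> x hx; apply/orP; right; apply/existsP; exists u; rewrite ht andbT.
  exact: ball2 h1 hx.
move: h3; rewrite /unlikely.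
rewrite (@cnt_ext _ _ (within e R v) _ _ (upd (run j).1 u (w u))) //.
move=> x hx; rewrite /upd; case: (x =P u) => [->|hne]; first by rewrite h2 orbT.
case: (frozen_or_set j v) => h.
  by move: h2; rewrite /tries h // andbF.
have -> : tries c j (run j) x = false.
  apply/negP => h4; apply: hne; apply: hcol (ball2 hx h1) _.
  by move: h2 h4 => /andP[/eqP -> _] /andP[/eqP ->].
rewrite orbF; case hr: (rv j x); first by rewrite h.
by case h5: ((run j).1 x) => [a|] //; case: (prun_val h5) => _; rewrite hr.
Qed.

Lemma frozen_tripped j x : (run j).2 x -> exists2 v, tp j v & within e (3 * R) v x.
Proof.
elim: j => [|j IH] //= /orP[/IH[v h1 h2]|/existsP[u /andP[h1 /andP[h2 /existsP[v /andP[h3 h4]]]]]].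
  by exists v; rewrite ?h1.
exists v; first by apply/orP; right; apply/existsP; exists u; rewrite h3 h2 h4.
rewrite (within_sym hsym) in h3.
by rewrite (_ : 3 * R = R + 2 * R); [apply: within_add h3 h1|lia].
Qed.

Lemma prun_done j u : c u < j -> (run j).1 u != None \/ (run j).2 u.
Proof.
elim: j => [|j IH] //=; rewrite ltnS leq_eqVlt => /orP[h|/IH[h|h]].
- case hf: ((run j).2 u); first by right.
  case ht: (trips e R n1 B c w j (run j) u).
    by right; apply/orP; right; apply/existsP; exists u; rewrite within_refl ht.
  by left; rewrite /tries h hf.
- by left; case: ifP.
- by right; rewrite h.
Qed.

Lemma unset_tripped j u : c u < j -> (run j).1 u = None ->
  exists2 v, tp j v & within e (3 * R) v u.
Proof. by move=> h1 h2; case: (prun_done h1); rewrite ?h2 // => /frozen_tripped. Qed.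

End PreShatterInv.

Section PreShatterProb.
Variables (V W : finType) (e : rel V) (R n0 n1 : nat) (B : V -> {ffun V -> W} -> bool).
Variables (c : V -> nat).
Notation asg := {ffun V -> W}.
Notation Q := #|{ffun V -> W}|.
Hypothesis hsym : symmetric e.
Hypothesis hdep : forall v, depends_on (within e R v) (B v).
Hypothesis hcol : forall x y, within e (2 * R) x y -> c x = c y -> x = y.
Hypothesis hn : n1 <= n0.
Hypothesis hp : forall v, #|[set w | B v w]| * n0 <= Q.
Hypothesis hQ : 0 < Q.

Lemma revealed_le (w : V -> W) i j u : i <= j -> revealed e R n1 B c w i u -> revealed e R n1 B c w j u.
Proof. by move=> /subnK <-; elim: (j - i) => //= m IH h; rewrite IH. Qed.

(** Which variable is tried next, and whether it trips, is decided from samples already revealed;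
    hence two samples agreeing there have the same run. *)
Lemma revealed_stopping K (w w' : asg) :
  (forall x, revealed e R n1 B c w K x -> w x = w' x) ->
  revealed e R n1 B c w' K =1 revealed e R n1 B c w K.
Proof.
move=> h.
have hst j : j <= K -> prun e R n1 B c w' j = prun e R n1 B c w j.
  elim: j => [|j IH] hj; first by [].
  rewrite [LHS]/= [RHS]/= IH; last by lia.
  have ht u : trips e R n1 B c w' j (prun e R n1 B c w j) u = trips e R n1 B c w j (prun e R n1 B c w j) u.
    rewrite /trips; case htr: (tries _ _ _ _) => //=; rewrite h //.
    by apply: (revealed_le hj); rewrite /= htr orbT.
  rewrite /pstep; congr pair; apply: functional_extensionality => u.
    rewrite ht; case: ifP => // /andP[h1 _]; rewrite h //.
    by apply: (revealed_le hj); rewrite /= h1 orbT.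
  by congr orb; apply: eq_existsb => x; rewrite ht.
move=> x; elim: {1 3 4}K (leqnn K) => [|j IH] hj; first by [].
have hj' : j <= K by lia.
by rewrite [LHS]/= [RHS]/= IH // hst.
Qed.

Definition sep (l : seq V) : Prop :=
  forall x y, x \in l -> y \in l -> within e (2 * R) x y -> x = y.

Lemma sep_cons v l : sep (v :: l) -> sep l.
Proof. by move=> h x y hx hy; apply: h; rewrite inE ?hx ?hy orbT. Qed.

Let ballU (l : seq V) : pred V := fun x => has (fun v => within e R v x) l.

Lemma all_depends l : depends_on (ballU l) (fun w => all (fun v => B v w) l).
Proof.
move=> w w' h; apply: eq_in_all => v hv; apply: (hdep (v := v)) => x hx.
by apply: h; apply/hasP; exists v.
Qed.

Lemma all_indep v l (r : V -> option W) : uniq (v :: l) -> sep (v :: l) ->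
  cnt (fun w => all (fun v => B v w) (v :: l)) r * Q = cnt (B v) r * cnt (fun w => all (fun v => B v w) l) r.
Proof.
move=> /= /andP[hv _] hs.
apply: (cnt_indep (depends_fill r (hdep (v:=v))) (depends_fill r (@all_depends l))).
move=> x hx; apply/negP => /hasP[u hu hux].
have : v = u.
  apply: hs; rewrite ?mem_head // ?inE ?hu ?orbT //.
  by rewrite mul2n -addnn; apply: within_add hx _; rewrite (within_sym hsym).
by move=> h; rewrite h hu in hv.
Qed.

Lemma all_small l : uniq l -> sep l ->
  #|[set w | all (fun v => B v w) l]| * n0 ^ size l <= Q.
Proof.
elim: l => [|v l IH] hu hs; first by rewrite muln1 max_card.
have := all_indep (fun=> None) hu hs; rewrite !cnt_none => h1.
have h2 := hp v; have := IH (proj2 (andP hu)) (sep_cons hs).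
set a := #|_| in h1 *; set b := #|_| in h1 h2; set d := #|_| in h1 * => h3.
rewrite -(leq_pmul2r hQ) /= expnS mulnAC h1.
by rewrite mulnACA leq_mul.
Qed.

Lemma all_large l (r : V -> option W) : uniq l -> sep l -> (forall v, v \in l -> ~~ unlikely B n1 r v) ->
  Q <= cnt (fun w => all (fun v => B v w) l) r * n1 ^ size l.
Proof.
elim: l => [|v l IH] hu hs hc.
  by rewrite muln1 /cnt leq_eqVlt -cardsT; apply/orP; left; apply/eqP; apply: eq_card => w; rewrite !inE.
have h1 := all_indep r hu hs.
have h2 := hc v (mem_head _ _); rewrite /unlikely -ltnNge in h2.
have := IH (proj2 (andP hu)) (sep_cons hs) (fun u hu => hc u (mem_behead (s := v :: l) hu)).
move: h1 h2; set a := cnt _ _; set b := cnt _ _; set d := cnt _ _ => h1 h2 h3.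
rewrite -(leq_pmul2r hQ) /= expnS mulnAC h1 mulnACA leq_mul //.
exact: ltnW.
Qed.

(* The revealed variables form a stopping set on which every tripped event keeps conditional
   probability above 1/n1; disjointness of the supports turns this into a product bound. *)
Lemma tripped_prob K l : uniq l -> sep l ->
  #|[set w : asg | all (tripped e R n1 B c w K) l]| * n0 ^ size l <= Q * n1 ^ size l.
Proof.
move=> hu hs.
have h1 := @cnt_reveal V W (fun w : asg => revealed e R n1 B c w K) (fun w => all (fun v => B v w) l)
  (fun=> None) (@revealed_stopping K).
set T := [set w : asg | _].
have h2 : #|T| * Q <= (\sum_(w : asg) cnt (fun w => all (fun v => B v w) l)
    (fun x => if revealed e R n1 B c w K x then Some (w x) else None)) * n1 ^ size l.
  rewrite -sum_nat_const big_distrl /= big_mkcond; apply: leq_sum => w _.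
  case: ifP => //; rewrite inE => /allP hall; apply: all_large => // v hv.
  by case: (tripped_spec hsym hdep hcol (hall _ hv)).
rewrite h1 cnt_none in h2.
have h3 : #|T| <= #|[set w | all (fun v => B v w) l]| * n1 ^ size l.
  by rewrite -(leq_pmul2r hQ) [X in _ <= X]mulnAC.
have h4 := all_small hu hs.
apply: (leq_trans (leq_mul h3 (leqnn _))); rewrite mulnAC leq_mul2r h4 orbT //.
Qed.
End PreShatterProb.

(** * Large pockets are unlikely *)

Lemma connect_boundary (V : finType) (e : rel V) (P : pred V) x y :
  connect e x y -> P x -> ~~ P y -> exists a b, [/\ e a b, P a, ~~ P b & connect e x a].
Proof.
move=> /connectP[p hp ->]; elim: p x hp => [|z p IH] x /=; first by move=> _ ->.
move=> /andP[h1 h2] hx hy; case hz: (P z); last by exists x, z; rewrite h1 hx hz connect0.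
by case: (IH _ h2 hz hy) => a [b [h3 h4 h5 h6]]; exists a, b; split => //;
  apply: connect_trans (connect1 h1) h6.
Qed.

Section Pocket.
Variables (V : finType) (e : rel V) (D R : nat) (U tp : pred V).
Hypothesis hsym : symmetric e.
Hypothesis hD : max_deg_le e D.
Hypothesis hU : forall x, U x -> exists2 v, tp v & within e (5 * R) v x.

Definition pocket (x : V) : {set V} := [set y | connect (induced e U) x y].

(** Evidence for a large pocket in a form that is easy to count: a walk with repetitions through [k]
    distinct, mutually far apart tripped vertices, playing the role of a traversal of a tree on
    them. *)
Definition witness_walk (k : nat) (x0 : V) (p : seq V) : Prop :=
  [/\ path (within e (14 * R + 1)) x0 p, size p = 2 * k.-1,
      #|[set x in x0 :: p]| = k, all tp (x0 :: p) & sep e R (x0 :: p)].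

(* A new vertex is inserted next to v as the detour v, v', v; hence walks of length 2 (k - 1). *)
Lemma detour (r : rel V) x0 p v v' : path r x0 p -> v \in x0 :: p -> r v v' -> r v' v ->
  exists p', [/\ path r x0 p', size p' = (size p).+2 & (x0 :: p') =i v' :: x0 :: p].
Proof.
move=> hp hv h1 h2; move: hv; rewrite inE => /orP[/eqP hv|hv].
  subst v; exists (v' :: x0 :: p); rewrite /= h1 h2 hp; split => // y.
  by rewrite !inE; case: (y == x0); rewrite ?orbT.
case/splitPr: hv hp => p1 p2; rewrite cat_path /= => /and3P[h3 h4 h5].
exists (p1 ++ [:: v, v', v & p2]); split.
- by rewrite cat_path /= h3 h4 h1 h2 h5.
- by rewrite !size_cat /=; lia.
- move=> y; rewrite !(inE, mem_cat).
  by case: (y == x0); case: (y \in p1); case: (y == v); case: (y == v'); case: (y \in p2).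
Qed.

(** Greedy choice. As long as balls of radius [7 * R] around the chosen vertices do not cover the
    pocket, some edge of the pocket leaves the covered part. A tripped vertex within [5 * R] of its
    outer end is more than [2 * R] from all chosen ones, and within [7 * R + 1 + 5 * R] of one of
    them, which [14 * R + 1] bounds. *)
Lemma pocket_walk x k : U x -> 0 < k -> k * D.+2 ^ (7 * R) < #|pocket x| ->
  exists x0 p, witness_walk k x0 p.
Proof.
move=> hx; set C := pocket x.
have hcov v : #|[set y | within e (7 * R) v y]| <= D.+2 ^ (7 * R) by apply: ball_card.
(* That [x0] is close to a vertex of the pocket is added so that the covered part is never empty. *)
suff main : 0 < k -> k * D.+2 ^ (7 * R) < #|C| -> exists x0 p, witness_walk k x0 p /\
   exists2 y, y \in C & within e (5 * R) x0 y.
  by move=> h1 h2; case: (main h1 h2) => x0 [p [h _]]; exists x0, p.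
elim: k => [|k IH] // _ hk.
case: (posnP k) => hk0.
  subst k; case: (hU hx) => v h1 h2; exists v, [::]; split; last first.
    by exists x => //; rewrite inE connect0.
  split => //=; rewrite ?h1 //.
    by rewrite (_ : [set _ in _] = [set v]) ?cards1 //; apply/setP => y; rewrite !inE.
  by move=> a b; rewrite !inE => /eqP -> /eqP ->.
have hk' : k * D.+2 ^ (7 * R) < #|C| by apply: leq_ltn_trans hk; rewrite leq_mul2r leqnSn orbT.
case: (IH hk0 hk') => x0 [p [[h1 h2 h3 h4 h5] [y0 hy0 hy0x]]].
pose cov y := has (fun v => within e (7 * R) v y) (x0 :: p).
have [y hyC hyn] : exists2 y, y \in C & ~~ cov y.
  have : ~~ (C \subset \bigcup_(v in [set v in x0 :: p]) [set y | within e (7 * R) v y]).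
    apply/negP => /subset_leq_card h6.
    have h7 := @card_bigcup_le V V [set v in x0 :: p] (fun v => [set y | within e (7 * R) v y]) (D.+2 ^ (7 * R)) (fun v _ => hcov v).
    by rewrite h3 in h7; lia.
  case/subsetPn => y h6 h7; exists y => //; apply: contra h7 => /hasP[v hv h8].
  by apply/bigcupP; exists v; rewrite inE.
have hcy0 : cov y0 by apply/hasP; exists x0; rewrite ?mem_head // (withinW _ hy0x) //; clear; lia.
have hc : connect (induced e U) y0 y.
  move: hy0 hyC; rewrite !inE => h6; apply: connect_trans.
  by rewrite (sym_connect_sym (induced_sym _ hsym)).
case: (connect_boundary hc hcy0 hyn) => c1 [c2 [/and3P[h6 _ h7] /hasP[v hv h8] h9 _]].
case: (hU h7) => v' h10 h11.
have hfar u : u \in x0 :: p -> ~~ within e (2 * R) u v'.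
  move=> hu; apply: contra h9 => h; apply/hasP; exists u => //.
  by apply: (withinW _ (within_add h h11)); clear; lia.
have hL : within e (14 * R + 1) v v'.
  rewrite (within_sym hsym) in h11.
  by apply: (withinW _ (within_add (within_rcons h8 h6) h11)); clear; lia.
have hL' : within e (14 * R + 1) v' v by rewrite (within_sym hsym).
case: (detour h1 hv hL hL') => p' [h12 h13 h14].
exists x0, p'; split; last by exists y0.
have hv' : v' \notin x0 :: p.
  by apply/negP => h; move: (hfar _ h); rewrite within_refl.
split => //.
- by rewrite h13 h2; case: (k) hk0 => // m _ /=; clear; lia.
- rewrite (_ : [set _ in _] = v' |: [set x in x0 :: p]); last by apply/setP => z; rewrite inE h14 !inE.
  by rewrite cardsU1 inE hv' h3.
- by rewrite (eq_all_r h14) /= h10.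
- move=> a b; rewrite !h14 ![_ \in v' :: _]in_cons => /orP[/eqP ->|ha] /orP[/eqP ->|hb] //.
  + by rewrite (within_sym hsym) => h; move: (hfar _ hb); rewrite h.
  + by move=> h; move: (hfar _ ha); rewrite h.
  + exact: h5.
Qed.

End Pocket.

Section Union.
Variables (V W : finType) (e : rel V) (D R n0 n1 k : nat) (tp : {ffun V -> W} -> pred V).
Notation asg := {ffun V -> W}.
Notation Q := #|{ffun V -> W}|.
Notation Dl := (D.+2 ^ (14 * R + 1)).
Hypothesis hD : max_deg_le e D.
Hypothesis htp : forall l, uniq l -> sep e R l ->
  #|[set w : asg | all (tp w) l]| * n0 ^ size l <= Q * n1 ^ size l.
Hypothesis hn1 : 0 < n1.
Hypothesis hn0 : 2 * n1 * Dl ^ 2 <= n0.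
Hypothesis hk : 0 < k.

Definition nbl (x : V) (i : nat) : V := nth x (enum [set y | within e (14 * R + 1) x y]) i.

Fixpoint decode (x : V) (cs : seq nat) : seq V :=
  if cs is i :: cs' then nbl x i :: decode (nbl x i) cs' else [::].

Lemma decode_surj x p : path (within e (14 * R + 1)) x p ->
  exists cs : (size p).-tuple 'I_Dl, decode x (map val cs) = p.
Proof.
elim: p x => [|y p IH] x /=; first by exists [tuple].
move=> /andP[h1 /IH[cs hcs]].
have hy : y \in enum [set y | within e (14 * R + 1) x y] by rewrite mem_enum inE.
have hi : index y (enum [set y | within e (14 * R + 1) x y]) < Dl.
  by apply: leq_trans (ball_card hD (14 * R + 1) x); rewrite cardE index_mem.
exists [tuple of Ordinal hi :: cs] => /=; rewrite /nbl nth_index //; by rewrite hcs.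
Qed.

(** Union bound over start vertices and codes of walks. Each of the [k] tripped vertices contributes
    probability [n1 / n0] and at most two steps of the walk, that is a factor [Dl ^ 2]; by [hn0]
    this is at most 1/2 per vertex. *)
Lemma witness_prob (P : asg -> bool) :
  (forall w, P w -> exists x0 p, witness_walk e R (tp w) k x0 p) ->
  #|[set w | P w]| * 2 ^ k <= #|V| * Q.
Proof.
move=> hP.
pose good (u : V * (2 * k.-1).-tuple 'I_Dl) :=
  pb (sep e R (u.1 :: decode u.1 (map val u.2))) &&
  (#|[set x in u.1 :: decode u.1 (map val u.2)]| == k).
pose F (u : V * (2 * k.-1).-tuple 'I_Dl) : {set asg} :=
  [set w | good u && all (tp w) (u.1 :: decode u.1 (map val u.2))].
have hsub : [set w | P w] \subset \bigcup_(u in [set: V * (2 * k.-1).-tuple 'I_Dl]) F u.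
  apply/subsetP => w; rewrite inE => /hP[x0 [p [h1 h2 h3 h4 h5]]].
  case: (decode_surj h1) => cs; move: cs; rewrite h2 => cs hcs.
  apply/bigcupP; exists (x0, cs) => //; rewrite inE /good [_.1]/= [_.2]/= hcs h3 eqxx h4 !andbT.
  exact/pbP.
have hF u : #|F u| * n0 ^ k <= Q * n1 ^ k.
  case hg: (good u); last first.
    by rewrite /F hg (_ : [set _ | _] = set0) ?cards0 //; apply/setP => w; rewrite !inE.
  move: (hg) => /andP[/pbP hs /eqP hc]; set s := u.1 :: decode u.1 (map val u.2) in hs hc *.
  (* The walk repeats vertices; the product bound applies to the distinct ones. *)
  have hsz : size (undup s) = k.
    rewrite -hc -(card_uniqP (undup_uniq s)); apply: eq_card => x.
    by rewrite !inE mem_undup.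
  have hs' : sep e R (undup s) by move=> x y hx hy; apply: hs; rewrite -mem_undup.
  have h := htp (undup_uniq s) hs'; rewrite hsz in h.
  apply: leq_trans h.
  rewrite leq_mul2r; apply/orP; right; apply: subset_leq_card; apply/subsetP => w.
  rewrite !inE hg => h1; apply/allP => x hx.
  have {}hx : x \in s by rewrite -mem_undup.
  exact: (allP (andP h1).2).
have h1 : #|[set w | P w]| * n0 ^ k <= #|V| * Dl ^ (2 * k.-1) * (Q * n1 ^ k).
  apply: (@leq_trans ((\sum_(u : V * (2 * k.-1).-tuple 'I_Dl) #|F u|) * n0 ^ k)).
    rewrite leq_mul2r; apply/orP; right; apply: (leq_trans (subset_leq_card hsub)).
    rewrite (eq_bigl predT); last by move=> u; rewrite inE.
    elim/big_rec2: _ => [|u X m _ h]; first by rewrite cards0.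
    by apply: leq_trans (leq_card_setU _ _) _; rewrite leq_add2l.
  rewrite big_distrl /=.
  apply: (@leq_trans (\sum_(u : V * (2 * k.-1).-tuple 'I_Dl) Q * n1 ^ k)); first exact: leq_sum.
  by rewrite sum_nat_const card_prod card_tuple card_ord.
have hDl : 0 < Dl by rewrite expn_gt0.
have h2 : 2 ^ k * n1 ^ k * Dl ^ (2 * k.-1) <= n0 ^ k.
  apply: (@leq_trans (2 ^ k * n1 ^ k * Dl ^ (2 * k))).
    by rewrite leq_mul2l; apply/orP; right; apply: leq_pexp2l => //; lia.
  by rewrite expnM -!expnMn; case: (k) => // m; rewrite leq_exp2r.
have hpos : 0 < n1 ^ k * Dl ^ (2 * k.-1) by rewrite muln_gt0 !expn_gt0 hn1.
rewrite -(leq_pmul2r hpos).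
apply: (@leq_trans (#|[set w | P w]| * n0 ^ k)).
  by rewrite -mulnA leq_mul2l mulnA h2 orbT.
by apply: (leq_trans h1); rewrite -!mulnA leq_mul2l; apply/orP; right; rewrite mulnCA [n1 ^ k * _]mulnC.
Qed.
End Union.

(** * Rake-and-cut layering *)

Section LayerDef.
Variables (V : finType) (h : rel V) (l K : nat) (c : V -> nat).

Definition deg_pred (p : pred V) (x : V) : nat := #|[pred y | p y && h x y]|.

Definition deep (p : pred V) (x : V) : bool :=
  [forall y, within (induced h p) l x y ==> (deg_pred p y == 2)].

(* Rake leaves; colour (i mod K) may also cut a long degree-2 chain at a single vertex. *)
Fixpoint alive (i : nat) (x : V) : bool :=
  if i is i'.+1 then
    [&& alive i' x, 1 < deg_pred (alive i') x & ~~ ((c x == i' %% K) && deep (alive i') x)]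
  else true.

Definition cutv (N : nat) (x : V) : bool :=
  [exists i : 'I_N, [&& alive i x, c x == i %% K & deep (alive i) x]].

(** Survival is monotone, so the number of steps survived is the last index at which [x] is
    alive. *)
Definition layer (N : nat) (x : V) : nat := \sum_(i < N) alive i.+1 x.
End LayerDef.

Lemma mod_time K i a : a < K -> exists2 t, i <= t < i + K & t %% K = a.
Proof.
move=> ha; have hK : 0 < K by lia.
have hr := ltn_pmod i hK; have hi := divn_eq i K.
case: (leqP (i %% K) a) => h.
  by exists (i %/ K * K + a); [lia|rewrite modnMDl modn_small].
by exists ((i %/ K).+1 * K + a); [rewrite mulSn; lia|rewrite modnMDl modn_small].
Qed.

Lemma path_first (V : eqType) (r : rel V) (P : pred V) x p : path r x p -> P x -> ~~ P (last x p) ->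
  exists p1 y p2, [/\ p = p1 ++ y :: p2, all P (x :: p1) & ~~ P y].
Proof.
elim: p x => [|z p IH] x /=; first by move=> _ ->.
move=> /andP[h1 h2] hx hl; case hz: (P z); last by exists [::], z, p; rewrite /= hx hz.
case: (IH _ h2 hz hl) => p1 [y [p2 [-> h3 h4]]].
by exists (z :: p1), y, p2; split => //=; rewrite hx.
Qed.

Section Layer.
Variables (V : finType) (h : rel V) (D l K : nat) (c : V -> nat).
Hypothesis hf : forest h.
Hypothesis hD : max_deg_le h D.
Hypothesis hc : forall x, c x < K.
Notation F := (alive h l K c).
Notation deg_pred := (deg_pred h).
Notation deep := (deep h l).

Lemma F_sub i j x : i <= j -> F j x -> F i x.
Proof. by move=> /subnK <-; elim: (j - i) => //= m IH /and3P[/IH]. Qed.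

Lemma F_path_induced i x p : path h x p -> all (F i) (x :: p) -> path (induced h (F i)) x p.
Proof.
elim: p x => [|y p IH] x //= /andP[h1 h2] /and3P[h3 h4 h5].
by rewrite /induced h1 h3 h4 IH //= h4 h5.
Qed.

Lemma deep_removed i x : c x = i %% K -> deep (F i) x -> ~~ F i.+1 x.
Proof. by move=> h1 h2 /=; rewrite h1 eqxx h2 andbF !andbF. Qed.

Section Progress.
Variable C : {set V}.
Hypothesis hC : forall x y, x \in C -> h x y -> y \in C.

Let A i := [set x in C | F i x].

Lemma deg_pred_in i x : x \in C -> deg_pred (F i) x = deg_in h (A i) x.
Proof.
move=> hx; apply: eq_card => y; rewrite !inE.
by case hxy: (h x y); rewrite ?andbF // (hC hx hxy).
Qed.

Lemma within_C k i x y : x \in C -> F i x -> within (induced h (F i)) k x y -> y \in C /\ F i y.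
Proof.
move=> h1 h2; elim: k y => [|k IH] y; first by rewrite within0 => /eqP <-.
rewrite withinS => /orP[/IH //|/existsP[z /andP[/IH[h3 h4] /and3P[h5 h6 h7]]]].
by split => //; apply: hC h5.
Qed.

(* Vertices far from leaves and branchings are removed at their colour's turn, unless a removal nearby
   has already broken the chain; so each round of K steps removes a constant fraction. *)
Lemma layer_progress i :
  #|A i| <= 4 * D.+2 ^ l.+1 * (#|A i| - #|A (i + K)|).
Proof.
set Rm := A i :\: A (i + K).
have hsub : A (i + K) \subset A i.
  by apply/subsetP => x; rewrite !inE => /andP[-> /=]; apply: F_sub; rewrite leq_addr.
have -> : #|A i| - #|A (i + K)| = #|Rm| by rewrite /Rm cardsD (setIidPr hsub).
case: (set_0Vmem (A i)) => [->|[x0 hx0]]; first by rewrite cards0.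
have hK : 0 < K by apply: leq_ltn_trans (hc x0).
pose NE := [set x in A i | deg_in h (A i) x != 2].
have hNE : #|NE| <= 3 * #|Rm|.
  apply: leq_trans (forest_ne2 hf (A i)) _; rewrite leq_mul2l /=; apply: subset_leq_card.
  apply/subsetP => x; rewrite inE => /andP[h1 h2]; rewrite inE h1 andbT inE.
  move: (h1); rewrite inE => /andP[h3 _]; rewrite h3 /=; apply/negP => h4.
  have : F i.+1 x by apply: F_sub h4; lia.
  by rewrite /= deg_pred_in // => /and3P[_ h5 _]; lia.
have hcov : A i \subset (\bigcup_(y in NE) [set x | within h l y x]) :|:
                        (\bigcup_(y in Rm) [set x | within h l.+1 y x]).
  apply/subsetP => x hx; move: (hx); rewrite inE => /andP[hxC hxF].
  case hd: (deep (F i) x); last first.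
    move/negP: hd => /negP; rewrite negb_forall => /existsP[y]; rewrite negb_imply => /andP[h1 h2].
    case: (within_C hxC hxF h1) => h3 h4.
    rewrite inE; apply/orP; left; apply/bigcupP; exists y; last first.
      rewrite inE (within_sym (forest_sym hf)); apply: within_sub h1; exact: induced_sub.
    by rewrite !inE h3 h4 -deg_pred_in.
  rewrite inE; apply/orP; right.
  case: (pickP [pred r in Rm | within h l.+1 x r]) => [r /andP[h1 h2]|hno].
    by apply/bigcupP; exists r => //; rewrite inE (within_sym (forest_sym hf)).
  exfalso; case: (mod_time i (hc x)) => t /andP[ht1 ht2] htc.
  have hkeep y : y \in C -> F i y -> within h l.+1 x y -> F (i + K) y.
    move=> h1 h2 h3; apply: contraT => h4; move: (hno y).
    by rewrite inE /= h3 andbT !inE h1 h2 h4.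
  have hxt : F (i + K) x by apply: hkeep => //; apply: within_refl.
  have htF y : F (i + K) y -> F t y by apply: F_sub; lia.
  have : deep (F t) x.
    apply/forallP => y; apply/implyP => h1.
    have h2 : within (induced h (F i)) l x y.
      apply: within_sub h1 => a b /and3P[h2 h3 h4]; rewrite /induced h2.
      by rewrite (F_sub ht1 h3) (F_sub ht1 h4).
    have h3 := forallP hd y; rewrite h2 /= in h3; rewrite -(eqP h3).
    case: (within_C hxC hxF h2) => h4 h5.
    have h6 : within h l x y by apply: within_sub h2; apply: induced_sub.
    apply/eqP; apply: eq_card => z; rewrite !inE; case hyz: (h y z); rewrite ?andbF // !andbT.
    apply/idP/idP; first exact: F_sub ht1.
    by move=> h7; apply: htF; apply: hkeep => //; [apply: hC hyz|apply: within_rcons h6 hyz].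
  move/(deep_removed (esym htc)) => /negP; apply; apply: F_sub hxt; lia.
apply: leq_trans (subset_leq_card hcov) _; apply: leq_trans (leq_card_setU _ _) _.
have h1 := @card_bigcup_le V V NE (fun y => [set x | within h l y x]) _ (fun y _ => ball_card hD l y).
have h2 := @card_bigcup_le V V Rm (fun y => [set x | within h l.+1 y x]) _ (fun y _ => ball_card hD l.+1 y).
apply: leq_trans (leq_add h1 h2) _.
have h3 : D.+2 ^ l <= D.+2 ^ l.+1 by rewrite leq_pexp2l.
rewrite (_ : 4 * _ * _ = 3 * #|Rm| * D.+2 ^ l.+1 + #|Rm| * D.+2 ^ l.+1); last first.
  by rewrite mulnAC [4 * _]mulSn mulnDl addnC.
by rewrite leq_add2r leq_mul.
Qed.

(** By [layer_progress] each of the [M] rounds removes at least a fraction [1 / M] of what remains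
    at the very end; together they remove at least as much as remains. *)
Lemma layer_halve i :
  2 * #|A (i + 4 * D.+2 ^ l.+1 * K)| <= #|A i|.
Proof.
set M := 4 * D.+2 ^ l.+1; have hM : 0 < M by rewrite muln_gt0 expn_gt0.
have hle a b : a <= b -> #|A b| <= #|A a|.
  move=> hab; apply: subset_leq_card; apply/subsetP => x; rewrite !inE => /andP[-> /=].
  exact: F_sub.
have h1 j : j <= M -> j * #|A (i + M * K)| <= M * (#|A i| - #|A (i + j * K)|).
  elim: j => [|j IH] hj //.
  have h2 := layer_progress (i + j * K).
  have h3 : #|A (i + M * K)| <= #|A (i + j * K)|.
    by apply: hle; rewrite leq_add2l leq_mul2r; apply/orP; right; lia.
  have h4 : #|A (i + j * K + K)| <= #|A (i + j * K)| by apply: hle; rewrite leq_addr.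
  have h5 : #|A (i + j * K)| <= #|A i| by apply: hle; rewrite leq_addr.
  have {}IH := IH (ltnW hj).
  rewrite mulSn (_ : i + (j.+1) * K = i + j * K + K); last by rewrite mulSn; lia.
  rewrite -/M in h2; move: h2 h3 h4 h5 IH; move: #|A i| #|A (i + M * K)| #|A (i + j * K)| #|A _|.
  move=> a b d f; clear; nia.
have h2 := h1 M (leqnn M).
rewrite leq_pmul2l // in h2.
have h3 : #|A (i + M * K)| <= #|A i| by apply: hle; rewrite leq_addr.
by lia.
Qed.

Lemma layer_empty t : #|C| < 2 ^ t -> forall x, x \in C -> ~~ F (t * (4 * D.+2 ^ l.+1 * K)) x.
Proof.
move=> ht x hx; set M := 4 * _.
have h1 j : 2 ^ j * #|A (j * (M * K))| <= #|C|.
  elim: j => [|j IH].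
    by rewrite mul1n; apply: subset_leq_card; apply/subsetP => y; rewrite inE => /andP[].
  apply: leq_trans IH; rewrite expnSr -mulnA leq_mul2l; apply/orP; right.
  by rewrite (mulSn j (M * K)) [M * K + _]addnC; exact: layer_halve.
apply/negP => hF.
have : 0 < #|A (t * (M * K))| by apply/card_gt0P; exists x; rewrite inE hx.
by have := h1 t; move: #|A _| => a; nia.
Qed.

End Progress.

Variable N : nat.
Hypothesis hN : forall x, ~~ F N x.
Notation lay := (layer h l K c N).
Notation cutv := (cutv h l K c N).

Lemma F_lay i x : F i x = (i <= lay x).
Proof.
have hlay : lay x < N /\ F (lay x) x /\ ~~ F (lay x).+1 x.
  rewrite /layer; elim: N (hN x) => [|m IH] hm //.
  rewrite big_ord_recr; have -> : alive h l K c (@ord_max m).+1 x = false := negbTE hm.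
  rewrite /= addn0; case hF: (F m x); last first.
    have hs : ~~ F m x by rewrite hF.
    by case: (IH hs) => h1 h2; split => //; apply: ltnW.
  rewrite (eq_bigr (fun=> 1)); last first.
    by move=> j _; have := F_sub (ltn_ord j) hF; rewrite /= => ->.
  rewrite sum1_card card_ord; split => //; split => //; exact: (negbTE hm).
case: hlay => h1 [h2 h3]; apply/idP/idP => [h4|]; last by move=> /F_sub; apply.
by rewrite leqNgt; apply: contra h3 => h5; apply: F_sub h4.
Qed.

Lemma lay_lt x : lay x < N.
Proof. by move: (hN x); rewrite F_lay -ltnNge. Qed.

Lemma cutvP x : reflect (c x = lay x %% K /\ deep (F (lay x)) x) (cutv x).
Proof.
apply: (iffP existsP) => [[i /and3P[h1 /eqP h2 h3]]|[h1 h2]]; last first.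
  by exists (Ordinal (lay_lt x)); rewrite /= F_lay leqnn h1 eqxx.
have := deep_removed h2 h3; rewrite F_lay -ltnNge => h4.
by rewrite F_lay in h1; have -> : lay x = i by lia.
Qed.

Lemma lay_deg x : ~~ cutv x -> deg_pred (F (lay x)) x <= 1.
Proof.
move=> h1; rewrite leqNgt; apply: contra h1 => h1.
have : ~~ F (lay x).+1 x by rewrite F_lay -ltnNge.
by rewrite /= F_lay leqnn h1 /= negbK => /andP[/eqP h2 h3]; apply/cutvP.
Qed.

Lemma two_nbrs i x y z : h x y -> h x z -> F i y -> F i z -> y != z -> 1 < deg_pred (F i) x.
Proof.
by move=> h1 h2 h3 h4 h5; apply/card_gt1P; exists y, z; rewrite !inE h1 h2 h3 h4.
Qed.

Hypothesis hcol : forall x y, within h l x y -> c x = c y -> x = y.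

(* If two cut vertices were close, the first vertex removed between them would be a cut
   vertex whose chain contains the other, contradicting that both chains have degree 2. *)
Lemma cutv_sep x y : within h l x y -> cutv x -> cutv y -> x = y.
Proof.
wlog hij : x y / lay x <= lay y.
  move=> hw h1 h2 h3; case: (leqP (lay x) (lay y)) => h4; first exact: hw.
  by apply/esym; apply: hw => //; [lia|rewrite (within_sym (forest_sym hf))].
move=> hxy hx hy; case: (ltngtP (lay x) (lay y)) => hlt; first last.
- by apply: hcol => //; case/cutvP: hx => -> _; case/cutvP: hy => -> _; rewrite hlt.
- by lia.
exfalso; set j := lay y.
have [p [hp hu hl hs]] : exists p, [/\ path h y p, uniq (y :: p), last y p = x & size p <= l].
  rewrite (within_sym (forest_sym hf)) in hxy.
  have : exists2 p, path h y p & last y p = x /\ size p <= l.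
    elim: l x hxy {hx hij hlt} => [|m IH] x; first by rewrite within0 => /eqP <-; exists [::].
    rewrite withinS => /orP[/IH[p h1 [h2 h3]]|/existsP[z /andP[/IH[p h1 [h2 h3]] h4]]].
      by exists p => //; split => //; lia.
    by exists (rcons p x); rewrite ?rcons_path ?h1 ?h2 // last_rcons size_rcons.
  case=> p h1 [h2 h3]; case: (shortenP h1) h2 => q h4 h5 h6 h2; exists q; split => //.
  apply: leq_trans h3; apply: uniq_leq_size h6; by case/andP: h5.
have [z hz hmin] : exists2 z, z \in y :: p & forall u, u \in y :: p -> lay z <= lay u.
  case: (@arg_minnP V y (mem (y :: p)) lay (mem_head _ _)) => z h1 h2; by exists z.
have hFz u : u \in y :: p -> F (lay z) u by move=> /hmin; rewrite F_lay.
have hxp : x \in y :: p by rewrite -hl mem_last.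
have hzj : lay z < j by apply: leq_ltn_trans (hmin _ hxp) hlt.
have hzp : z \in p.
  by move: hz; rewrite inE => /orP[/eqP hzy|//]; move: hzj; rewrite hzy ltnn.
case/splitPr: hzp hp hu hl hs hFz {hz hmin hxp} => p1 p2 hp hu hl hs hFz.
(* Both path neighbours of [z] are still alive when it goes, so it cannot have been raked. *)
have hcz : cutv z.
  case: p2 hp hu hl hs hFz => [|b p2] hp hu hl hs hFz; first by rewrite last_cat /= in hl; rewrite hl.
  apply: contraT => /lay_deg; rewrite leqNgt => /negP; case.
  move: hp; rewrite cat_path /= => /and4P[h1 h2 h3 h4].
  apply: (@two_nbrs _ _ (last y p1) b) => //.
  - by rewrite (forest_sym hf).
  - by apply: hFz; rewrite -cat_cons mem_cat mem_last.
  - by apply: hFz; rewrite !(inE, mem_cat) eqxx !orbT.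
  - move: hu; rewrite -cat_cons cat_uniq => /and3P[_ /hasPn h5 _].
    apply/eqP => h6; have : b \notin y :: p1 by apply: h5; rewrite !inE eqxx orbT.
    by rewrite -h6 mem_last.
have hp' : path h y (rcons p1 z).
  by move: hp; rewrite -cat_rcons cat_path => /andP[].
have hs' : size (rcons p1 z) <= l by move: hs; rewrite size_cat size_rcons /=; clear; lia.
have hFz' u : u \in y :: rcons p1 z -> F (lay z) u.
  by move=> hu'; apply: hFz; rewrite -cat_rcons -cat_cons mem_cat hu'.
have hFy : F j y by rewrite F_lay.
have hlz : ~~ F j (last y (rcons p1 z)) by rewrite last_rcons F_lay -ltnNge.
(* [w] is the first vertex on the way from [y] to [z] that is gone when [y] is cut. Its predecessor
   [a] has degree 2 both when [z] is cut and when [y] is cut, hence the same neighbours at both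
   times, so [w] would still be alive. *)
case: (path_first hp' hFy hlz) => p3 [w [p4 [h1 h2 h3]]].
rewrite h1 in hp' hs' hFz'.
have hlast : last w p4 = z by have := congr1 (last y) h1; rewrite last_rcons last_cat.
move: hp'; rewrite cat_path /= => /and3P[h4 h5 h6].
set a := last y p3 in h5.
have e1 : deg_pred (F j) a = 2.
  case/cutvP: hy => _ /forallP /(_ a) /implyP hd; apply/eqP; apply: hd.
  apply: (withinW _ (within_last (F_path_induced h4 h2))).
  by apply: leq_trans hs'; rewrite size_cat leq_addr.
have e2 : deg_pred (F (lay z)) a = 2.
  case/cutvP: hcz => _ /forallP /(_ a) /implyP hd; apply/eqP; apply: hd.
  rewrite (within_sym (induced_sym _ (forest_sym hf))) -[z in within _ _ _ z]hlast.
  have hpa : path h a (w :: p4) by rewrite /= h5.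
  apply: (withinW _ (within_last (F_path_induced hpa _))).
    by apply: leq_trans hs'; rewrite size_cat leq_addl.
  apply/allP => u hu'; apply: hFz'; move: hu'; rewrite inE => /orP[/eqP ->|hu'].
    by rewrite /a -cat_cons mem_cat mem_last.
  by rewrite inE mem_cat hu' !orbT.
case/negP: h3.
have hsub : [pred u | F j u && h a u] \subset [pred u | F (lay z) u && h a u].
  by apply/subsetP => u; rewrite !inE => /andP[h7 ->]; rewrite (F_sub (ltnW hzj) h7).
have := subset_cardP (etrans e1 (esym e2)); move/elimT/(_ hsub) => /(_ w).
rewrite !inE h5 !andbT => ->; apply: hFz'.
by rewrite inE mem_cat mem_head !orbT.
Qed.

Notation P := (induced h (fun x => ~~ cutv x)).

(** A vertex that is not cut leaves with at most one neighbour of at least its own layer. If the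
    path enters it from such a neighbour, it must continue to a strictly lower layer. *)
Lemma piece_descent x0 y p : path P x0 (y :: p) -> uniq (x0 :: y :: p) -> lay y <= lay x0 ->
  path (fun a b => lay b < lay a) y p.
Proof.
elim: p x0 y => [|z p IH] x0 y //= /and3P[h1 h2 h3] hu hl.
have hzy : lay z < lay y.
  rewrite ltnNge; apply/negP => h4; case/and3P: h1 => h5 h6 h7; case/and3P: h2 => h8 _ _.
  have := lay_deg h7; rewrite leqNgt => /negP; apply.
  apply: (@two_nbrs _ _ x0 z) => //; rewrite ?F_lay //; first by rewrite (forest_sym hf).
  by apply/eqP => h9; move: hu; rewrite h9 !inE eqxx orbT.
rewrite hzy /=; apply: (IH y) => //; last by exact: ltnW.
  by rewrite /= h2.
by case/andP: hu.
Qed.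

Lemma descent_size y p : path (fun a b => lay b < lay a) y p -> size p + lay (last y p) <= lay y.
Proof.
elim: p y => [|z p IH] y //= /andP[h1 /IH h2].
by rewrite addSn; apply: leq_ltn_trans h2 h1.
Qed.

Lemma piece_path x y : connect P x y -> exists p, [/\ path P x p, uniq (x :: p) & last x p = y].
Proof.
by move=> /connectP[p0 h1 h2]; case: (shortenP h1) h2 => p h3 h4 _ ->; exists p.
Qed.

(** Lexicographic in layer and colour; the colour separates two adjacent vertices that share the top
    layer of a piece. *)
Definition key (x : V) : nat := lay x * K + c x.

Lemma key_lay x y : key x <= key y -> lay x <= lay y.
Proof.
rewrite /key => h1; rewrite leqNgt; apply/negP => h2.
have := hc y; have : (lay y).+1 * K <= lay x * K by rewrite leq_mul2r h2 orbT.
rewrite mulSn; lia.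
Qed.

Lemma key_inj x y : key x = key y -> lay x = lay y /\ c x = c y.
Proof.
move=> h1; have h2 : lay x = lay y by apply/eqP; rewrite eqn_leq !key_lay ?h1.
by split => //; move: h1; rewrite /key h2 => /addnI.
Qed.

Lemma leader_near x y : (forall z, connect P x z -> key z <= key x) -> connect P x y -> within P N x y.
Proof.
move=> hm /piece_path[p [h1 h2 <-]]; apply: (withinW _ (within_last h1)).
case: p h1 h2 => [|z p] h1 h2 //=.
have hz : lay z <= lay x.
  by apply/key_lay/hm/connect1; case/andP: h1.
have := descent_size (piece_descent h1 h2 hz); have := lay_lt z; lia.
Qed.

(** Two leaders have the same layer and colour. A path of at least two edges between them would end
    in a strictly lower layer, and the ends of a single edge differ in colour. *)
Lemma leader_uniq x y : 0 < l -> (forall z, connect P x z -> key z <= key x) ->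
  (forall z, connect P y z -> key z <= key y) -> connect P x y -> x = y.
Proof.
move=> hl0 hx hy hxy.
have hyx : connect P y x.
  by rewrite (sym_connect_sym (induced_sym _ (forest_sym hf))).
have hk : key x = key y by apply/eqP; rewrite eqn_leq hx // hy.
case: (key_inj hk) => h1 h2; case: (piece_path hxy) => p [h3 h4 h5].
case: p h3 h4 h5 => [|z p] h3 h4 h5 //; exfalso.
have hz : lay z <= lay x by apply/key_lay/hx/connect1; case/andP: h3.
case: p h3 h4 h5 => [|b p] h3 h4 h5.
  move: h4; rewrite /= inE andbT => /eqP; apply; apply: hcol; last by rewrite h2 -h5.
  case/andP: h3 => /induced_sub h6 _; exact: (withinW hl0 (within_edge h6)).
have := descent_size (piece_descent h3 h4 hz).
rewrite -[last z (b :: p)]/(last x (z :: b :: p)) h5 -h1 /=; lia.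
Qed.

Lemma leader_exists x : exists2 y, connect P x y & forall z, connect P y z -> key z <= key y.
Proof.
case: (@arg_maxnP V x (connect P x) key (connect0 _ _)) => y h1 h2.
by exists y => // z h3; apply: h2; apply: connect_trans h1 h3.
Qed.

End Layer.

(** * From local functions to CONGEST algorithms *)

Definition prefix_free (T : Type) (f : T -> seq bool) : Prop :=
  forall a b s t, f a ++ s = f b ++ t -> a = b /\ s = t.

Fixpoint unary (n : nat) : seq bool := if n is n'.+1 then true :: unary n' else [:: false].

Lemma unary_prefix_free : prefix_free unary.
Proof.
elim=> [|a IH] [|b] s t //=; first by case.
by case=> /IH[-> ->].
Qed.

Lemma size_unary n : size (unary n) = n.+1.
Proof. by elim: n => //= n ->. Qed.

Fixpoint bitsw (w m : nat) : seq bool :=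
  if w is w'.+1 then odd m :: bitsw w' m./2 else [::].

Lemma size_bitsw w m : size (bitsw w m) = w.
Proof. by elim: w m => //= w IH m; rewrite IH. Qed.

Lemma bitsw_inj w m m' : m < 2 ^ w -> m' < 2 ^ w -> bitsw w m = bitsw w m' -> m = m'.
Proof.
elim: w m m' => [|w IH] m m'; first by rewrite expn0; lia.
rewrite expnS /= => h1 h2 [h3 /IH h4].
by rewrite -(odd_double_half m) -(odd_double_half m') h3 h4 //; lia.
Qed.

Definition nat_code (m : nat) : seq bool :=
  unary (trunc_log 2 m) ++ bitsw (trunc_log 2 m).+1 m.

Lemma nat_code_pfree : prefix_free nat_code.
Proof.
have hlt m : m < 2 ^ (trunc_log 2 m).+1 by apply: trunc_log_ltn.
move=> a b s t; rewrite /nat_code -!catA => /unary_prefix_free[h1].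
rewrite -h1 => /eqP; rewrite eqseq_cat ?size_bitsw // => /andP[/eqP h2 /eqP ->].
by split=> //; apply: bitsw_inj h2 => //; rewrite h1.
Qed.

Lemma size_nat_code m : size (nat_code m) = (trunc_log 2 m).+1 * 2.
Proof. rewrite /nat_code size_cat size_unary size_bitsw; lia. Qed.

(** The part from the fixed set [X] costs at most [#|X|] bits in unary; only the number, an
    identifier or a colour, grows with the network. *)
Definition label_code (X : finType) (a : X * nat) : seq bool := unary (enum_rank a.1) ++ nat_code a.2.

Lemma label_code_pfree (X : finType) : prefix_free (@label_code X).
Proof.
move=> [x m] [y m'] s t; rewrite /label_code /= -[(_ ++ nat_code m) ++ s]catA -[(_ ++ nat_code m') ++ t]catA.
move=> /unary_prefix_free[h1 /nat_code_pfree[-> ->]].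
by split=> //; congr pair; apply: enum_rank_inj; apply: val_inj.
Qed.

Lemma size_label_code (X : finType) (a : X * nat) : size (label_code a) <= #|X| + (trunc_log 2 a.2).+1 * 2.
Proof.
by rewrite /label_code size_cat size_unary size_nat_code leq_add2r ltn_ord.
Qed.

(** There are two encoders because the two sides come from different graphs; equal codes then yield
    a relation between views instead of an equality. *)
Lemma flatten_prefix_free (R : nat -> Prop) (f f' : nat -> seq bool) (qs : seq nat) s s' :
  (forall q, q \in qs -> forall s s', f q ++ s = f' q ++ s' -> R q /\ s = s') ->
  flatten (map f qs) ++ s = flatten (map f' qs) ++ s' ->
  (forall q, q \in qs -> R q) /\ s = s'.
Proof.
elim: qs => [|q qs IH] h //=; rewrite -!catA => /(h q (mem_head _ _))[h1 h2].
case: (IH _ h2) => [q' hq'|h3 h4]; first by apply: h; rewrite inE hq' orbT.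
by split => // q'; rewrite inE => /orP[/eqP ->|/h3].
Qed.

Section Msg.
Variables (L : Type) (cl : L -> seq bool) (D : nat).
Hypothesis hcl : prefix_free cl.

Section One.
Variables (V : finType) (e : rel V) (pn : V -> V -> nat) (lab : V -> L).

(* The depth-j view from v with port p excluded: on a tree this lists every vertex once. *)
Fixpoint view_code (j : nat) (v : V) (p : nat) : seq bool :=
  cl (lab v) ++ unary p ++
  (if j is j'.+1 then
     flatten [seq (if q == p then [::] else
                   if nbr_at e pn v q is Some u then true :: view_code j' u (pn u v) else [:: false])
             | q <- iota 0 D]
   else [::]).

Definition port_codes (j : nat) (v : V) (q : nat) : option (seq bool) :=
  omap (fun u => view_code j u (pn u v)) (nbr_at e pn v q).

Definition port_forest : Prop :=
  [/\ forest e, pinj e pn & forall v u, e v u -> pn v u < D].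

End One.

Section Two.
Variables (V V' : finType) (e : rel V) (pn : V -> V -> nat) (lab : V -> L).
Variables (e' : rel V') (pn' : V' -> V' -> nat) (lab' : V' -> L).

Fixpoint same_view (j : nat) (v : V) (p : nat) (v' : V') (p' : nat) : Prop :=
  [/\ lab v = lab' v', p = p' &
  if j is j'.+1 then forall q, q < D -> q <> p ->
    match nbr_at e pn v q, nbr_at e' pn' v' q with
    | Some u, Some u' => same_view j' u (pn u v) u' (pn' u' v')
    | None, None => True
    | _, _ => False
    end
  else True].

Definition same_root_view (j : nat) (v : V) (v' : V') : Prop :=
  forall q, match nbr_at e pn v q, nbr_at e' pn' v' q with
    | Some u, Some u' => same_view j u (pn u v) u' (pn' u' v')
    | None, None => True
    | _, _ => False
    end.

Lemma view_code_same j v p v' p' s s' :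
  view_code e pn lab j v p ++ s = view_code e' pn' lab' j v' p' ++ s' -> same_view j v p v' p' /\ s = s'.
Proof.
elim: j v p v' p' s s' => [|j IH] v p v' p' s s' /=; rewrite -!catA => /hcl[h1 /unary_prefix_free[h2]].
  by move=> /= ->.
subst p' => h3; set R := fun q => q <> p -> match nbr_at e pn v q, nbr_at e' pn' v' q with
    | Some u, Some u' => same_view j u (pn u v) u' (pn' u' v')
    | None, None => True
    | _, _ => False
    end.
case: (flatten_prefix_free (R := R) _ h3) => [q _ t t'|h4 ->].
  rewrite /R; case: eqP => [->|_]; first by move=> /= ->.
  case: (nbr_at e pn v q) => [u|]; case: (nbr_at e' pn' v' q) => [u'|] //=.
    by case=> /IH[h5 ->].
  by case=> ->.
by split => //; split => // q hq; apply: h4; rewrite mem_iota.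
Qed.

Variables (v : V) (v' : V').

(** [x] and [x'] are reached from the two centres by the same sequence of ports along shortest
    paths. *)
Fixpoint matched (i : nat) (x : V) (x' : V') : Prop :=
  if i is i'.+1 then
    exists w w', [/\ matched i' w w', e w x, e' w' x', pn w x = pn' w' x' &
                     sphere e v i'.+1 x /\ sphere e' v' i'.+1 x']
  else x = v /\ x' = v'.

Hypotheses (hg : port_forest e pn) (hg' : port_forest e' pn') (hlab : lab v = lab' v').
Variable j : nat.
Hypothesis hroot : same_root_view j v v'.

Lemma matched_sph i x x' : matched i x x' -> sphere e v i x /\ sphere e' v' i x'.
Proof.
case: i => [[-> ->]|i]; first by rewrite !sph0 !eqxx.
by case=> w [w' [_ _ _ _]].
Qed.

(** Each step outwards uses up one level of the view. The port excluded from a view leads back to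
    the parent, so the next vertex outwards is never hidden by it. *)
Lemma matched_bis i x x' : i <= j.+1 -> matched i x x' -> lab x = lab' x' /\
  (if i is i'.+1 then exists w w', [/\ matched i' w w', e w x, e' w' x', pn w x = pn' w' x' &
     same_view (j - i') x (pn x w) x' (pn' x' w')] else True).
Proof.
case: hg hg' => hf hp _ [hf' hp' _].
have hb k a b c d : same_view k a b c d -> lab a = lab' c by case: k => [|k] [].
elim: i x x' => [|i IH] y y' hi; first by case=> -> ->.
move=> [x [x' [h1 h2 h3 h4 [h5 h6]]]].
suff hbis : same_view (j - i) y (pn y x) y' (pn' y' x').
  by split; [exact: hb hbis|exists x, x'].
case: (IH x x' (ltnW hi) h1) => _; case: i {IH} hi h1 h5 h6 => [|i] hi h1 h5 h6.
  move=> _; case: h1 => hx hx'; subst x x'; rewrite subn0.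
  have := hroot (pn v y); rewrite nbr_at_pn //.
  by rewrite h4 nbr_at_pn.
move=> [w [w' [h7 h8 h9 h10]]].
have -> : j - i = (j - i.+1).+1 by lia.
case=> _ h11 /(_ (pn x y)).
have hq : pn x y < D by case: hg => _ _; apply.
have hne : pn x y <> pn x w.
  move=> h12; have hyw : y = w by apply: hp h12 => //; rewrite (forest_sym hf).
  case: (matched_sph h7) => h13 _; rewrite -hyw in h13.
  by have := sphere_uniq h5 h13; lia.
by move=> /(_ hq hne); rewrite nbr_at_pn // h4 nbr_at_pn.
Qed.

Lemma matched_fun i x x1 x2 : matched i x x1 -> matched i x x2 -> x1 = x2.
Proof.
case: hg hg' => hf hp _ [hf' hp' _].
elim: i x x1 x2 => [|i IH] x x1 x2; first by case=> _ -> [_ ->].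
move=> [w [w1 [h1 h2 h3 h4 [h5 h6]]]] [u [u1 [h7 h8 h9 h10 [_ h12]]]].
case: (matched_sph h1) (matched_sph h7) => h13 _ [h14 _].
have hwu : w = u by apply: sphere_parent_uniq h5 h13 h14 h2 h8.
subst u; have hw1 := IH _ _ _ h1 h7; subst u1.
by apply: hp' h3 h9 _; congruence.
Qed.

Lemma matched_total i x : i <= j.+1 -> sphere e v i x -> exists x', matched i x x'.
Proof.
case: hg hg' => hf hp hD [hf' hp' hD'].
elim: i x => [|i IH] y hi hy; first by exists v'; move: hy; rewrite sph0 => /eqP.
case: (sphere_parent hy) => x hx hxy.
case: (IH x (ltnW hi) hx) => x' hR; case: (matched_sph hR) => _ hx'.
have [y' [h1 h2 h3]] : exists y', [/\ e' x' y', pn x y = pn' x' y' & sphere e' v' i.+1 y'].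
  case: (matched_bis (ltnW hi) hR) => _; case: i {IH} hi hy hx hR hx' => [|i] hi hy hx hR hx'.
    move=> _; case: hR => hxv hxv'; subst x x'.
    have := hroot (pn v y); rewrite nbr_at_pn //.
    case h: (nbr_at e' pn' v' (pn v y)) => [y'|] // _; case: (nbr_at_Some h) => h1 h2.
    by exists y'; split => //; case: (sphere_edge hf' hx' h1) => // -[].
  move=> [w [w' [h7 h8 h9 h10]]].
  have -> : j - i = (j - i.+1).+1 by lia.
  case=> _ h11 /(_ (pn x y) (hD _ _ hxy)).
  have hne : pn x y <> pn x w.
    move=> h12; have hyw : y = w by apply: hp h12 => //; rewrite (forest_sym hf).
    case: (matched_sph h7) => h13 _; rewrite -hyw in h13.
    by have := sphere_uniq hy h13; lia.
  move=> /(_ hne); rewrite nbr_at_pn //.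
  case h: (nbr_at e' pn' x' (pn x y)) => [y'|] // _; case: (nbr_at_Some h) => h1 h2.
  exists y'; split => //; case: (sphere_edge hf' hx' h1) => // -[k [hk] h12]; subst k.
  case: hne; rewrite h11 -h2; congr pn'.
  case: (matched_sph h7) => _ h13.
  by apply: (sphere_parent_uniq hf' hx' h12 h13) => //; rewrite (forest_sym hf').
by exists y', x, x'.
Qed.
End Two.

Lemma same_view_sym (V V' : finType) e pn lab e' pn' lab' j (v : V) p (v' : V') p' :
  same_view e pn lab e' pn' lab' j v p v' p' -> same_view e' pn' lab' e pn lab j v' p' v p.
Proof.
elim: j v p v' p' => [|j IH] v p v' p' /= [h1 h2 h3]; split => //.
subst p' => q hq hne; move: (h3 q hq hne).
by case: (nbr_at e pn v q) => [u|]; case: (nbr_at e' pn' v' q) => [u'|] //; apply: IH.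
Qed.

Lemma matched_swap (V V' : finType) e pn e' pn' (v : V) (v' : V') i x x' :
  matched e pn e' pn' v v' i x x' -> matched e' pn' e pn v' v i x' x.
Proof.
elim: i x x' => [|i IH] x x'; first by case.
by move=> [w [w' [h1 h2 h3 h4 [h5 h6]]]]; exists w', w; split => //; apply: IH.
Qed.

Section FpSim.
Variables (V V' : finType) (e : rel V) (pn : V -> V -> nat) (lab : V -> L).
Variables (e' : rel V') (pn' : V' -> V' -> nat) (lab' : V' -> L) (v : V) (v' : V') (j : nat).

Definition match_map (x : V) : V' :=
  epsilon (inhabits v') (fun x' => exists2 i, i <= j.+1 & matched e pn e' pn' v v' i x x').

Hypotheses (hg : port_forest e pn) (hg' : port_forest e' pn') (hlab : lab v = lab' v').
Hypothesis hroot : same_root_view e pn lab e' pn' lab' j v v'.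

Lemma match_mapP i x : i <= j.+1 -> sphere e v i x -> matched e pn e' pn' v v' i x (match_map x).
Proof.
move=> hi hx; case: (matched_total hg hg' hlab hroot hi hx) => x' h.
have h0 : exists x', exists2 i, i <= j.+1 & matched e pn e' pn' v v' i x x' by exists x', i.
case: (epsilon_spec (inhabits v') _ h0) => k hk h1.
case: (matched_sph h1) => h2 _; by rewrite -(sphere_uniq h2 hx).
Qed.

Lemma match_map_edge x y : within e j.+1 v x -> within e j.+1 v y -> e x y ->
  e' (match_map x) (match_map y) /\ pn' (match_map x) (match_map y) = pn x y.
Proof.
case: (hg) (hg') => hf hp hD [hf' hp' hD'].
have main i a b : i.+1 <= j.+1 -> sphere e v i a -> sphere e v i.+1 b -> e a b ->
  [/\ e' (match_map a) (match_map b), pn' (match_map a) (match_map b) = pn a b & pn' (match_map b) (match_map a) = pn b a].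
  move=> hi ha hb hab; have hRb := match_mapP hi hb; have hRa := match_mapP (ltnW hi) ha.
  case: (matched_bis hg hg' hlab hroot hi hRb) => _ [w [w' [h1 h2 h3 h4 h5]]].
  case: (matched_sph h1) => h6 h7.
  have hwa : w = a by apply: (sphere_parent_uniq hf hb h6 ha).
  subst w; have hw' := matched_fun hg hg' h1 hRa; subst w'.
  by split => //; case: (j - i) h5 => [|?] [].
move=> /within_sph[i hi hx] hy hxy.
case: (sphere_edge hf hx hxy) => [h|[k hk h]].
  have hi' : i.+1 <= j.+1.
    by case: (within_sph hy) => k hk h2; rewrite (sphere_uniq h h2).
  by case: (main _ _ _ hi' hx h hxy).
by subst i; rewrite (forest_sym hf) in hxy; case: (main _ _ _ hi h hx hxy);
  rewrite (forest_sym hf').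
Qed.
End FpSim.

(** In a forest a ball is the tree of non-backtracking walks from its centre, so the depth-[j] views
    from the neighbours determine the ball of radius [j + 1]. Matching along port sequences is a
    function in both directions, which gives the two maps. *)
Lemma same_codes_sim (V V' : finType) (e : rel V) (pn : V -> V -> nat) (lab : V -> L)
  (e' : rel V') (pn' : V' -> V' -> nat) (lab' : V' -> L) (v : V) (v' : V') j :
  port_forest e pn -> port_forest e' pn' -> lab v = lab' v' ->
  (forall q, port_codes e pn lab j v q = port_codes e' pn' lab' j v' q) ->
  exists f g, simf e pn lab e' pn' lab' j.+1 f g v v'.
Proof.
move=> hg hg' hlab hq.
have hroot : same_root_view e pn lab e' pn' lab' j v v'.
  move=> q; move: (hq q); rewrite /port_codes.
  case: (nbr_at e pn v q) => [u|]; case: (nbr_at e' pn' v' q) => [u'|] //= [h].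
  by apply: (proj1 (@view_code_same _ _ _ _ _ _ _ _ _ _ _ _ _ [::] [::] _)); rewrite h.
have hroot' : same_root_view e' pn' lab' e pn lab j v' v.
  move=> q; move: (hroot q).
  by case: (nbr_at e pn v q) => [u|]; case: (nbr_at e' pn' v' q) => [u'|] //; apply: same_view_sym.
pose f := match_map e pn e' pn' v v' j; pose g := match_map e' pn' e pn v' v j.
have P1 i x : i <= j.+1 -> sphere e v i x -> matched e pn e' pn' v v' i x (f x).
  refine (@match_mapP V V' e pn lab e' pn' lab' v v' j hg hg' hlab hroot i x).
have P2 i x : i <= j.+1 -> sphere e' v' i x -> matched e' pn' e pn v' v i x (g x).
  exact: (@match_mapP V' V e' pn' lab' e pn lab v' v j hg' hg (esym hlab) hroot').
have hR1 := @matched_bis V V' e pn lab e' pn' lab' v v' hg hg' hlab j hroot.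
have hE1 := @match_map_edge V V' e pn lab e' pn' lab' v v' j hg hg' hlab hroot.
have hE2 := @match_map_edge V' V e' pn' lab' e pn lab v' v j hg' hg (esym hlab) hroot'.
have hfw x : within e j.+1 v x -> within e' j.+1 v' (f x) /\ g (f x) = x.
  move=> /within_sph[i hi hx]; have hR := P1 i x hi hx.
  case: (matched_sph hR) => _ h1; split; first by apply: (withinW hi); case/andP: h1.
  exact: (matched_fun hg' hg (P2 _ _ hi h1) (matched_swap hR)).
have hbw x : within e' j.+1 v' x -> within e j.+1 v (g x) /\ f (g x) = x.
  move=> /within_sph[i hi hx]; have hR := P2 i x hi hx.
  case: (matched_sph hR) => _ h1; split; first by apply: (withinW hi); case/andP: h1.
  exact: (matched_fun hg hg' (P1 _ _ hi h1) (matched_swap hR)).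
exists f, g; split => //.
- have h0 : sphere e v 0 v by rewrite sph0.
  by case: (P1 0 v isT h0).
- move=> x /within_sph[i hi hx].
  by case: (hR1 _ _ _ hi (P1 i x hi hx)).
- move=> x y hx hy; apply/idP/idP => h.
    case: (hfw _ hx) (hfw _ hy) => h1 h2 [h3 h4].
    by case: (hE2 _ _ h1 h3 h); rewrite -/g h2 h4.
  by case: (hE1 _ _ hx hy h).
- by move=> x y hx hy h; case: (hE1 _ _ hx hy h).
Qed.

End Msg.

Definition local_fun (L Y : Type) (D k : nat)
  (Fn : forall V : finType, rel V -> (V -> V -> nat) -> (V -> L) -> V -> Y) : Prop :=
  forall (V V' : finType) (e : rel V) (pn : V -> V -> nat) (lab : V -> L)
    (e' : rel V') (pn' : V' -> V' -> nat) (lab' : V' -> L) f g v v',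
    port_forest D e pn -> port_forest D e' pn' -> simf e pn lab e' pn' lab' k f g v v' ->
    Fn V e pn lab v = Fn V' e' pn' lab' v'.

Lemma nbr_at_induced (V : finType) (e : rel V) pn (p : pred V) v q : pinj e pn ->
  nbr_at (induced e p) pn v q =
  if nbr_at e pn v q is Some u then (if p v && p u then Some u else None) else None.
Proof.
move=> hp; have hp' : pinj (induced e p) pn.
  by move=> a b c /induced_sub h1 /induced_sub h2; apply: hp.
case h: (nbr_at e pn v q) => [u|].
  case: (nbr_at_Some h) => h1 h2; case: ifP => [/andP[h3 h4]|h3].
    by apply/eqP/nbr_atP => //; rewrite /induced h1 h3 h4.
  case h4: (nbr_at _ _ _ _) => [w|] //; case: (nbr_at_Some h4) => /and3P[h5 h6 h7] h8.
  have hw : u = w by apply: (hp v) => //; congruence.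
  by subst w; rewrite h6 h7 in h3.
case h4: (nbr_at _ _ _ _) => [w|] //; case: (nbr_at_Some h4) => /and3P[h5 h6 h7] h8.
suff : nbr_at e pn v q == Some w by rewrite h.
by apply/nbr_atP.
Qed.

Section SimAlg.
Variables (Si So : Type) (X : finType) (D B : nat).
Notation Lb := (X * nat)%type.
Variables (nph : nat -> nat) (rad : nat -> nat -> nat) (act : nat -> nat -> Lb -> bool).
Variable fn : nat -> nat -> forall V : finType, rel V -> (V -> V -> nat) -> (V -> Lb) -> V -> Lb.
Variables (bits : nat -> nat).
Variable ini : forall n, nat -> (nat -> option Si) -> (bits n).-tuple bool -> Lb.
Variable outp : Lb -> nat -> So.

Notation rcT := (nat -> option (seq bool)).
Notation cl := (@label_code X).

(* The node evaluates fn on an arbitrary instance that would have produced the same fingerprints;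
   locality of fn makes the choice irrelevant. *)
Definition Phi (n k : nat) (l0 : Lb) (rc : rcT) : Lb :=
  epsilon (inhabits l0) (fun y => exists (V : finType) (e : rel V) (pn : V -> V -> nat) (lab : V -> Lb) (v : V),
    [/\ port_forest D e pn, lab v = l0, forall q, port_codes cl D e pn lab (rad n k).-1 v q = rc q &
        fn n k e pn lab v = y]).

Definition msg_budget (n : nat) : nat := B * (trunc_log 2 n).+1.

Definition sim_state : Type := (nat * nat * Lb * rcT)%type.

(* The empty message is only sent when the budget is exceeded, which happens in failing runs alone. *)
Definition sim_send (n : nat) (s : sim_state) (p : nat) : seq bool :=
  let: (k, j, lab, rc) := s in
  if act n k lab then
    let m := true :: cl lab ++ unary p ++
      (if j is _.+1 then flatten [seq (if q == p then [::] else
          if rc q is Some t then true :: t else [:: false]) | q <- iota 0 D] else [::]) in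
    if size m <= msg_budget n then m else [::]
  else if 1 <= msg_budget n then [:: false] else [::].

(** Ports to inactive neighbours are treated as absent, so a phase runs on the subgraph induced by
    its active vertices. In the last round of a phase the new label is computed and the received
    codes are dropped. *)
Definition sim_recv (n : nat) (s : sim_state) (ms : nat -> option (seq bool)) : sim_state :=
  let: (k, j, lab, rc) := s in
  let rc' := fun q => if act n k lab then
     (if ms q is Some (true :: t) then Some t else None) else None in
  if j.+1 == rad n k then (k.+1, 0, Phi n k lab rc', fun=> None) else (k, j.+1, lab, rc').

Definition sim_time (n : nat) : nat := \sum_(k < nph n) rad n k.

Definition sim_algo : algo Si So :=
  @Algo Si So sim_state (seq bool) sim_time bits
    (fun n d ip b => (0, 0, ini d ip b, fun=> None)) sim_send sim_recv
    (fun n s p => outp s.1.2 p).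

Lemma sim_algo_congest : congest sim_algo.
Proof.
exists B, id; split => // n [[[k j] lab] rc] p /=.
rewrite -/(msg_budget n); case: ifP => _; first by case: ifP.
by case: ifP.
Qed.

Section Run.
Variables (n : nat) (V : finType) (e : rel V) (pn : V -> V -> nat) (inp : V -> V -> Si).
Variable beta : V -> (bits n).-tuple bool.

Fixpoint labels (k : nat) (v : V) : Lb :=
  if k is k'.+1 then
    fn n k' (induced e (fun x => act n k' (labels k' x))) pn (labels k') v
  else ini (deg e v) (fun p => omap (inp v) (nbr_at e pn v p)) (beta v).

Definition phase_graph (k : nat) : rel V := induced e (fun x => act n k (labels k x)).

Hypotheses (ht : is_tree e) (hD : max_deg_le e D) (hpn : port_numbering e pn).
Hypothesis hrad : forall k, 0 < rad n k.
Hypothesis hloc : forall k, local_fun D (rad n k) (@fn n k).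
Hypothesis hbud : forall k j v p, k < nph n -> j < rad n k -> p < D -> act n k (labels k v) ->
  (size (view_code cl D (phase_graph k) pn (labels k) j v p)).+1 <= msg_budget n.

Lemma port_forest_grf k : port_forest D (phase_graph k) pn.
Proof.
have hp := port_pinj hpn; split.
- exact/induced_forest/tree_forest.
- by move=> a b c /induced_sub h1 /induced_sub h2; apply: hp.
- by move=> v u /induced_sub h; case: (hpn v) => h1 _; apply: leq_trans (h1 _ h) (hD v).
Qed.

Lemma Phi_fn k v (rc : rcT) : (forall q, port_codes cl D (phase_graph k) pn (labels k) (rad n k).-1 v q = rc q) ->
  Phi n k (labels k v) rc = labels k.+1 v.
Proof.
move=> hrc; have ho := port_forest_grf k.
have h0 : exists y, exists (V : finType) (e : rel V) (pn : V -> V -> nat) (lab : V -> Lb) (v0 : V),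
    [/\ port_forest D e pn, lab v0 = labels k v, forall q, port_codes cl D e pn lab (rad n k).-1 v0 q = rc q &
        fn n k e pn lab v0 = y].
  by exists (fn n k (phase_graph k) pn (labels k) v), V, (phase_graph k), pn, (labels k), v.
case: (epsilon_spec (inhabits (labels k v)) _ h0) => V' [e' [pn' [lab' [v' [h1 h2 h3 h4]]]]].
rewrite -/(Phi n k (labels k v) rc) in h4; rewrite -h4.
have hq q : port_codes cl D e' pn' lab' (rad n k).-1 v' q = port_codes cl D (phase_graph k) pn (labels k) (rad n k).-1 v q.
  by rewrite h3 hrc.
case: (same_codes_sim (@label_code_pfree X) h1 ho h2 hq) => f [g hs].
rewrite prednK // in hs.
exact: (hloc h1 ho hs).
Qed.

Definition received (k j : nat) (v : V) : rcT :=
  if j is j'.+1 then port_codes cl D (phase_graph k) pn (labels k) j' v else fun=> None.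

(** The depth-[j] view with one port excluded is a concatenation of the codes received in the
    previous round on the other ports, so forwarding needs no decoding. *)
Lemma send_view_code k j v p : k < nph n -> j < rad n k -> p < D -> act n k (labels k v) ->
  sim_send n (k, j, labels k v, received k j v) p = true :: view_code cl D (phase_graph k) pn (labels k) j v p.
Proof.
move=> h1 h2 h3 h4; rewrite /sim_send h4.
have e1 : true :: cl (labels k v) ++ unary p ++
      (if j is _.+1 then flatten [seq (if q == p then [::] else
          if received k j v q is Some t then true :: t else [:: false]) | q <- iota 0 D] else [::]) =
   true :: view_code cl D (phase_graph k) pn (labels k) j v p.
  case: j h2 => [|j] h2 //; rewrite [RHS]/=; congr (_ :: _ ++ _ ++ flatten _).
  apply: eq_map => q; case: ifP => // _; rewrite /= /port_codes.
  by case: (nbr_at (phase_graph k) pn v q).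
by rewrite e1 /= hbud.
Qed.

Lemma exec_step k j v t : k < nph n -> j < rad n k ->
  (forall u, exec sim_algo n e pn inp beta t u = (k, j, labels k u, received k j u)) ->
  exec sim_algo n e pn inp beta t.+1 v =
    if j.+1 == rad n k then (k.+1, 0, labels k.+1 v, received k.+1 0 v) else (k, j.+1, labels k v, received k j.+1 v).
Proof.
move=> h1 h2 hx.
rewrite [LHS]/= !hx.
set ms := fun p : nat => omap _ _.
have hms q : (if act n k (labels k v) then
     (if ms q is Some (true :: t) then Some t else None) else None) = port_codes cl D (phase_graph k) pn (labels k) j v q.
  rewrite /ms /port_codes /phase_graph nbr_at_induced; last exact: port_pinj.
  case h: (nbr_at e pn v q) => [u|] /=; last by case: ifP.
  case: (nbr_at_Some h) => h3 _; rewrite hx.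
  have hp : pn u v < D.
    case: (hpn u) => h4 _; apply: leq_trans (hD u); apply: h4.
    by rewrite (forest_sym (tree_forest ht)).
  have hsend : sim_send n (k, j, labels k u, received k j u) (pn u v) =
      if act n k (labels k u) then true :: view_code cl D (phase_graph k) pn (labels k) j u (pn u v)
      else if 1 <= msg_budget n then [:: false] else [::].
    case: ifP => hu; first by apply: send_view_code.
    by rewrite [LHS]/= hu.
  rewrite hsend; case: (act n k (labels k v)) => //=; case: (act n k (labels k u)) => //=.
  by case: ifP.
rewrite /sim_recv; case: ifP => [/eqP h3|_].
  rewrite /received; congr pair; congr pair; apply: Phi_fn => q.
  by rewrite -h3 hms.
by congr pair; apply: functional_extensionality => q; rewrite hms.
Qed.

Lemma exec_phase k : k <= nph n -> forall v,
  exec sim_algo n e pn inp beta (\sum_(i < k) rad n i) v = (k, 0, labels k v, received k 0 v).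
Proof.
elim: k => [|k IH] hk v; first by rewrite big_ord0.
rewrite big_ord_recr /= -/(_ + _).
have main j : j < rad n k -> forall u,
  exec sim_algo n e pn inp beta (\sum_(i < k) rad n i + j) u = (k, j, labels k u, received k j u).
  elim: j => [|j IHj] hj u; first by rewrite addn0 IH // ltnW.
  rewrite addnS (exec_step _ hk (ltnW hj) (IHj (ltnW hj))).
  by rewrite ltn_eqF.
have hr := hrad k.
have -> : \sum_(i < k) rad n i + rad n k = (\sum_(i < k) rad n i + (rad n k).-1).+1 by lia.
rewrite (exec_step (k := k) (j := (rad n k).-1)) //; last first.
  by apply: main; lia.
  by rewrite prednK.
by rewrite prednK // eqxx.
Qed.

Lemma sim_algo_out v u : outl sim_algo n e pn inp beta v u = outp (labels (nph n) v) (pn v u).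
Proof. by rewrite /outl [a_time _ _]/= /sim_time exec_phase. Qed.

End Run.
End SimAlg.

(** * Lengths of the messages *)

Lemma sum_disjoint (T : finType) (qs : seq nat) (A : nat -> {set T}) (Z : {set T}) :
  uniq qs -> (forall q, q \in qs -> A q \subset Z) ->
  (forall q q', q \in qs -> q' \in qs -> q != q' -> [disjoint A q & A q']) ->
  \sum_(q <- qs) #|A q| <= #|Z|.
Proof.
elim: qs Z => [|q qs IH] Z; first by rewrite big_nil.
move=> /= /andP[hq hu] hsub hd; rewrite big_cons.
have h1 : A q \subset Z by apply: hsub; rewrite mem_head.
rewrite -(cardsID (A q) Z) (setIidPr h1) leq_add2l; apply: IH => //.
  move=> q' hq'; rewrite subsetD hsub ?inE ?hq' ?orbT //= disjoint_sym; apply: hd; rewrite ?mem_head ?inE ?hq' ?orbT //.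
  by apply: contraNneq hq => ->.
by move=> a b ha hb; apply: hd; rewrite inE ?ha ?hb orbT.
Qed.

Section Size.
Variables (L : Type) (cl : L -> seq bool) (D b : nat).
Variables (V : finType) (e : rel V) (pn : V -> V -> nat) (lab : V -> L).
Hypothesis hg : port_forest D e pn.
Hypothesis hb : forall v, size (cl (lab v)) <= b.
Notation view_code := (view_code cl D e pn lab).

Lemma view_code_size_exp j v p : p < D -> size (view_code j v p) <= (b + 2 * D) * D.+2 ^ j.
Proof.
case: hg => hf hp hD.
elim: j v p => [|j IH] v p hp'.
  rewrite /= size_cat size_cat size_unary /=; have := hb v; lia.
rewrite [view_code _ _ _]/= size_cat size_cat size_unary.
set fl := flatten _.
have : size fl <= D * ((b + 2 * D) * D.+2 ^ j).+1.
  rewrite /fl size_flatten /shape -map_comp sumnE big_map.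
  rewrite -[D in X in _ <= X * _](size_iota 0 D) -sum1_size big_distrl /=.
  apply: leq_sum => q _; rewrite mul1n; case: ifP => // _.
  case h: (nbr_at e pn v q) => [u|] //=; rewrite ltnS; apply: IH.
  by case: (nbr_at_Some h) => h1 _; apply: hD; rewrite (forest_sym hf).
have := hb v; have : 0 < D.+2 ^ j by rewrite expn_gt0.
rewrite expnS; move: (D.+2 ^ j) (size fl) (size _) => P f s; nia.
Qed.

Variable r : V.

Definition desc (i : nat) (x : V) : {set V} :=
  [set y | [exists m : 'I_#|V|.+1, sphere e r (i + m) y && within e m x y]].

Lemma descP i x y : reflect (exists m, sphere e r (i + m) y /\ within e m x y) (y \in desc i x).
Proof.
rewrite inE; apply: (iffP existsP) => [[m /andP[h1 h2]]|[m [h1 h2]]]; first by exists m.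
have hm : m <= #|V|.
  have h3 := connect_within_card (within_connect (sphere_within h1)).
  by rewrite leqNgt; apply/negP => h4; move: (sphere_lt h1 (j := #|V|)); rewrite h3; lia.
have hm' : m < #|V|.+1 by [].
by exists (Ordinal hm'); rewrite /= h1 h2.
Qed.

Lemma anc_uniq i m c c' y : sphere e r i c -> sphere e r i c' -> sphere e r (i + m) y ->
  within e m c y -> within e m c' y -> c = c'.
Proof.
case: hg => hf _ _ hc hc'; elim: m y => [|m IH] y.
  by move=> _; rewrite !within0 => /eqP -> /eqP ->.
rewrite addnS => hy.
have main a : sphere e r i a -> within e m.+1 a y -> exists2 z, sphere e r (i + m) z & within e m a z /\ e z y.
  move=> ha; rewrite withinS => /orP[h|/existsP[z /andP[h1 h2]]].
    have := sphere_lt hy (ltnSn _); by rewrite (within_add (sphere_within ha) h).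
  exists z => //; case: (within_sph (within_add (sphere_within ha) h1)) => k hk hz.
  case: (sphere_edge hf hz h2) => [h3|[k' hk' h3]].
    by have <- : k = i + m by have := sphere_uniq hy h3; lia.
  by have := sphere_uniq hy h3; lia.
move=> /(main _ hc)[z hz [h1 h2]] /(main _ hc')[z' hz' [h1' h2']].
have hzz : z = z' by apply: (sphere_parent_uniq hf hy hz hz' h2 h2').
by subst z'; apply: IH hz h1 h1'.
Qed.

(** With the tree rooted at [r] and the excluded port leading to the parent, the views of different
    children list disjoint sets of descendants. So the length is linear in the number of
    descendants, whatever the depth [j]. *)
Lemma view_code_size_desc j i x p : p < D -> sphere e r i x ->
  (if i is i'.+1 then exists w, [/\ sphere e r i' w, e x w & p = pn x w] else True) ->
  size (view_code j x p) <= (b + 2 * D) * #|desc i x|.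
Proof.
case: (hg) => hf hp hD.
elim: j i x p => [|j IH] i x p hp' hx hi.
  have h1 : 0 < #|desc i x|.
    by apply/card_gt0P; exists x; apply/descP; exists 0; rewrite addn0 within_refl.
  rewrite /= size_cat size_cat size_unary /=; have := hb x; nia.
rewrite [view_code _ _ _]/= size_cat size_cat size_unary.
set fl := flatten _.
pose A q : {set V} := if q == p then set0 else if nbr_at e pn x q is Some u then desc i.+1 u else set0.
have hchild q u : q != p -> nbr_at e pn x q = Some u -> sphere e r i.+1 u /\ e x u.
  move=> hq h; case: (nbr_at_Some h) => h1 h2; split => //.
  case: (sphere_edge hf hx h1) => // -[k hk h3]; subst i.
  case: hi => w [h4 h5 h6].
  have hwu : w = u by apply: (sphere_parent_uniq hf hx h4 h3); rewrite (forest_sym hf).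
  by subst w; rewrite h6 h2 eqxx in hq.
have hfl : size fl <= D + (b + 2 * D) * \sum_(q <- iota 0 D) #|A q|.
  rewrite /fl size_flatten /shape -map_comp sumnE big_map.
  rewrite -[D in X in _ <= X + _](size_iota 0 D) -sum1_size big_distrr /= -big_split /=.
  apply: leq_sum => q _; rewrite /A; case: eqP => [_|/eqP hq]; first by rewrite cards0.
  case h: (nbr_at e pn x q) => [u|] //.
  case: (hchild q u hq h) => h1 h2; rewrite /= add1n ltnS; apply: IH => //.
    by apply: hD; rewrite (forest_sym hf).
  by exists x; rewrite (forest_sym hf).
have hxd : x \in desc i x by apply/descP; exists 0; rewrite addn0 within_refl.
have hsum : \sum_(q <- iota 0 D) #|A q| <= #|desc i x :\ x|.
  apply: (@sum_disjoint V); first exact: iota_uniq.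
    move=> q _; rewrite /A; case: eqP => [_|/eqP hq]; first exact: sub0set.
    case h: (nbr_at e pn x q) => [u|]; last exact: sub0set.
    case: (hchild q u hq h) => h1 h2; apply/subsetP => y /descP[m [h3 h4]].
    rewrite in_setD1; apply/andP; split.
      apply/eqP => hyx; rewrite hyx in h3; have := sphere_uniq hx h3; lia.
    apply/descP; exists m.+1; rewrite addnS; split; first by rewrite addSn in h3.
    exact: within_cons h2 h4.
  move=> q q' _ _ hqq; rewrite /A.
  case: eqP => [_|/eqP hq]; first by rewrite disjoint_sym; apply/pred0P => y; rewrite /= !inE andbF.
  case: eqP => [_|/eqP hq']; first by apply/pred0P => y; rewrite /= !inE andbF.
  case h: (nbr_at e pn x q) => [u|]; last by apply/pred0P => y; rewrite /= !inE.
  case h': (nbr_at e pn x q') => [u'|]; last by apply/pred0P => y; rewrite /= !inE andbF.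
  case: (hchild q u hq h) (hchild q' u' hq' h') => h1 h2 [h3 h4].
  apply/pred0P => y; apply/negP => /andP[/descP[m [h5 h6]] /descP[m' [h7 h8]]].
  have hm : m = m' by have := sphere_uniq h5 h7; lia.
  subst m'; have huu := anc_uniq h1 h3 h5 h6 h8; subst u'.
  by case/eqP: hqq; case: (nbr_at_Some h) (nbr_at_Some h') => _ <- [_ <-].
have hc : #|desc i x| = #|desc i x :\ x|.+1 by rewrite (cardsD1 x) hxd.
have := hb x; rewrite hc; move: hfl hsum hp'.
move: (size fl) (size (cl _)) (#|desc i x :\ x|) (\sum_(q <- iota 0 D) #|A q|) => f s d t.
clear; nia.
Qed.

End Size.

Lemma view_code_size_comp (L : Type) (cl : L -> seq bool) (D b : nat)
  (V : finType) (e : rel V) (pn : V -> V -> nat) (lab : V -> L) j v p :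
  port_forest D e pn -> (forall v, size (cl (lab v)) <= b) -> p < D ->
  size (view_code cl D e pn lab j v p) <= (b + 2 * D) * #|[set y | connect e v y]|.
Proof.
move=> hg hb hp.
have h0 : sphere e v 0 v by rewrite sph0.
apply: leq_trans (@view_code_size_desc _ _ _ _ _ _ _ _ hg hb v j 0 v p hp h0 I) _.
rewrite leq_mul2l; apply/orP; right; apply: subset_leq_card; apply/subsetP => y /descP[m [h1 h2]].
by rewrite inE; apply: within_connect h2.
Qed.

(** * Completing the pockets *)

Section Finish.
Variables (Si So : Type) (Pi : LCL Si So) (A : algo Si So) (n0 : nat).
Notation W := ((a_bits A n0).-tuple bool).
Notation inf := (nat * (nat -> option Si))%type.
Notation R := (bad_rad Pi A n0).
Variables (D K N n1 n2 : nat).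

Section FinDef.
Variables (V : finType) (h : rel V) (pn : V -> V -> nat).
Variables (I : V -> inf) (chi : V -> 'I_K) (rho : V -> option W).

Definition cutset : pred V := cutv h (4 * R) K chi N.
Definition lvl : V -> nat := layer h (4 * R) K chi N.

Definition Bad (v : V) (w : {ffun V -> W}) : bool := bad Pi h pn I w v.

(** Colours are distinct near [s], so the values there are given as a function of the colour, which
    mentions no vertex. *)
Definition cutext (s : V) (gm : {ffun 'I_K -> W}) : V -> option W := fun u =>
  if rho u is Some a then Some a else if within h R s u then Some (gm (chi u)) else None.

Definition goodcut (s : V) (gm : {ffun 'I_K -> W}) : bool :=
  [forall u, forall v, [&& rho u == None, within h R s u & within h R u v] ==>
     unlikely Bad n2 (cutext s gm) v].

Definition cutchoice (s : V) : option {ffun 'I_K -> W} := [pick gm | goodcut s gm].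

(* Values are picked rather than vertices: the choice must depend on the isomorphism type alone. *)
Definition with_cuts : V -> option W := fun u =>
  if rho u is Some a then Some a else
  [pick a | [exists s, [&& cutset s, within h R s u &
     (if cutchoice s is Some gm then gm (chi u) == a else false)]]].
End FinDef.

Section FinDef2.
Variables (V : finType) (h : rel V) (pn : V -> V -> nat).
Variables (I : V -> inf) (ct : pred V) (ky : V -> nat) (r2 : V -> option W).

Definition piece : rel V := induced h (fun x => ~~ ct x).

Fixpoint wlk (x : V) (ps : seq nat) : option V :=
  if ps is p :: ps' then obind (fun y => wlk y ps') (nbr_at h pn x p) else Some x.

(* A vertex is named by the set of all short port walks leading to it from the leader. *)
Definition addr (l x : V) : seq nat -> Prop := fun ps => size ps <= N /\ wlk l ps = Some x.

(** Only events meeting an unset variable of the piece are listed. All unset variables of such an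
    event lie in the same piece, so no other piece has a say in it. *)
Definition completes (l : V) (gm : (seq nat -> Prop) -> W) : Prop :=
  forall u v, r2 u = None -> within piece N l u -> within h R u v ->
    ~~ bad Pi h pn I (fun x => if r2 x is Some a then a else gm (addr l x)) v.

Definition w0 : W := [tuple of nseq (a_bits A n0) false].

Definition chosen (l : V) : (seq nat -> Prop) -> W := epsilon (inhabits (fun=> w0)) (completes l).

Definition isleader (l : V) : bool := [forall z, within piece (2 * N) l z ==> (ky z <= ky l)].

Definition finish_piece (v : V) : W :=
  if r2 v is Some a then a else
  odflt w0 [pick a | [exists l, [&& within piece N v l, isleader l & chosen l (addr l v) == a]]].
End FinDef2.

Definition finish (V : finType) (h : rel V) (pn : V -> V -> nat)
  (I : V -> inf) (chi : V -> 'I_K) (rho : V -> option W) : V -> W :=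
  finish_piece h pn I (cutset h chi) (fun x => lvl h chi x * K + chi x) (with_cuts h pn I chi rho).

Section Correct.
Variables (V : finType) (e : rel V) (pn : V -> V -> nat) (U : pred V).
Variables (I : V -> inf) (chi : V -> 'I_K) (rho : V -> option W).
Notation h := (induced e U).
Notation asg := {ffun V -> W}.
Notation Q := #|{ffun V -> W}|.
Notation BadE v := (fun w : asg => bad Pi e pn I w v).
Hypothesis hf : forest e.
Hypothesis hD : max_deg_le e D.
Hypothesis hpn : pinj e pn.
Hypothesis hU : forall x y, rho x = None -> within e (2 * R) x y -> U y.
Hypothesis hcol : forall x y, within e (4 * R) x y -> chi x = chi y -> x = y.
Hypothesis hrho : forall v, unlikely (fun v => BadE v) n1 rho v.
Hypothesis hN : forall x, ~~ alive h (4 * R) K chi N x.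
Hypothesis hn1 : n2 * D.+2 ^ (2 * R) <= n1.
Hypothesis hn2 : 4 * D.+2 ^ (2 * R) <= n2.

Notation cutset := (cutset h chi).
Notation r2 := (with_cuts h pn I chi rho).
Notation Pg := (piece h cutset).

Let hes : symmetric e := forest_sym hf.
Let hh : forest h := induced_forest U hf.
Let hhs : symmetric h := forest_sym hh.
Let hR : 0 < R. Proof. by rewrite /bad_rad addn1. Qed.

Lemma asg_gt0 : 0 < Q.
Proof. by apply/card_gt0P; exists [ffun=> w0]. Qed.

Lemma h_within j u v : rho u = None -> j <= 2 * R -> within e j u v -> within h j u v.
Proof.
move=> hu; elim: j v => [|j IH] v hj; first by rewrite !within0.
rewrite withinS => /orP[h1|/existsP[z /andP[h1 h2]]].
  by apply: (withinW (leqnSn j)); apply: IH => //; lia.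
apply: within_rcons (IH _ _ h1) _; first by lia.
have h3 : within e (2 * R) u z by apply: (withinW _ h1); lia.
have h4 : within e (2 * R) u v by apply: (withinW _ (within_rcons h1 h2)); lia.
by rewrite /induced h2 (hU hu h3) (hU hu h4).
Qed.

Lemma h_within_e j u v : within h j u v -> within e j u v.
Proof. by apply: within_sub; apply: induced_sub. Qed.

(** The [R]-ball of [v] lies within [2 * R] of the unset variable [u], hence in [U]; the pocket
    shows it completely. *)
Lemma bad_he u v (w : V -> W) : rho u = None -> within e R u v -> bad Pi h pn I w v = bad Pi e pn I w v.
Proof.
move=> hu huv; have hpn' : pinj h pn.
  by move=> a b c /induced_sub h1 /induced_sub h2; apply: hpn.
apply/esym; apply: (@bad_sim _ _ Pi A n0 V V e pn h pn I I w w id id) => //.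
apply: sim_id; first exact: induced_sub.
move=> x y hx hy hxy; have hm z : within e R v z -> U z.
  by move=> hz; apply: (hU hu); rewrite mul2n -addnn; apply: within_add huv hz.
by rewrite /induced hxy !hm.
Qed.

Lemma bad_dep v : depends_on (within e R v) (BadE v).
Proof. by move=> w w' hw; apply: bad_local. Qed.

Lemma chi_e x y : within e (4 * R) x y -> (chi x : nat) = chi y -> x = y.
Proof. by move=> h1 h2; apply: hcol => //; apply: val_inj. Qed.

Lemma cutset_sep x y : within h (4 * R) x y -> cutset x -> cutset y -> x = y.
Proof.
apply: (cutv_sep hh hN) => a b /h_within_e; exact: chi_e.
Qed.

(** First moment: over random values near [s], the conditional probabilities of the at most
    [D.+2 ^ (2 * R)] events in [Z] add up to at most [#|Z| / n1] on average. Some choice attains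
    this, and then every single event is below [1 / n2] by [hn1]. *)
Lemma cutchoice_exists s : exists2 gm, cutchoice h pn I chi rho s = Some gm & goodcut h pn I chi rho s gm.
Proof.
suff [gm hgm] : exists gm, goodcut h pn I chi rho s gm.
  rewrite /cutchoice; case: pickP => [g hg|hn]; first by exists g.
  by move: (hn gm); rewrite hgm.
pose Z := [set v | [exists u, [&& rho u == None, within h R s u & within h R u v]]].
have hZ : #|Z| <= D.+2 ^ (2 * R).
  apply: leq_trans (ball_card hD (2 * R) s); apply: subset_leq_card; apply/subsetP => v.
  rewrite !inE => /existsP[u /and3P[_ /h_within_e h1 /h_within_e h2]].
  by rewrite mul2n -addnn; apply: within_add h1 h2.
pose ext (w : asg) : V -> option W := fun x => if rho x is Some a then Some a else
   if within h R s x then Some (w x) else None.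
have hsum : \sum_(w : asg) \sum_(v in Z) cnt (BadE v) (ext w) * n1 <= #|Z| * Q * Q.
  rewrite exchange_big /= -mulnA -sum_nat_const; apply: leq_sum => v _.
  rewrite -big_distrl /= (@cnt_reveal V W (fun=> within h R s) (BadE v) rho) //.
  by rewrite mulnAC leq_mul2r; apply/orP; right; apply: hrho.
have [w hw] : exists w : asg, \sum_(v in Z) cnt (BadE v) (ext w) * n1 <= #|Z| * Q.
  apply: NNPP => hno; move: hsum; apply/negP; rewrite -ltnNge.
  have hlt (w : asg) : (#|Z| * Q).+1 <= \sum_(v in Z) cnt (BadE v) (ext w) * n1.
    by rewrite ltnNge; apply/negP => h1; apply: hno; exists w.
  have : \sum_(w : asg) (#|Z| * Q).+1 <= \sum_(w : asg) \sum_(v in Z) cnt (BadE v) (ext w) * n1.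
    by apply: leq_sum => w _.
  rewrite sum_nat_const; have := asg_gt0; set q := #|_|; move: (#|Z| * q) => z; nia.
(* Reading the chosen values by colour loses nothing, as colours are distinct within distance [R] of
   [s]. *)
pose gm : {ffun 'I_K -> W} := [ffun k => if [pick x | within h R s x && (chi x == k)] is Some x then w x else w0].
exists gm.
have hext : cutext h chi rho s gm =1 ext w.
  move=> x; rewrite /cutext /ext; case: (rho x) => //; case: ifP => // hx; congr Some.
  rewrite ffunE; case: pickP => [y /andP[hy /eqP hxy]|hn]; last by move: (hn x); rewrite hx eqxx.
  congr (w _); apply: hcol => //; rewrite (within_sym hhs) in hy.
  by apply: h_within_e; apply: (withinW _ (within_add hy hx)); lia.
apply/forallP => u; apply/forallP => v; apply/implyP => /and3P[/eqP h1 h2 h3].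
have hv : v \in Z by rewrite inE; apply/existsP; exists u; rewrite h1 h2 h3.
have e1 : cnt (Bad h pn I v) (cutext h chi rho s gm) = cnt (BadE v) (ext w).
  apply: eq_card => w'; rewrite !inE /Bad (bad_he _ h1 (h_within_e h3)).
  by congr bad; apply: functional_extensionality => x; rewrite !ffunE hext.
rewrite /unlikely e1.
have h4 : cnt (BadE v) (ext w) * n1 <= #|Z| * Q.
  by apply: leq_trans hw; rewrite (bigD1 v) //= leq_addr.
have hE : 0 < D.+2 ^ (2 * R) by rewrite expn_gt0.
rewrite -(leq_pmul2r hE) -mulnA (leq_trans _ (leq_trans h4 _)) //.
  by rewrite leq_mul2l hn1 orbT.
by rewrite mulnC leq_mul2l hZ orbT.
Qed.

(* Near a fixed event at most one cut vertex is relevant. *)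
Lemma with_cuts_near v u s : within e R v u -> rho u = None -> cutset s -> within h R s u ->
  forall gm, cutchoice h pn I chi rho s = Some gm ->
  forall x, within e R v x -> r2 x = cutext h chi rho s gm x.
Proof.
move=> hu hru hs hsu gm hgm x hx; rewrite /with_cuts /cutext.
case hrx: (rho x) => [a|] //.
have huniq s' : cutset s' -> within h R s' x -> s' = s.
  move=> hs' hs'x; apply: cutset_sep => //; rewrite (within_sym hhs).
  have hux : within h (2 * R) u x.
    apply: h_within => //; rewrite mul2n -addnn; apply: within_add hx.
    by rewrite (within_sym hes).
  rewrite (within_sym hhs) in hs'x.
  by apply: (withinW _ (within_add (within_add hsu hux) hs'x)); lia.
case: pickP => [a /existsP[s' /and3P[h1 h2]]|hn].
  have e1 := huniq _ h1 h2; subst s'; rewrite hgm h2 => /eqP -> //.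
case: ifP => // hsx; move: (hn (gm (chi x))) => /= /negbT/negP; case.
by apply/existsP; exists s; rewrite hs hsx hgm eqxx.
Qed.

Lemma with_cuts_none x : r2 x = None -> rho x = None /\ (forall s, cutset s -> ~~ within h R s x).
Proof.
rewrite /with_cuts; case hr: (rho x) => [a|] // h1; split => // s hs; apply/negP => h2.
case: (cutchoice_exists s) => gm hgm _.
move: h1; case: pickP => // hn _; move: (hn (gm (chi x))) => /= /negbT/negP; case.
by apply/existsP; exists s; rewrite hs h2 hgm eqxx.
Qed.

Lemma with_cuts_unlikely v : cnt (BadE v) r2 * n2 <= Q.
Proof.
case: (pickP [pred u | [&& within e R v u, rho u == None & [exists s, cutset s && within h R s u]]]) =>
   [u /and3P[h1 /eqP h2 /existsP[s /andP[h3 h4]]]|hn].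
  case: (cutchoice_exists s) => gm hgm hgood.
  rewrite (cnt_ext (@bad_dep v) (with_cuts_near h1 h2 h3 h4 hgm)).
  rewrite (within_sym hes) in h1.
  move: hgood => /forallP /(_ u) /forallP /(_ v); rewrite h2 eqxx h4 (h_within h2 _ h1) /=; last by lia.
  rewrite /unlikely; congr (_ * _ <= _); apply: eq_card => w; rewrite !inE /Bad.
  by rewrite (bad_he _ h2 h1).
rewrite (@cnt_ext _ _ (within e R v) _ r2 rho (@bad_dep v)); last first.
  move=> x hx; rewrite /with_cuts; case hr: (rho x) => [a|] //.
  case: pickP => // a /existsP[s /and3P[h1 h2 _]].
  by move: (hn x); rewrite /= hx hr /= => /negbT/negP; case; apply/existsP; exists s; rewrite h1 h2.
apply: leq_trans (hrho v); rewrite leq_mul2l; apply/orP; right; apply: leq_trans hn1.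
by rewrite leq_pmulr // expn_gt0.
Qed.

(** The local lemma is applied once to the whole tree. No node computes this assignment; it only
    witnesses that every piece has a completion. *)
Lemma completion : exists w : asg, forall v, ~~ bad Pi e pn I (fill r2 w) v.
Proof.
have hd v : #|[set j | meets (fun v => within e R v) v j]| <= D.+2 ^ (2 * R).
  apply: leq_trans (ball_card hD (2 * R) v); apply: subset_leq_card; apply/subsetP => j.
  rewrite !inE => /existsP[x /andP[h1 h2]]; rewrite mul2n -addnn; apply: within_add h1 _.
  by rewrite (within_sym hes).
have hE : 0 < D.+2 ^ (2 * R) by rewrite expn_gt0.
apply: (@lll V W V (fun v w => bad Pi e pn I (fill r2 w) v) (fun v => within e R v) n2 _ _ _ asg_gt0 hd) => //.
- move=> v; exact: depends_fill (@bad_dep v).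
- exact: with_cuts_unlikely.
- by lia.
Qed.

(** Otherwise a walk of length [2 * R] between the two variables would pass a cut vertex, at
    distance at most [R] from one of them, and that variable would have been set. *)
Lemma with_cuts_coupled v x y : within e R v x -> within e R v y -> r2 x = None -> r2 y = None ->
  connect Pg x y.
Proof.
move=> hx hy /with_cuts_none[h1 h2] /with_cuts_none[h3 h4].
have hxy : within h (2 * R) x y.
  apply: h_within => //; rewrite mul2n -addnn; apply: within_add hy.
  by rewrite (within_sym hes).
case: (within_cut (fun z => ~~ cutset z) hxy) => [h5|[i [s [h5 h6 h7 h8]]]].
  exact: within_connect h5.
rewrite negbK in h6; case: (leqP i R) => hi.
  by move: (h2 s h6); rewrite (within_sym hhs) (withinW hi h7).
by move: (h4 s h6); rewrite (withinW _ h8) //; lia.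
Qed.

Lemma chi_lt x : chi x < K. Proof. exact: ltn_ord. Qed.

Notation ky := (fun x => lvl h chi x * K + chi x).
Notation conn := (connect Pg).

Let hcolh : forall x y, within h (4 * R) x y -> (chi x : nat) = chi y -> x = y.
Proof. by move=> x y /h_within_e; apply: chi_e. Qed.

(** All vertices of a piece are within [N] of its vertex of largest key, so comparing keys up to
    distance [2 * N] covers the whole piece. *)
Lemma leaderP l : isleader h cutset ky l <-> (forall z, conn l z -> ky z <= ky l).
Proof.
split=> [/forallP h1 z hz|h1]; last first.
  by apply/forallP => z; apply/implyP => /within_connect; apply: h1.
case: (leader_exists h (4 * R) K chi N l) => y h2 h3.
have near a : conn l a -> within Pg N y a.
  move=> ha; apply: (leader_near hh chi_lt hN h3); apply: connect_trans ha.
  by rewrite (sym_connect_sym (induced_sym _ hhs)).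
have := h1 z; move/implyP; apply; rewrite mul2n -addnn.
apply: within_add (near _ hz); rewrite (within_sym (induced_sym _ hhs)); apply: near.
exact: connect0.
Qed.

Lemma addr_inj l x y : within h N l x -> addr h pn l x = addr h pn l y -> x = y.
Proof.
move=> hx hxy.
have hpn' : pinj h pn by move=> a b c /induced_sub h1 /induced_sub h2; apply: hpn.
have : exists ps, addr h pn l x ps.
  have : exists2 ps, size ps <= N & wlk h pn l ps = Some x.
    elim: N l hx {hxy} => [|m IH] l; first by rewrite within0 => /eqP ->; exists [::].
    move=> /within_split[->|[z h1 /IH[ps h2 h3]]]; first by exists [::].
    by exists (pn l z :: ps) => //=; rewrite nbr_at_pn.
  by case=> ps h1 h2; exists ps.
move=> [ps h1]; have h2 := h1; rewrite hxy in h2.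
by case: h1 => _ h1; case: h2 => _; rewrite h1 => -[].
Qed.

Lemma completes_exists l : (forall z, conn l z -> ky z <= ky l) -> exists gm, completes h pn I cutset r2 l gm.
Proof.
move=> hl; case: completion => w hw.
(* The global completion read through addresses; by [addr_inj] the vertex found for an address that
   occurs is the right one. *)
pose gm (P : seq nat -> Prop) : W := 
  w (epsilon (inhabits l) (fun x => within h N l x /\ addr h pn l x = P)).
exists gm => u v hu hlu huv; have [hru _] := with_cuts_none hu.
rewrite (bad_he _ hru (h_within_e huv)).
have hsub : within e R v u by rewrite (within_sym hes); apply: h_within_e.
rewrite (@bad_local _ _ Pi A n0 V e pn I _ (fill r2 w) v) // => x hx.
rewrite ffunE; case hrx: (r2 x) => [a|] //.
have hux := with_cuts_coupled hsub hx hu hrx.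
have hlx : within h N l x.
  have := leader_near hh chi_lt hN hl (connect_trans (within_connect hlu) hux).
  by apply: within_sub; apply: induced_sub.
have h0 : exists x', within h N l x' /\ addr h pn l x' = addr h pn l x by exists x.
case: (epsilon_spec (inhabits l) _ h0) => h1 h2.
by rewrite /gm; congr (w _); apply: addr_inj h1 h2.
Qed.

(** If the event meets an unset variable, all its unset variables lie in one piece, each finds the
    unique leader of that piece, and so all take their values from the same [chosen] completion.
    Otherwise its values are already those of the global completion. *)
Lemma finish_correct v : ~~ bad Pi e pn I (finish h pn I chi rho) v.
Proof.
case: (pickP [pred u | within e R v u && (r2 u == None)]) => [u /andP[h1 /eqP h2]|hn]; last first.
  case: completion => w hw; rewrite (@bad_local _ _ Pi A n0 V e pn I _ (fill r2 w) v) // => x hx.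
  rewrite ffunE /finish /finish_piece; move: (hn x); rewrite /= hx /=.
  by case: (r2 x).
case: (leader_exists h (4 * R) K chi N u) => l h3 h4.
case: (with_cuts_none h2) => hru _.
have hG := epsilon_spec (inhabits (fun=> w0)) _ (completes_exists h4).
have hlu : conn l u by rewrite (sym_connect_sym (induced_sym _ hhs)).
have huv : within e R u v by rewrite (within_sym hes).
have := hG u v h2 (leader_near hh chi_lt hN h4 hlu) (h_within hru _ huv).
rewrite (bad_he _ hru huv) (@bad_local _ _ Pi A n0 V e pn I _ (finish h pn I chi rho) v) //.
  by apply; lia.
move=> x hx; rewrite /finish /finish_piece; case hrx: (r2 x) => [a|] //.
have hux := with_cuts_coupled h1 hx h2 hrx.
have hlx := connect_trans hlu hux.
have hwx : within Pg N x l.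
  by rewrite (within_sym (induced_sym _ hhs)); apply: (leader_near hh chi_lt hN h4 hlx).
case: pickP => [a /existsP[l' /and3P[h5 h6 /eqP <-]]|hno]; last first.
  move: (hno (chosen h pn I cutset r2 l (addr h pn l x))) => /= /negbT/negP; case.
  by apply/existsP; exists l; rewrite hwx eqxx andbT; apply/leaderP.
have -> // : l' = l.
apply/esym; apply: (leader_uniq hh chi_lt hN hcolh _ h4) => //; first by lia.
  by apply/leaderP.
exact: connect_trans hlx (within_connect h5).
Qed.

End Correct.
End Finish.

(** * Locality of the completion *)

Lemma leq_ratio a b q q' n : 0 < q -> 0 < q' -> a * q' = b * q -> (b * n <= q') = (a * n <= q).
Proof.
move=> h1 h2 h3; rewrite -(leq_pmul2r h1) -[RHS](leq_pmul2r h2).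
by rewrite mulnAC -h3 mulnAC [q' * q]mulnC.
Qed.

Section SimMore.
Variables (L : Type) (V V' : finType) (e : rel V) (pn : V -> V -> nat) (lab : V -> L).
Variables (e' : rel V') (pn' : V' -> V' -> nat) (lab' : V' -> L).
Variables (k : nat) (f : V -> V') (g : V' -> V) (v : V) (v' : V').
Hypothesis hs : simf e pn lab e' pn' lab' k f g v v'.

Lemma sim_ex (b : nat) (P : pred V) (P' : pred V') : b <= k ->
  (forall x, within e b v x -> P' (f x) = P x) ->
  [exists x, within e' b v' x && P' x] = [exists x, within e b v x && P x].
Proof.
move=> hb hP; have hsb := sim_weaken hs hb.
apply/existsP/existsP => [[x /andP[h1 h2]]|[x /andP[h1 h2]]].
  by case: (sim_bwd hsb h1) => h3 h4; exists (g x); rewrite h3 -hP // h4.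
by case: (sim_fwd hsb h1) => h3 h4; exists (f x); rewrite h3 hP.
Qed.

Lemma sim_all (b : nat) (P : pred V) (P' : pred V') : b <= k ->
  (forall x, within e b v x -> P' (f x) = P x) ->
  [forall x, within e' b v' x ==> P' x] = [forall x, within e b v x ==> P x].
Proof.
move=> hb hP; apply: negb_inj; rewrite !negb_forall.
rewrite (eq_existsb (P2 := fun x => within e' b v' x && ~~ P' x)); last by move=> x; rewrite negb_imply.
rewrite [RHS](eq_existsb (P2 := fun x => within e b v x && ~~ P x)); last by move=> x; rewrite negb_imply.
by apply: sim_ex => // x hx; rewrite hP.
Qed.

Lemma sim_induced (p : pred V) (p' : pred V') :
  (forall x, within e k v x -> p' (f x) = p x) ->
  simf (induced e p) pn lab (induced e' p') pn' lab' k f g v v'.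
Proof.
move=> hp.
have hsub j x y : within (induced e p) j x y -> within e j x y by apply: within_sub; apply: induced_sub.
have hsub' j x y : within (induced e' p') j x y -> within e' j x y by apply: within_sub; apply: induced_sub.
have h1 j x : j <= k -> within (induced e p) j v x -> within (induced e' p') j v' (f x).
  elim: j x => [|j IH] x hj; first by rewrite !within0 -(sim_ctr hs) => /eqP ->.
  rewrite withinS => /orP[h|/existsP[y /andP[h2 /and3P[h3 h4 h5]]]].
    by apply: (withinW (leqnSn j)); apply: IH => //; lia.
  apply: within_rcons (IH _ _ h2) _; first by lia.
  have hy : within e k v y by apply: (withinW _ (hsub _ _ _ h2)); lia.
  have hx : within e k v x by apply: (withinW _ (within_rcons (hsub _ _ _ h2) h3)).
  by rewrite /induced (sim_adj hs) // !hp // h3 h4 h5.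
have h2 j x : j <= k -> within (induced e' p') j v' x -> within (induced e p) j v (g x).
  elim: j x => [|j IH] x hj; first by rewrite !within0 -(sim_back hs) => /eqP ->.
  rewrite withinS => /orP[h|/existsP[y /andP[h3 /and3P[h4 h5 h6]]]].
    by apply: (withinW (leqnSn j)); apply: IH => //; lia.
  apply: within_rcons (IH _ _ h3) _; first by lia.
  have hy : within e' k v' y by apply: (withinW _ (hsub' _ _ _ h3)); lia.
  have hx : within e' k v' x by apply: (withinW _ (within_rcons (hsub' _ _ _ h3) h4)).
  case: (sim_bwd hs hx) (sim_bwd hs hy) => h7 h8 [h9 h10].
  by rewrite /induced -(sim_adj hs) // -!hp // h8 h10 h4 h5 h6.
split.
- exact: sim_ctr hs.
- move=> x hx; split; first exact: h1.
  by case: (sim_fwd hs (hsub _ _ _ hx)).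
- move=> x hx; split; first exact: h2.
  by case: (sim_bwd hs (hsub' _ _ _ hx)).
- by move=> x /hsub hx; exact: (sim_lab hs hx).
- by move=> x y /hsub hx /hsub hy; rewrite /induced (sim_adj hs) // !hp.
- by move=> x y /hsub hx /hsub hy /induced_sub; apply: (sim_pn hs).
Qed.

Lemma sim_deg_pred (p : pred V) (p' : pred V') : 0 < k ->
  (forall x, within e 1 v x -> p' (f x) = p x) -> deg_pred e' p' v' = deg_pred e p v.
Proof.
move=> hk hp; have hs1 := sim_weaken hs hk.
have hc := within_refl e 1 v; have hc' := within_refl e' 1 v'.
apply/eqP; rewrite eqn_leq; apply/andP; split.
  rewrite /deg_pred -(@card_in_imset _ _ g); last first.
    move=> x y; rewrite !inE => /andP[_ /within_edge hx] /andP[_ /within_edge hy] h.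
    by case: (sim_bwd hs1 hx) (sim_bwd hs1 hy) => _ h1 [_ h2]; rewrite -h1 h h2.
  apply: subset_leq_card; apply/subsetP => y /imsetP[x]; rewrite !inE => /andP[h1 h2] ->.
  case: (sim_bwd hs1 (within_edge h2)) => h3 h4.
  by rewrite -hp // h4 h1 /= -(sim_adj hs1) // (sim_ctr hs) h4.
rewrite /deg_pred -(@card_in_imset _ _ f); last first.
  move=> x y; rewrite !inE => /andP[_ /within_edge hx] /andP[_ /within_edge hy] h.
  by case: (sim_fwd hs1 hx) (sim_fwd hs1 hy) => _ h1 [_ h2]; rewrite -h1 h h2.
apply: subset_leq_card; apply/subsetP => y /imsetP[x]; rewrite !inE => /andP[h1 h2] ->.
have h3 := within_edge h2.
by rewrite hp // h1 /= -(sim_ctr hs) (sim_adj hs1).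
Qed.

Lemma sim_wlk a x ps : pinj e pn -> pinj e' pn' -> within e a v x -> a + size ps <= k ->
  wlk e' pn' (f x) ps = omap f (wlk e pn x ps) /\
  (forall y, wlk e pn x ps = Some y -> within e (a + size ps) v y).
Proof.
move=> h1 h2; elim: ps a x => [|p ps IH] a x hx hk /=.
  by split => // y [<-]; rewrite addn0.
rewrite (sim_nbr hs p h1 h2 hx); last by move: hk => /=; lia.
case h: (nbr_at e pn x p) => [u|] //=; case: (nbr_at_Some h) => h3 _.
rewrite addnS -addSn; apply: (IH a.+1); first exact: within_rcons hx h3.
by move: hk => /=; lia.
Qed.

End SimMore.

Section LayerLocal.
Variables (l K : nat) (V V' : finType) (h : rel V) (pn : V -> V -> nat) (h' : rel V') (pn' : V' -> V' -> nat).
Variables (c : V -> nat) (c' : V' -> nat) (k : nat) (f : V -> V') (g : V' -> V) (v : V) (v' : V').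
Hypothesis hs : simf h pn c h' pn' c' k f g v v'.

Lemma sim_deep a x (p : pred V) (p' : pred V') : within h a v x -> a + l.+1 <= k ->
  (forall y, within h (a + l.+1) v y -> p' (f y) = p y) -> deep h' l p' (f x) = deep h l p x.
Proof.
move=> hx hk hp; have hsx := sim_restrict hs hx hk.
have hp' y : within h l.+1 x y -> p' (f y) = p y by move=> hy; apply: hp; apply: within_add hx hy.
have hsi := sim_induced hsx hp'.
apply: (sim_all hsi (b := l)) => // y hy.
have hy' : within h l x y by apply: within_sub hy; apply: induced_sub.
rewrite (sim_deg_pred (sim_restrict hsx hy' (b := 1) _) (p := p)) ?addn1 // => z hz.
by apply: hp'; rewrite -addn1; apply: within_add hy' hz.
Qed.

Lemma sim_F i a x : within h a v x -> a + i * l.+1 <= k -> alive h' l K c' i (f x) = alive h l K c i x.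
Proof.
elim: i a x => [|i IH] a x hx hk //; rewrite mulSn in hk.
have hF y : within h (a + l.+1) v y -> alive h' l K c' i (f y) = alive h l K c i y.
  by move=> hy; apply: (IH (a + l.+1)) => //; lia.
have hF1 y : within h 1 x y -> alive h' l K c' i (f y) = alive h l K c i y.
  by move=> hy; apply: hF; apply: (withinW _ (within_add hx hy)); lia.
have hsx : simf h pn c h' pn' c' 1 f g x (f x) by apply: (sim_restrict hs hx); lia.
rewrite [LHS]/= [RHS]/= (IH a) //; last by lia.
rewrite (sim_deg_pred hsx (p := alive h l K c i)) // (@sim_deep a x (alive h l K c i)) //; last by lia.
by rewrite (sim_lab hs) //; apply: (withinW _ hx); lia.
Qed.

Lemma sim_cutv N a x : within h a v x -> a + N.+1 * l.+1 <= k -> cutv h' l K c' N (f x) = cutv h l K c N x.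
Proof.
move=> hx hk; apply: eq_existsb => i.
have hi : i * l.+1 + l.+1 <= N.+1 * l.+1 by rewrite addnC -mulSn leq_mul2r; apply/orP; right; have := ltn_ord i; lia.
rewrite (sim_F hx); last by lia.
rewrite (@sim_deep a x (alive h l K c i)) //; [|by lia|].
  by rewrite (sim_lab hs) //; apply: (withinW _ hx); lia.
by move=> y hy; apply: (sim_F hy); lia.
Qed.

Lemma sim_lay N a x : within h a v x -> a + N.+1 * l.+1 <= k -> layer h' l K c' N (f x) = layer h l K c N x.
Proof.
move=> hx hk; apply: eq_bigr => i _; congr nat_of_bool; apply: (sim_F hx).
apply: leq_trans hk; rewrite leq_add2l leq_mul2r; apply/orP; right; have := ltn_ord i; lia.
Qed.
End LayerLocal.

Section FinLocal.
Variables (Si So : Type) (Pi : LCL Si So) (A : algo Si So) (n0 : nat).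
Notation W := ((a_bits A n0).-tuple bool).
Notation inf := (nat * (nat -> option Si))%type.
Notation R := (bad_rad Pi A n0).
Variables (D K N n2 : nat).

Section Chk.
Variables (V V' : finType) (h : rel V) (pn : V -> V -> nat) (h' : rel V') (pn' : V' -> V' -> nat).
Variables (I : V -> inf) (I' : V' -> inf) (r : V -> option W) (r' : V' -> option W).
Variables (f : V -> V') (g : V' -> V) (v : V) (v' : V') (n : nat).

Lemma unlikely_sim : symmetric h -> symmetric h' -> pinj h pn -> pinj h' pn' ->
  simf h pn (fun x => (I x, r x)) h' pn' (fun x => (I' x, r' x)) R f g v v' ->
  unlikely (Bad Pi h' pn' I') n r' v' = unlikely (Bad Pi h pn I) n r v.
Proof.
move=> h1 h2 h3 h4 hs.
have := @cnt_transfer V V' W f g (within h R v) (within h' R v') 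
  (fun w => Bad Pi h pn I v (fill r w)) (fun w => Bad Pi h' pn' I' v' (fill r' w)) (sim_fwd hs) (sim_bwd hs).
have hE (w : {ffun V -> W}) (w' : {ffun V' -> W}) : (forall x, within h R v x -> w x = w' (f x)) ->
   Bad Pi h pn I v (fill r w) = Bad Pi h' pn' I' v' (fill r' w').
  move=> hw; apply: (bad_sim (f := f) (g := g)) => //.
  apply: (sim_relabel hs) => // x hx; have [-> hr] := sim_lab hs hx; congr pair.
  by rewrite !ffunE hr hw.
move=> /(_ hE) ht.
have hq : 0 < #|{ffun V -> W}| by apply/card_gt0P; exists [ffun=> w0 A n0].
have hq' : 0 < #|{ffun V' -> W}| by apply/card_gt0P; exists [ffun=> w0 A n0].
by rewrite /unlikely /cnt (leq_ratio _ hq hq' ht).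
Qed.
End Chk.

Variables (V V' : finType) (h : rel V) (pn : V -> V -> nat) (h' : rel V') (pn' : V' -> V' -> nat).
Hypotheses (hh : symmetric h) (hh' : symmetric h') (hp : pinj h pn) (hp' : pinj h' pn').
Variables (I : V -> inf) (I' : V' -> inf) (chi : V -> 'I_K) (chi' : V' -> 'I_K).
Variables (rho : V -> option W) (rho' : V' -> option W).
Variables (f : V -> V') (g : V' -> V).

Notation sim3 := (simf h pn (fun x => (I x, chi x, rho x))
  h' pn' (fun x => (I' x, chi' x, rho' x))).
Notation sim4 := (simf h pn (fun x => (I x, chi x, rho x, cutset Pi A n0 N h chi x))
  h' pn' (fun x => (I' x, chi' x, rho' x, cutset Pi A n0 N h' chi' x))).

Lemma sim_goodcut (s : V) (s' : V') gm :
  sim3 (3 * R) f g s s' ->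
  goodcut Pi n2 h' pn' I' chi' rho' s' gm = goodcut Pi n2 h pn I chi rho s gm.
Proof.
move=> hs.
have hR : 0 < R by rewrite /bad_rad addn1.
have e1 (T : finType) (hT : rel T) pT IT chT rT sT : goodcut Pi n2 hT pT IT chT rT sT gm =
  [forall u, within hT R sT u ==> ((rT u == None) ==> [forall v, within hT R u v ==>
      unlikely (Bad Pi hT pT IT) n2 (cutext Pi hT chT rT sT gm) v])].
  apply: eq_forallb => u; apply/forallP/implyP => [H h1|H v].
    by apply/implyP => h2; apply/forallP => v; apply/implyP => h3; move: (H v); rewrite h1 h2 h3.
  by apply/implyP => /and3P[h1 h2 h3]; move: (H h2); rewrite h1 /= => /forallP /(_ v); rewrite h3.
rewrite !e1; apply: (sim_all hs); first by lia.
move=> u hu; have hu3 : within h (3 * R) s u by apply: (withinW _ hu); lia.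
have [_ hr] : (I' (f u), chi' (f u)) = (I u, chi u) /\ rho' (f u) = rho u.
  by have [-> -> ->] := sim_lab hs hu3.
rewrite hr; congr implb.
have hsu : sim3 (2 * R) f g u (f u).
  by apply: (sim_restrict hs hu); lia.
apply: (sim_all hsu); first by lia.
move=> v hv; have hsv : sim3 R f g v (f v).
  by apply: (sim_restrict hsu hv); lia.
apply: unlikely_sim => //; apply: (sim_relabel hsv) => // x hx.
have hsx : within h (3 * R) s x.
  by apply: (withinW _ (within_add (within_add hu hv) hx)); lia.
have [h1 h2 h3] := sim_lab hs hsx; rewrite h1; congr pair; rewrite /cutext h2 h3.
case: (rho x) => //; have -> // : within h' R s' (f x) = within h R s x.
have hsR : sim3 (3 * R) f g s s' by [].
apply/idP/idP => h4.
  have := sim_dist (sim_inv hs) (a := 0) (b := R) _ (within_refl _ _ _) h4.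
  by rewrite (sim_back hs); case: (sim_fwd hs hsx) => _ ->; apply; lia.
by rewrite -(sim_ctr hs); apply: (sim_dist hs (a := 0)) h4; [lia|apply: within_refl].
Qed.

Lemma sim_with_cuts (v : V) (v' : V') :
  sim4 (4 * R) f g v v' ->
  with_cuts Pi N n2 h' pn' I' chi' rho' v' = with_cuts Pi N n2 h pn I chi rho v.
Proof.
move=> hs; have [h1 h2 h3 h4] := sim_lab hs (within_refl h (4 * R) v).
rewrite -{1}(sim_ctr hs) /with_cuts h3; case: (rho v) => // {h1 h4}.
apply: eq_pick => a /=.
have e1 (T : finType) (hT : rel T) P1 P2 x : symmetric hT ->
   [exists s, [&& P1 s, within hT R s x & P2 s]] = [exists s : T, within hT R x s && (P1 s && P2 s)].
  by move=> hT0; apply: eq_existsb => s; rewrite (within_sym hT0); case: (P1 s); case: (within _ _ _ _).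
rewrite !e1 // (sim_ctr hs); apply: (sim_ex hs); first by lia.
move=> s hsv; have hs4 : within h (4 * R) v s by apply: (withinW _ hsv); lia.
have [_ _ _ ->] := sim_lab hs hs4; congr andb.
rewrite (_ : cutchoice _ _ _ _ _ _ _ (f s) = cutchoice Pi n2 h pn I chi rho s).
  by rewrite -(sim_ctr hs) h2.
apply: eq_pick => gm /=; apply: sim_goodcut.
have hs3 : sim4 (3 * R) f g s (f s).
  by apply: (sim_restrict hs hsv); lia.
by apply: (sim_relabel hs3) => // x hx; have [-> -> ->] := sim_lab hs3 hx.
Qed.

Section Fin2.
Variables (ct : pred V) (ct' : pred V') (ky : V -> nat) (ky' : V' -> nat).
Variables (r2 : V -> option W) (r2' : V' -> option W).
Notation lb := (fun x => (I x, ct x, ky x, r2 x)).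
Notation lb' := (fun x => (I' x, ct' x, ky' x, r2' x)).
Notation simL := (simf h pn lb h' pn' lb').

Lemma sim_piece k x x' : simL k f g x x' ->
  simf (piece h ct) pn lb (piece h' ct') pn' lb' k f g x x'.
Proof. by move=> hs; apply: (sim_induced hs) => y hy; have [_ -> _ _] := sim_lab hs hy. Qed.

Lemma piece_sub j x y : within (piece h ct) j x y -> within h j x y.
Proof. by apply: within_sub; apply: induced_sub. Qed.

Lemma sim_isleader l l' : simL (2 * N) f g l l' ->
  isleader N h' ct' ky' l' = isleader N h ct ky l.
Proof.
move=> hs; apply: (sim_all (sim_piece hs)) => // z hz.
have [_ _ -> _] := sim_lab hs (piece_sub hz).
by rewrite -(sim_ctr hs); have [_ _ -> _] := sim_lab hs (within_refl h _ l).
Qed.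

Lemma sim_addr k l l' x : simL k f g l l' -> N <= k -> within h k l x ->
  addr N h' pn' l' (f x) = addr N h pn l x.
Proof.
move=> hs hk hx; apply: functional_extensionality => ps; apply: propositional_extensionality.
rewrite /addr -(sim_ctr hs).
split=> -[h1 h2]; split => //.
  have hps : 0 + size ps <= k by lia.
  case: (sim_wlk hs hp hp' (within_refl h 0 l) hps) => h3 h4.
  move: h2; rewrite h3; case hw: (wlk h pn l ps) => [z|] //= -[h5]; congr Some.
  have hz : within h k l z by apply: withinW (h4 _ hw).
  by case: (sim_fwd hs hz) (sim_fwd hs hx) => _ <- [_ <-]; rewrite h5.
have hps : 0 + size ps <= k by lia.
by case: (sim_wlk hs hp hp' (within_refl h 0 l) hps) => -> _; rewrite h2.
Qed.

Lemma sim_completes (l : V) (l' : V') gm :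
  simL (2 * N + 2 * R) f g l l' ->
  completes Pi N h' pn' I' ct' r2' l' gm -> completes Pi N h pn I ct r2 l gm.
Proof.
move=> hs hG u v hu hlu huv.
have hlu' := piece_sub hlu.
have hu2 : within h (2 * N + 2 * R) l u by apply: (withinW _ hlu'); lia.
have hlv := within_add hlu' huv.
have hp1 : within (piece h' ct') N l' (f u).
  by rewrite -(sim_ctr hs); apply: (sim_dist (sim_piece hs) (a := 0)) hlu; [lia|apply: within_refl].
have hp2 : within h' R (f u) (f v) by apply: (sim_dist hs _ hlu' huv); lia.
have hr : r2' (f u) = None by have [_ _ _ ->] := sim_lab hs hu2.
have hsv : simL R f g v (f v) by apply: (sim_restrict hs hlv); lia.
have := hG _ _ hr hp1 hp2; congr (is_true (~~ _)).
apply/esym; apply: (bad_sim (f := f) (g := g)) => //; apply: (sim_relabel hsv) => // x hx.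
have [-> _ _ ->] := sim_lab hsv hx; congr pair; case: (r2 x) => //.
by rewrite (sim_addr hs) //; [lia|apply: (withinW _ (within_add hlv hx)); lia].
Qed.

End Fin2.
End FinLocal.

Section FinLocal2.
Variables (Si So : Type) (Pi : LCL Si So) (A : algo Si So) (n0 : nat).
Notation W := ((a_bits A n0).-tuple bool).
Notation inf := (nat * (nat -> option Si))%type.
Notation R := (bad_rad Pi A n0).
Variables (K N n2 : nat).
Variables (V V' : finType) (h : rel V) (pn : V -> V -> nat) (h' : rel V') (pn' : V' -> V' -> nat).
Hypotheses (hh : symmetric h) (hh' : symmetric h') (hp : pinj h pn) (hp' : pinj h' pn').
Variables (I : V -> inf) (I' : V' -> inf) (f : V -> V') (g : V' -> V).

Section Piece.
Variables (ct : pred V) (ct' : pred V') (ky : V -> nat) (ky' : V' -> nat).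
Variables (r2 : V -> option W) (r2' : V' -> option W).
Notation simL := (simf h pn (fun x => (I x, ct x, ky x, r2 x))
  h' pn' (fun x => (I' x, ct' x, ky' x, r2' x))).

(** Candidates are functions of addresses, so their type does not mention the vertex set; the two
    predicates are equal as predicates, and [epsilon] picks the same candidate on both sides. *)
Lemma sim_chosen l l' :
  simL (2 * N + 2 * R) f g l l' ->
  chosen Pi N h' pn' I' ct' r2' l' = chosen Pi N h pn I ct r2 l.
Proof.
move=> hs; congr epsilon; apply: functional_extensionality => gm.
apply: propositional_extensionality; split.
  exact: (sim_completes hh hh' hp hp' hs).
exact: (sim_completes hh' hh hp' hp (sim_inv hs)).
Qed.

Lemma sim_finish_piece v v' :
  simL (3 * N + 2 * R) f g v v' ->
  finish_piece Pi N h' pn' I' ct' ky' r2' v' = finish_piece Pi N h pn I ct ky r2 v.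
Proof.
move=> hs; rewrite /finish_piece.
have [_ _ _ h1] := sim_lab hs (within_refl h (3 * N + 2 * R) v).
rewrite -{1}(sim_ctr hs) h1; case: (r2 v) => //; congr odflt.
apply: eq_pick => a /=.
apply: (sim_ex (sim_piece hs)); first by lia.
move=> l hl; have hl' := piece_sub hl.
have hsl : simL (2 * N + 2 * R) f g l (f l) by apply: (sim_restrict hs hl'); lia.
have hsl2 : simL (2 * N) f g l (f l) by apply: (sim_restrict hs hl'); lia.
rewrite (sim_isleader hsl2) (sim_chosen hsl) -(sim_ctr hs) (sim_addr hp hp' hsl) //; first by lia.
by rewrite (within_sym hh); apply: (withinW _ hl'); lia.
Qed.

End Piece.

(** Three reaches add up: every layer looks [4 * R + 1] further, values near a cut vertex need
    [4 * R], and a vertex looks [N] far to its leader, from which the piece and its events extend by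
    at most [2 * N + 2 * R]. *)
Definition finish_rad : nat := N.+1 * (4 * R).+1 + 4 * R + (3 * N + 2 * R).

Lemma sim_finish (chi : V -> 'I_K) (chi' : V' -> 'I_K) (rho : V -> option W) (rho' : V' -> option W) v v' :
  simf h pn (fun x => (I x, chi x, rho x)) h' pn' (fun x => (I' x, chi' x, rho' x)) finish_rad f g v v' ->
  finish Pi N n2 h' pn' I' chi' rho' v' = finish Pi N n2 h pn I chi rho v.
Proof.
move=> hs; pose k1 := 4 * R + (3 * N + 2 * R).
have hc : simf h pn (fun x => chi x : nat) h' pn' (fun x => chi' x : nat) finish_rad f g v v'.
  by apply: (sim_relabel hs) => // x hx; have [_ -> _] := sim_lab hs hx.
have h1 x : within h k1 v x ->
  [/\ cutset Pi A n0 N h' chi' (f x) = cutset Pi A n0 N h chi x,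
      lvl Pi A n0 N h' chi' (f x) = lvl Pi A n0 N h chi x,
      I' (f x) = I x, chi' (f x) = chi x & rho' (f x) = rho x].
  move=> hx; have hk : k1 + N.+1 * (4 * R).+1 <= finish_rad by rewrite /finish_rad /k1; lia.
  have hx' : within h finish_rad v x by apply: (withinW _ hx); rewrite /finish_rad /k1; lia.
  split; [by rewrite /cutset; exact: (sim_cutv K hc hx hk)|by rewrite /lvl; exact: (sim_lay K hc hx hk)|..];
  by case: (sim_lab hs hx').
have hk1 : k1 <= finish_rad by rewrite /finish_rad /k1; lia.
have hs1 : simf h pn (fun x => (I x, chi x, rho x, cutset Pi A n0 N h chi x)) h' pn'
   (fun x => (I' x, chi' x, rho' x, cutset Pi A n0 N h' chi' x)) k1 f g v v'.
  by apply: (sim_relabel hs hk1) => x hx; case: (h1 x hx) => -> _ -> -> ->.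
apply: sim_finish_piece.
have hk2 : 3 * N + 2 * R <= k1 by rewrite /k1; lia.
apply: (sim_relabel hs1 hk2) => x hx.
have hx1 := withinW hk2 hx.
case: (h1 x hx1) => -> -> -> -> _; congr pair.
apply: sim_with_cuts => //; apply: (sim_restrict hs1 hx); rewrite /k1; lia.
Qed.
End FinLocal2.

(** * Colour reduction *)

Section Reduce.
Variables (b Dl rho : nat).

Definition bitn (m i : nat) : bool := nth false (bitsw b m) i.

Definition fdiff (m m' : nat) : nat := find (fun i => bitn m i != bitn m' i) (iota 0 b).

Lemma fdiffP m m' : m < 2 ^ b -> m' < 2 ^ b -> m != m' ->
  fdiff m m' < b /\ bitn m (fdiff m m') != bitn m' (fdiff m m').
Proof.
move=> h1 h2 h3; have hh : has (fun i => bitn m i != bitn m' i) (iota 0 b).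
  apply: contraT => /hasPn h; case/eqP: h3; apply: (bitsw_inj h1 h2).
  apply: (@eq_from_nth _ false); rewrite !size_bitsw // => i hi.
  by apply/eqP; have := h i; rewrite mem_iota hi negbK; apply.
have hlt : fdiff m m' < b by rewrite -[b in X in _ < X](size_iota 0 b) -has_find.
by split => //; have := nth_find 0 hh; rewrite nth_iota.
Qed.

Section OneGraph.
Variables (V : finType) (e : rel V) (col : V -> nat).

(* The positions where u first differs from its neighbours, with the bit of u there; two adjacent
   vertices disagree at such a position, so their sets differ. *)
Definition dset (u : V) : {set 'I_(2 * b)} :=
  [set s : 'I_(2 * b) | [exists v, [&& within e rho u v, col v != col u &
     val s == 2 * fdiff (col u) (col v) + bitn (col u) (fdiff (col u) (col v))]]].

(** A set of at most [Dl] elements is stored as a [Dl]-tuple, so the number of new colours is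
    polynomial in [b] instead of exponential. *)
Definition setcode (s : {set 'I_(2 * b)}) : {ffun 'I_Dl -> option 'I_(2 * b)} :=
  [ffun i : 'I_Dl => nth None (map Some (enum s)) i].

Definition newcol (u : V) : nat := enum_rank (setcode (dset u)).

Lemma setcode_inj (s s' : {set 'I_(2 * b)}) : #|s| <= Dl -> #|s'| <= Dl -> setcode s = setcode s' -> s = s'.
Proof.
have main (t t' : {set 'I_(2 * b)}) : #|t| <= Dl -> setcode t = setcode t' -> t \subset t'.
  move=> ht h; apply/subsetP => x; rewrite -mem_enum => hx.
  have hi : index x (enum t) < Dl by apply: leq_trans ht; rewrite cardE index_mem.
  move/ffunP: h => /(_ (Ordinal hi)); rewrite !ffunE /=.
  rewrite (nth_map x) ?index_mem // nth_index // => h.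
  case: (ltnP (index x (enum t)) (size (enum t'))) => h1.
    by move: h; rewrite (nth_map x) // => -[->]; rewrite -mem_enum mem_nth.
  by move: h; rewrite nth_default // size_map.
by move=> h1 h2 h; apply/eqP; rewrite eqEsubset !main.
Qed.

Lemma newcol_lt u : newcol u < (2 * b).+1 ^ Dl.
Proof.
apply: leq_trans (ltn_ord _) _.
by rewrite card_ffun card_option !card_ord.
Qed.

Variable D : nat.
Hypothesis hD : max_deg_le e D.
Hypothesis hDl : D.+2 ^ rho <= Dl.
Hypothesis hsym : symmetric e.
Hypothesis hcol : forall v, col v < 2 ^ b.

Lemma dset_card u : #|dset u| <= Dl.
Proof.
apply: leq_trans hDl; apply: leq_trans (ball_card hD rho u).
pose A (v : V) := [set s : 'I_(2 * b) | val s == 2 * fdiff (col u) (col v) + bitn (col u) (fdiff (col u) (col v))].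
apply: (@leq_trans #|\bigcup_(v in [set v | within e rho u v]) A v|).
  apply: subset_leq_card; apply/subsetP => s; rewrite inE => /existsP[v /and3P[h1 h2 h3]].
  by apply/bigcupP; exists v; rewrite inE.
rewrite -[#|[set _ | _]|]muln1; apply: card_bigcup_le => v _; rewrite leqNgt.
apply/negP => /card_gt1P[x [y [hx hy]]]; rewrite !inE in hx hy.
by case/eqP; apply: val_inj; rewrite (eqP hx) (eqP hy).
Qed.

Lemma newcol_proper u v : within e rho u v -> col u != col v -> newcol u != newcol v.
Proof.
move=> huv hne; apply/eqP => h.
have hs : dset u = dset v.
  by apply: setcode_inj; rewrite ?dset_card //; apply: enum_rank_inj; apply: val_inj.
have [h1 h2] := fdiffP (hcol u) (hcol v) hne.
have hlt : 2 * fdiff (col u) (col v) + bitn (col u) (fdiff (col u) (col v)) < 2 * b.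
  by case: (bitn _ _); lia.
have : Ordinal hlt \in dset u.
  by rewrite inE; apply/existsP; exists v; rewrite huv eq_sym hne /=.
rewrite hs inE => /existsP[w /and3P[_ _ /eqP /= h3]].
have h4 : fdiff (col u) (col v) = fdiff (col v) (col w).
  by move: h3; case: (bitn _ _); case: (bitn _ _); lia.
by case/eqP: h2; move: h3; rewrite -h4; case: (bitn _ _); case: (bitn _ _) => //; lia.
Qed.
End OneGraph.

Lemma newcol_local (D : nat) : local_fun D rho (fun V e pn (col : V -> nat) v => newcol e col v).
Proof.
move=> V V' e pn col e' pn' col' f g v v' _ _ hs; rewrite /newcol; congr (nat_of_ord (enum_rank (setcode _))).
apply/setP => s; rewrite !inE.
have hv : col' v' = col v by rewrite -(sim_ctr hs) (sim_lab hs) // within_refl.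
apply/existsP/existsP => [[x /and3P[h1 h2 h3]]|[x /and3P[h1 h2 h3]]].
  exists (f x); case: (sim_fwd hs h1) => h4 _.
  by rewrite h4 (sim_lab hs h1) hv h2 h3.
exists (g x); case: (sim_bwd hs h1) => h4 h5.
by rewrite h4 /= -(sim_lab hs h4) h5 -hv h2 h3.
Qed.
End Reduce.

Section Bits.
Variable Dl : nat.

Definition nbits (b : nat) : nat := Dl * (trunc_log 2 (2 * b).+1).+1.

Lemma newcol_bits b rho (V : finType) (e : rel V) col u : newcol b Dl rho e col u < 2 ^ nbits b.
Proof.
apply: leq_trans (newcol_lt _ _ _ _ _ _) _.
rewrite /nbits [Dl * _]mulnC expnM; case: (Dl) => [|d]; first by rewrite !expn0.
by rewrite leq_exp2r //; apply: ltnW; apply: trunc_log_ltn.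
Qed.

Lemma nbits_mono b b' : b <= b' -> nbits b <= nbits b'.
Proof.
move=> h; rewrite /nbits leq_mul2l; apply/orP; right; rewrite ltnS; apply: leq_trunc_log; lia.
Qed.

(** The length of the colours really shrinks logarithmically. Halving is enough here, since it
    brings O(log n) bits down to a constant in O(log log n) steps. *)
Lemma nbits_fix : exists bs, forall b k, iter k nbits b <= maxn bs (b %/ 2 ^ k).
Proof.
(* Chosen so that a step halves every length from [bs] on. For [m <= 16 * Dl + 4] this is the
   definition of [bs]; for larger [m] it follows from [(m + 1)^2 <= 4 * 2^m]. *)
pose bs := 2 * Dl * (16 * Dl + 5).
have hbig b : bs <= b -> 2 * nbits b <= b.
  move=> hb; rewrite /nbits; set m := trunc_log 2 _.
  have hm : 2 ^ m <= (2 * b).+1 by apply: trunc_logP.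
  case: (leqP m (16 * Dl + 4)) => h; first by apply: leq_trans hb; rewrite /bs; nia.
  have h1 : (m.+1) * (m.+1) <= 4 * 2 ^ m.
    have h2 k : k < 2 ^ k by apply: ltn_expl.
    have h3 := h2 m./2; have h4 := h2 (m - m./2).
    have -> : 2 ^ m = 2 ^ m./2 * 2 ^ (m - m./2) by rewrite -expnD; congr (2 ^ _); have := odd_double_half m; lia.
    have h5 : m.+1 <= 2 * 2 ^ m./2 by have := odd_double_half m; lia.
    have h6 : m.+1 <= 2 * 2 ^ (m - m./2) by have := odd_double_half m; lia.
    apply: leq_trans (leq_mul h5 h6) _; by rewrite mulnACA.
  have h7 : (16 * Dl + 4) * m.+1 <= m.+1 * m.+1 by rewrite leq_mul2r; lia.
  move: hm h1 h7; move: (2 ^ m) => P; nia.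
have hsmall b : b <= bs -> nbits b <= bs.
  by move=> h; apply: leq_trans (nbits_mono h) _; have := hbig bs (leqnn _); lia.
exists bs => b k.
elim: k => [|k IH] /=; first by rewrite expn0 divn1 leq_maxr.
case: (leqP (iter k nbits b) bs) => h; first by apply: leq_trans (hsmall _ h) _; rewrite leq_maxl.
have h1 := hbig _ (ltnW h); rewrite leq_max; apply/orP; right.
have h2 : iter k nbits b <= b %/ 2 ^ k by move: IH; rewrite leq_max leqNgt h.
rewrite expnSr divnMA leq_divRL //; lia.
Qed.
End Bits.

(** * The algorithm *)

Section PrunLocal.
Variables (Si So : Type) (Pi : LCL Si So) (A : algo Si So) (n0 n1 : nat).
Notation W := ((a_bits A n0).-tuple bool).
Notation inf := (nat * (nat -> option Si))%type.
Notation R := (bad_rad Pi A n0).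
Variables (V V' : finType) (h : rel V) (pn : V -> V -> nat) (h' : rel V') (pn' : V' -> V' -> nat).
Hypotheses (hh : symmetric h) (hh' : symmetric h') (hp : pinj h pn) (hp' : pinj h' pn').
Variables (I : V -> inf) (I' : V' -> inf) (c : V -> nat) (c' : V' -> nat) (w : V -> W) (w' : V' -> W).
Variables (f : V -> V') (g : V' -> V).

Notation simS s s' := (simf h pn (fun x => (I x, c x, w x, s.1 x, s.2 x))
  h' pn' (fun x => (I' x, c' x, w' x, s'.1 x, s'.2 x))).

Lemma sim_trips j (s : pstate V W) (s' : pstate V' W) u u' :
  simS s s' (2 * R) f g u u' ->
  tries c' j s' u' = tries c j s u /\
  trips h' R n1 (Bad Pi h' pn' I') c' w' j s' u' = trips h R n1 (Bad Pi h pn I) c w j s u.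
Proof.
move=> hs; have [_ h2 h3 _ h5] := sim_lab hs (within_refl h (2 * R) u).
rewrite (sim_ctr hs) in h2 h3 h5.
have ht : tries c' j s' u' = tries c j s u by rewrite /tries h2 h5.
split => //; rewrite /trips ht; congr andb.
apply: (sim_ex hs); first by lia.
move=> v hv; congr (~~ _).
have hsv : simS s s' R f g v (f v) by apply: (sim_restrict hs hv); lia.
apply: unlikely_sim => //; apply: (sim_relabel hsv) => // x hx.
have [-> _ _ h4 _] := sim_lab hsv hx; congr pair; rewrite /upd h3 h4.
have hx2 : within h (2 * R) u x by apply: (withinW _ (within_add hv hx)); lia.
have -> // : (f x == u') = (x == u).
apply/eqP/eqP => [h6|->]; last exact: sim_ctr hs.
by case: (sim_fwd hs hx2) => _ <-; rewrite h6 (sim_back hs).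
Qed.

(** A step reads radius [4 * R]: freezing comes from a trip within [2 * R], and deciding a trip
    reads another [2 * R]. *)
Lemma sim_prun k v v' :
  simf h pn (fun x => (I x, c x, w x)) h' pn' (fun x => (I' x, c' x, w' x)) k f g v v' ->
  forall j a x, within h a v x -> a + j * (4 * R) <= k ->
  (prun h' R n1 (Bad Pi h' pn' I') c' w' j).1 (f x) = (prun h R n1 (Bad Pi h pn I) c w j).1 x /\
  (prun h' R n1 (Bad Pi h' pn' I') c' w' j).2 (f x) = (prun h R n1 (Bad Pi h pn I) c w j).2 x.
Proof.
move=> hs; elim=> [|j IH] a x hx hk //; rewrite mulSn in hk.
set s := prun h R n1 (Bad Pi h pn I) c w j; set s' := prun h' R n1 (Bad Pi h' pn' I') c' w' j.
have hsx : simS s s' (4 * R) f g x (f x).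
  have hsx0 : simf h pn (fun x => (I x, c x, w x)) h' pn' (fun x => (I' x, c' x, w' x)) (4 * R) f g x (f x).
    by apply: (sim_restrict hs hx); lia.
  apply: (sim_relabel hsx0) => // y hy; have [-> -> ->] := sim_lab hsx0 hy.
  have hk' : a + 4 * R + j * (4 * R) <= k by lia.
  by case: (IH _ y (within_add hx hy) hk') => -> ->.
have hsx2 : simS s s' (2 * R) f g x (f x) by apply: (sim_weaken hsx); lia.
have [_ _ h3 h4 h5] := sim_lab hsx (within_refl h (4 * R) x).
case: (sim_trips j hsx2) => h6 h7; split; rewrite [LHS]/= [RHS]/= -/s -/s'.
  by rewrite h6 h7 h3 h4.
rewrite h5; congr orb.
have e1 (T : finType) (hT : rel T) P2 y : symmetric hT ->
   [exists u, within hT (2 * R) u y && P2 u] = [exists u : T, within hT (2 * R) y u && P2 u].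
  by move=> hT0; apply: eq_existsb => u; rewrite (within_sym hT0).
rewrite !e1 //; apply: (sim_ex hsx); first by lia.
move=> u hu; have hsu : simS s s' (2 * R) f g u (f u) by apply: (sim_restrict hsx hu); lia.
by case: (sim_trips j hsu).
Qed.
End PrunLocal.

Section Phases.
Variables (Si So : finType) (D : nat) (Pi : LCL Si So) (A : algo Si So) (n0 n1 n2 K' : nat).
Notation W := ((a_bits A n0).-tuple bool).
Notation inf := (nat * (nat -> option Si))%type.
Notation R := (bad_rad Pi A n0).
Notation K := K'.+1.
Notation Dl := (D.+2 ^ (4 * R)).

(* degree and inputs, random string (later its final value), colour, value fixed so far, active flag, output *)
Definition xlabel : finType := ('I_D.+1 * {ffun 'I_D -> option Si} * W * 'I_K * option W * bool * {ffun 'I_D -> So})%type.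
Notation Lb := (xlabel * nat)%type.

Definition mk_xlabel (dg : 'I_D.+1) (ip : {ffun 'I_D -> option Si}) (w : W) (ch : 'I_K) (ro : option W)
  (ac : bool) (ou : {ffun 'I_D -> So}) : xlabel := (dg, ip, w, ch, ro, ac, ou).
Definition xdg (x : xlabel) : 'I_D.+1 := x.1.1.1.1.1.1.
Definition xip (x : xlabel) : {ffun 'I_D -> option Si} := x.1.1.1.1.1.2.
Definition xW (x : xlabel) : W := x.1.1.1.1.2.
Definition xchi (x : xlabel) : 'I_K := x.1.1.1.2.
Definition xrho (x : xlabel) : option W := x.1.1.2.
Definition xact (x : xlabel) : bool := x.1.2.
Definition xo (x : xlabel) : {ffun 'I_D -> So} := x.2.
Definition xI (x : xlabel) : inf :=
  (nat_of_ord (xdg x), fun p => if insub p is Some i then xip x i else None).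

Section PhaseDef.
Variables (V : finType) (e : rel V) (pn : V -> V -> nat) (lab : V -> Lb).
Notation lI := (fun x => xI (lab x).1).
Notation lW := (fun x => xW (lab x).1).

Definition color_phase (b : nat) (v : V) : Lb :=
  ((lab v).1, newcol b Dl (4 * R) e (fun x => (lab x).2) v).

Definition shatter_state : V -> option W :=
  (prun e R n1 (Bad Pi e pn lI) (fun x => (inord (lab x).2 : 'I_K) : nat) lW K).1.

Definition shatter_phase (v : V) : Lb :=
  let x := (lab v).1 in
  (mk_xlabel (xdg x) (xip x) (xW x) (inord (lab v).2) (shatter_state v)
     [exists y, within e (2 * R) v y && (shatter_state y == None)] (xo x), 0).

Definition gather_phase (N : nat) (v : V) : Lb :=
  let x := (lab v).1 in
  (mk_xlabel (xdg x) (xip x) (finish Pi N n2 e pn lI (fun x => xchi (lab x).1) (fun x => xrho (lab x).1) v)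
     (xchi x) (xrho x) (xact x) (xo x), 0).

Definition run_phase (v : V) : Lb :=
  let x := (lab v).1 in
  (mk_xlabel (xdg x) (xip x) (xW x) (xchi x) (xrho x) (xact x)
     [ffun p : 'I_D => xout e pn lI lW v p], 0).
End PhaseDef.

Lemma color_phase_local b : local_fun D (4 * R) (fun V e pn lab => @color_phase V e lab b).
Proof.
move=> V V' e pn lab e' pn' lab' f g v v' ho ho' hs; rewrite /color_phase.
have h1 : lab' v' = lab v by rewrite -(sim_ctr hs) (sim_lab hs) // within_refl.
have hs2 : simf e pn (fun x => (lab x).2) e' pn' (fun x => (lab' x).2) (4 * R) f g v v'.
  by apply: (sim_relabel hs) => // x hx; rewrite (sim_lab hs hx).
by rewrite h1 (newcol_local b Dl ho ho' hs2).
Qed.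

Definition shatter_rad : nat := K * (4 * R) + 2 * R.

Lemma shatter_phase_local : local_fun D shatter_rad shatter_phase.
Proof.
move=> V V' e pn lab e' pn' lab' f g v v' [hf hp _] [hf' hp' _] hs; rewrite /shatter_phase.
have h1 : lab' v' = lab v by rewrite -(sim_ctr hs) (sim_lab hs) // within_refl.
have hs2 : simf e pn (fun x => (xI (lab x).1, (inord (lab x).2 : 'I_K) : nat, xW (lab x).1))
   e' pn' (fun x => (xI (lab' x).1, (inord (lab' x).2 : 'I_K) : nat, xW (lab' x).1)) shatter_rad f g v v'.
  by apply: (sim_relabel hs) => // x hx; rewrite (sim_lab hs hx).
have h2 x : within e (2 * R) v x -> shatter_state e' pn' lab' (f x) = shatter_state e pn lab x.
  move=> hx; have hk : 2 * R + K * (4 * R) <= shatter_rad by rewrite /shatter_rad addnC.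
  by case: (sim_prun n1 (forest_sym hf) (forest_sym hf') hp hp' hs2 hx hk).
rewrite h1; have -> : shatter_state e pn lab v = shatter_state e' pn' lab' v'.
  by rewrite -(sim_ctr hs) h2 // within_refl.
congr (mk_xlabel _ _ _ _ _ _ _, 0); apply/esym; apply: (sim_ex hs).
  by rewrite /shatter_rad leq_addl.
by move=> x hx; rewrite h2.
Qed.

Lemma gather_phase_local N : local_fun D (finish_rad Pi A n0 N) (fun V e pn lab => @gather_phase V e pn lab N).
Proof.
move=> V V' e pn lab e' pn' lab' f g v v' [hf hp _] [hf' hp' _] hs; rewrite /gather_phase.
have h1 : lab' v' = lab v by rewrite -(sim_ctr hs) (sim_lab hs) // within_refl.
rewrite h1; congr (mk_xlabel _ _ _ _ _ _ _, 0); apply/esym.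
apply: (sim_finish n2 (forest_sym hf) (forest_sym hf') hp hp' (f := f) (g := g)).
by apply: (sim_relabel hs) => // x hx; rewrite (sim_lab hs hx).
Qed.

Lemma run_phase_local : local_fun D R run_phase.
Proof.
move=> V V' e pn lab e' pn' lab' f g v v' [hf hp _] [hf' hp' _] hs; rewrite /run_phase.
have h1 : lab' v' = lab v by rewrite -(sim_ctr hs) (sim_lab hs) // within_refl.
rewrite h1; congr (mk_xlabel _ _ _ _ _ _ _, 0); apply/ffunP => p; rewrite !ffunE /xout; congr a_out.
have hs2 : simf e pn (fun x => (xI (lab x).1, xW (lab x).1)) e' pn' (fun x => (xI (lab' x).1, xW (lab' x).1)) R f g v v'.
  by apply: (sim_relabel hs) => // x hx; rewrite (sim_lab hs hx).
rewrite -(sim_ctr hs); apply/esym.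
apply: (xrun_sim (forest_sym hf) hp hp' hs2 (within_refl e 0 v)).
by rewrite /bad_rad; lia.
Qed.

End Phases.

Lemma induced_true (V : finType) (e : rel V) : induced e (fun=> true) = e.
Proof.
apply: functional_extensionality => x; apply: functional_extensionality => y.
by rewrite /induced !andbT.
Qed.

Lemma lcl_valid_ext (Si So : Type) (Pi : LCL Si So) (V : finType) (e : rel V) inp (out out' : V -> V -> So) :
  (forall x y, e x y -> out x y = out' x y) -> lcl_valid Pi e inp out -> lcl_valid Pi e inp out'.
Proof.
move=> h hv v; case: (hv v) => H h1 [f [g [h2 h3 h4 h5 h6]]]; exists H => //; exists f, g.
by split => // x y hx hy he; case: (h6 x y hx hy he) => h7 h8; rewrite -h.
Qed.

Fixpoint valb (s : seq bool) : nat := if s is b :: s' then b + 2 * valb s' else 0.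

Lemma valb_lt s : valb s < 2 ^ size s.
Proof. by elim: s => //= b s IH; rewrite expnS; case: b; lia. Qed.

Lemma valb_inj s t : size s = size t -> valb s = valb t -> s = t.
Proof.
elim: s t => [|b s IH] [|b' t] //= [h1] h2.
have hb : b = b' by move: h2; case: b; case: b' => //=; lia.
by subst b'; congr cons; apply: IH => //; lia.
Qed.

Section Inst.
Variables (Si So : finType) (D : nat) (Pi : LCL Si So) (A : algo Si So) (n0 K' cn bs : nat).
Variable so0 : So.
Notation W := ((a_bits A n0).-tuple bool).
Notation R := (bad_rad Pi A n0).
Notation K := K'.+1.
Notation Dl := (D.+2 ^ (4 * R)).
(* thr2 is what the local lemma needs for the final completion; the extra factor in thr1 pays for
   the union bound over the events near a cut vertex. *)
Definition thr2 : nat := 4 * D.+2 ^ (2 * R).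
Definition thr1 : nat := thr2 * D.+2 ^ (2 * R).
Notation Xf := (xlabel D A n0 K').
Notation Lb := (Xf * nat)%type.

Definition lg (n : nat) : nat := (trunc_log 2 n).+1.
(** Two of at most [n ^ 2] pairs' worth of powers of [n] pay for the pairs that may collide, [cn]
    give the required bound, and one more covers the factor 2 from having two sources of failure. *)
Definition id_len (n : nat) : nat := (cn + 3) * lg n.
Definition col_phases (n : nat) : nat := (trunc_log 2 (id_len n)).+1.
(** As for [id_len], except that the union bound over start vertices costs only one power of [n]. *)
Definition witness_size (n : nat) : nat := (cn + 2) * lg n.
Definition pocket_bound (n : nat) : nat := witness_size n * D.+2 ^ (7 * R).
(** Enough halvings to exhaust a pocket, times the number of steps in [layer_halve]. *)
Definition num_layers (n : nat) : nat := (trunc_log 2 (pocket_bound n)).+1 * (4 * D.+2 ^ (4 * R).+1 * K).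

Definition phase_rad (n k : nat) : nat :=
  if k < col_phases n then 4 * R else if k == col_phases n then shatter_rad Pi A n0 K'
  else if k == (col_phases n).+1 then finish_rad Pi A n0 (num_layers n) else R.
Definition phase_act (n k : nat) (l : Lb) : bool := if k == (col_phases n).+1 then xact l.1 else true.
Definition phase_fun (n k : nat) (V : finType) (e : rel V) (pn : V -> V -> nat) (lab : V -> Lb) (v : V) : Lb :=
  if k < col_phases n then color_phase Pi e lab (iter k (nbits Dl) (id_len n)) v
  else if k == col_phases n then shatter_phase Pi thr1 e pn lab v
  else if k == (col_phases n).+1 then gather_phase Pi thr2 e pn lab (num_layers n) v else run_phase e pn lab v.
Definition num_bits (n : nat) : nat := id_len n + a_bits A n0.
Definition id_bits (n : nat) (t : (num_bits n).-tuple bool) : (id_len n).-tuple bool := [tuple nth false t i | i < id_len n].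
Definition sample_bits (n : nat) (t : (num_bits n).-tuple bool) : W := [tuple nth false t (id_len n + i) | i < a_bits A n0].
Definition init_label (n : nat) (d : nat) (ip : nat -> option Si) (t : (num_bits n).-tuple bool) : Lb :=
  (mk_xlabel (inord d) [ffun i : 'I_D => ip i] (sample_bits t) (ord0 : 'I_K) None false [ffun=> so0], valb (id_bits t)).
Definition out_label (l : Lb) (p : nat) : So := if insub p is Some i then xo l.1 i else so0.

(** The first summand serves the phases of bounded radius on the whole tree, the second the
    gathering inside pockets, the last the leading bit of a message. *)
Definition msg_const : nat :=
  (#|Xf| + 2 * (cn + bs + 5) + 2 * D) * D.+2 ^ (4 * R + shatter_rad Pi A n0 K' + R) +
  (#|Xf| + 2 + 2 * D) * ((cn + 2) * D.+2 ^ (7 * R)) + 1.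

Definition fast_algo : algo Si So :=
  sim_algo D msg_const (fun n => col_phases n + 3) phase_rad phase_act phase_fun init_label out_label.

Hypothesis hK : K = 2 ^ bs.
Hypothesis hbs : forall b k, iter k (nbits Dl) b <= maxn bs (b %/ 2 ^ k).
Hypothesis hA : fails_rarely D Pi A n0.
Hypothesis hn0 : 2 * thr1 * (D.+2 ^ (14 * R + 1)) ^ 2 <= n0.
Hypothesis hn0' : D.+2 ^ R.+1 <= n0.

Lemma bad_rad_gt0 : 0 < R. Proof. by rewrite /bad_rad addn1. Qed.

Lemma phase_rad_gt0 n k : 0 < phase_rad n k.
Proof.
have := bad_rad_gt0; rewrite /phase_rad /shatter_rad /finish_rad; case: ifP => _; first by lia.
by case: ifP => _; [lia|case: ifP => _ //; lia].
Qed.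

Lemma phase_fun_local n k : local_fun D (phase_rad n k) (@phase_fun n k).
Proof.
rewrite /phase_rad /phase_fun; case: (k < col_phases n); first exact: color_phase_local.
case: (k == col_phases n); first exact: shatter_phase_local.
by case: (k == (col_phases n).+1); [apply: gather_phase_local|apply: run_phase_local].
Qed.

Lemma lg_gt n : n < 2 ^ lg n.
Proof. exact: trunc_log_ltn. Qed.

Lemma col_phases_small n : iter (col_phases n) (nbits Dl) (id_len n) <= bs.
Proof.
apply: leq_trans (hbs _ _) _.
by rewrite divn_small ?maxn0 // /col_phases; apply: trunc_log_ltn.
Qed.

Section Tree.
Variables (n : nat) (V : finType) (e : rel V) (pn : V -> V -> nat) (inp : V -> V -> Si).
Hypotheses (hV : 0 < #|V| <= n) (ht : is_tree e) (hD : max_deg_le e D) (hpn : port_numbering e pn).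
Notation asg := {ffun V -> W}.
Notation Q := #|{ffun V -> W}|.
Notation idT := ((id_len n).-tuple bool).
Notation I := (sinfo e pn inp).
Notation BadI := (@Bad Si So Pi A n0 V e pn I).

Let hf := tree_forest ht.
Let hes := forest_sym hf.
Let hp := port_pinj hpn.

Lemma n1_le : thr1 <= n0.
Proof.
apply: leq_trans hn0; have : 0 < (D.+2 ^ (14 * R + 1)) ^ 2 by rewrite !expn_gt0.
move: (_ ^ 2) => x; nia.
Qed.

Lemma n1_gt0 : 0 < thr1.
Proof. by rewrite /thr1 /thr2 !muln_gt0 !expn_gt0. Qed.

Fixpoint colors (i : V -> idT) (k : nat) (v : V) : nat :=
  if k is k'.+1 then newcol (iter k' (nbits Dl) (id_len n)) Dl (4 * R) e (colors i k') v else valb (i v).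

Lemma colors_lt i k v : colors i k v < 2 ^ iter k (nbits Dl) (id_len n).
Proof.
case: k => [|k] /=; last exact: newcol_bits.
by rewrite -[X in _ < 2 ^ X](size_tuple (i v)) valb_lt.
Qed.

Lemma colors_proper i k x y : injective i -> within e (4 * R) x y -> colors i k x = colors i k y -> x = y.
Proof.
move=> hi hxy; elim: k => [|k IH] /= h.
  by apply: hi; apply: val_inj; apply: valb_inj h; rewrite !size_tuple.
apply: IH; apply/eqP; apply: contraT => hne.
have := @newcol_proper _ Dl (4 * R) V e (colors i k) D hD (leqnn _) (colors_lt i k) x y hxy hne.
by rewrite h eqxx.
Qed.

Definition final_color (i : V -> idT) (v : V) : 'I_K := inord (colors i (col_phases n) v).

Lemma final_color_val i v : (final_color i v : nat) = colors i (col_phases n) v.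
Proof.
rewrite inordK // hK; apply: leq_trans (colors_lt _ _ _) _.
by rewrite leq_exp2l // col_phases_small.
Qed.

Definition pre_assign (i : V -> idT) (w : V -> W) : V -> option W :=
  (prun e R thr1 BadI (fun x => final_color i x : nat) w K).1.

Definition pocket_set (i : V -> idT) (w : V -> W) : pred V :=
  fun x => [exists y, within e (2 * R) x y && (pre_assign i w y == None)].

Definition bigpocket (i : V -> idT) (w : V -> W) : bool :=
  [exists x, pocket_set i w x && (pocket_bound n < #|pocket e (pocket_set i w) x|)].

Let hdep v : depends_on (within e R v) (BadI v).
Proof. by move=> w w' hw; apply: bad_local. Qed.

Let hbadp v : #|[set w | BadI v w]| * n0 <= Q.
Proof. exact: (bad_prob hA hn0'). Qed.

Lemma final_color_inj i x y : injective i -> within e (4 * R) x y -> (final_color i x : nat) = final_color i y -> x = y.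
Proof. by move=> hi hxy; rewrite !final_color_val; apply: colors_proper. Qed.

Lemma final_color_inj2 i x y : injective i -> within e (2 * R) x y -> (final_color i x : nat) = final_color i y -> x = y.
Proof. by move=> hi hxy; apply: final_color_inj => //; apply: (withinW _ hxy); lia. Qed.

Lemma bigpocket_prob (i : V -> idT) : injective i ->
  #|[set w : asg | bigpocket i w]| * 2 ^ witness_size n <= #|V| * Q.
Proof.
move=> hi; have hcol x y := @final_color_inj2 i x y hi.
have hk : 0 < witness_size n by rewrite /witness_size /lg muln_gt0; lia.
apply: (@witness_prob V W e D R n0 thr1 (witness_size n)
   (fun w => tripped e R thr1 BadI (fun x => final_color i x : nat) w K)) => //.
- move=> l hu hs; apply: tripped_prob => //; [exact: n1_le|exact: asg_gt0].
- exact: n1_gt0.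
- move=> w /existsP[x /andP[hx hbig]].
  apply: (pocket_walk (U := pocket_set i w) (D := D)) hx hk hbig => //.
  move=> y /existsP[z /andP[h1 /eqP h2]].
  have hlt : final_color i z < K by apply: ltn_ord.
  case: (unset_tripped hes n1_le hlt h2) => v h3 h4; exists v => //.
  rewrite (within_sym hes) in h1.
  by apply: (withinW _ (within_add h4 h1)); lia.
Qed.

Lemma finish_ok (i : V -> idT) (w : V -> W) : injective i -> ~~ bigpocket i w ->
  forall v, ~~ bad Pi e pn I (finish Pi (num_layers n) thr2 (induced e (pocket_set i w)) pn I (final_color i) (pre_assign i w)) v.
Proof.
move=> hi hb; have hcol x y := @final_color_inj2 i x y hi.
apply: (@finish_correct _ _ Pi A n0 D K (num_layers n) thr1 thr2 V e pn (pocket_set i w) I (final_color i) (pre_assign i w)) => //.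
- move=> x y hx hxy; apply/existsP; exists x; rewrite hx eqxx andbT.
  by rewrite (within_sym hes).
- by move=> x y hxy h; apply: (final_color_inj hi hxy); rewrite h.
- move=> v; apply: (prun_unlikely (e := e) (R := R) (n0 := n0) (c := fun x => final_color i x : nat) hes hdep hcol n1_le hbadp w K v).
- move=> x; set h := induced e (pocket_set i w).
  have hfh : forest h by apply: induced_forest.
  have hDh : max_deg_le h D.
    move=> v; apply: leq_trans (hD v); apply: subset_leq_card; apply/subsetP => y.
    by rewrite !inE => /induced_sub.
  apply: (@layer_empty V h D (4 * R) K (fun x => final_color i x : nat) hfh hDh _ [set y | connect h x y] _ _ _ x).
  + by move=> y; apply: ltn_ord.
  + move=> y z; rewrite !inE => h1 h2; exact: connect_trans h1 (connect1 h2).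
  + apply: leq_ltn_trans (trunc_log_ltn (pocket_bound n) (isT : 1 < 2)).
    case hx: (pocket_set i w x).
      by move: hb; rewrite negb_exists => /forallP /(_ x); rewrite hx /= -leqNgt.
    (* A vertex outside the pockets is isolated in [h], so its component is a singleton. *)
    apply: (@leq_trans 1).
      rewrite leqNgt; apply/negP => /card_gt1P[y [z [h1 h2 h3]]].
      have h4 u : u \in [set y | connect h x y] -> u = x.
        rewrite inE => /connectP[p h5 ->]; case: p h5 => [|a p] //= /andP[/and3P[_ h6 _] _].
        by rewrite hx in h6.
      by move: h3; rewrite (h4 _ h1) (h4 _ h2) eqxx.
    by rewrite /pocket_bound /witness_size /lg !muln_gt0 expn_gt0 addn2.
  + by rewrite inE connect0.
Qed.

Section Run.
Variable beta : V -> (num_bits n).-tuple bool.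
Notation ib := (fun v => id_bits (beta v)).
Notation wb := (fun v => sample_bits (beta v)).
Notation graph_at := (phase_graph phase_act phase_fun init_label e pn inp beta).
Notation lb := (@labels Si Xf phase_act phase_fun num_bits init_label n V e pn inp beta).

Definition col_label (v : V) : Xf :=
  mk_xlabel (inord (deg e v)) [ffun q : 'I_D => omap (inp v) (nbr_at e pn v q)] (wb v) (ord0 : 'I_K) None false [ffun=> so0].

Lemma act_all k (f : V -> Lb) : k != (col_phases n).+1 -> induced e (fun x => phase_act n k (f x)) = e.
Proof.
move=> h; rewrite -[RHS]induced_true; congr induced; apply: functional_extensionality => x.
by rewrite /phase_act (negbTE h).
Qed.

Lemma labsS k v : lb k.+1 v = phase_fun n k (induced e (fun x => phase_act n k (lb k x))) pn (lb k) v.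
Proof. by []. Qed.

Lemma labels_col k : k <= col_phases n -> lb k = fun v => (col_label v, colors ib k v).
Proof.
elim: k => [|k IH] hk; first by [].
apply: functional_extensionality => v; rewrite labsS act_all; last by rewrite neq_ltn ltnS (ltnW hk).
by rewrite /phase_fun hk IH // ltnW.
Qed.

Lemma xI_sinfo v (x : Xf) : xdg x = inord (deg e v) ->
  xip x = [ffun q : 'I_D => omap (inp v) (nbr_at e pn v q)] -> xI x = I v.
Proof.
move=> h1 h2; rewrite /xI h1 h2 inordK ?ltnS // /sinfo; congr pair.
apply: functional_extensionality => p; case: insubP => [q _ hq|hq]; first by rewrite ffunE hq.
case h: (nbr_at e pn v p) => [u|] //; case: (nbr_at_Some h) => h3 h4.
case: (hpn v) => /(_ u h3) h5 _; rewrite h4 in h5.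
by rewrite (leq_trans h5 (hD v)) in hq.
Qed.

Lemma shatter_state_pre : shatter_state Pi thr1 e pn (lb (col_phases n)) = pre_assign ib wb.
Proof.
rewrite /shatter_state (labels_col (leqnn _)).
have -> : (fun x => xI (col_label x, colors ib (col_phases n) x).1) = I.
  by apply: functional_extensionality => x; apply: xI_sinfo.
reflexivity.
Qed.

Definition sh_label (w : V -> W) (v : V) : Xf :=
  mk_xlabel (inord (deg e v)) [ffun q : 'I_D => omap (inp v) (nbr_at e pn v q)] (w v) (final_color ib v) (pre_assign ib wb v)
    (pocket_set ib wb v) [ffun=> so0].

Lemma labels_sh : lb (col_phases n).+1 = fun v => (sh_label wb v, 0).
Proof.
apply: functional_extensionality => v; rewrite labsS act_all; last by rewrite neq_ltn ltnSn.
rewrite /phase_fun ltnn eqxx /shatter_phase shatter_state_pre (labels_col (leqnn _)); reflexivity.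
Qed.

Notation wf := (finish Pi (num_layers n) thr2 (induced e (pocket_set ib wb)) pn I (final_color ib) (pre_assign ib wb)).

Lemma act_U : induced e (fun x => phase_act n (col_phases n).+1 (lb (col_phases n).+1 x)) = induced e (pocket_set ib wb).
Proof.
congr induced; apply: functional_extensionality => x.
by rewrite /phase_act eqxx labels_sh.
Qed.

Lemma labels_ga : lb (col_phases n).+2 = fun v => (sh_label wf v, 0).
Proof.
apply: functional_extensionality => v.
rewrite labsS act_U /phase_fun ltnNge leqnSn [~~ true]/= eqxx eqn_leq ltnn [false && _]/= /gather_phase labels_sh.
have -> : (fun x => xI (sh_label wb x, 0).1) = I.
  by apply: functional_extensionality => x; apply: xI_sinfo.
reflexivity.
Qed.

Lemma labels_out v p : p < D -> out_label (lb (col_phases n).+3 v) p = xout e pn I wf v p.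
Proof.
move=> hp'.
rewrite labsS act_all; last by rewrite neq_ltn ltnSn orbT.
have h1 : ((col_phases n).+2 < col_phases n) = false by lia.
have h2 : ((col_phases n).+2 == col_phases n) = false by lia.
have h3 : ((col_phases n).+2 == (col_phases n).+1) = false by lia.
rewrite /phase_fun h1 h2 h3 /out_label /run_phase labels_ga insubT /xo /= ffunE.
have -> : (fun x => xI (sh_label wf x, 0).1) = I.
  by apply: functional_extensionality => x; apply: xI_sinfo.
reflexivity.
Qed.

Lemma trunc_log_lt2 m k : m < 2 ^ k -> trunc_log 2 m <= k.
Proof.
by move=> h; apply: leq_trans (leq_trunc_log 2 (ltnW h)) _; rewrite trunc_expnK.
Qed.

(** Only the gathering phase has a radius growing with [n], and there the size of the pocket bounds
    the message. In all other phases the number of vertices in view is bounded and each label takes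
    O(log n) bits. *)
Lemma budget k j v p : ~~ bigpocket ib wb -> k < col_phases n + 3 -> j < phase_rad n k -> p < D -> phase_act n k (lb k v) ->
  (size (view_code (@label_code Xf) D (graph_at k) pn (lb k) j v p)).+1 <= msg_budget msg_const n.
Proof.
move=> hb hk hj hp' hact.
have ho : port_forest D (graph_at k) pn by apply: port_forest_grf.
have hlg : 0 < lg n by [].
case: (eqVneq k (col_phases n).+1) => [hk1|hk1].
  subst k.
  have hb1 u : size (label_code (lb (col_phases n).+1 u)) <= #|Xf| + 2.
    by rewrite labels_sh; apply: (leq_trans (size_label_code _)).
  have h1 := view_code_size_comp (lab := lb (col_phases n).+1) j v ho hb1 hp'.
  apply: leq_ltn_trans h1 _.
  have hcomp : #|[set y | connect (graph_at (col_phases n).+1) v y]| <= pocket_bound n.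
    rewrite /phase_graph act_U.
    have hU : pocket_set ib wb v by move: hact; rewrite /phase_act eqxx labels_sh.
    by move: hb; rewrite negb_exists => /forallP /(_ v); rewrite hU /= -leqNgt.
  have h2 : (#|Xf| + 2 + 2 * D) * #|[set y | connect (graph_at (col_phases n).+1) v y]| <=
     (#|Xf| + 2 + 2 * D) * ((cn + 2) * D.+2 ^ (7 * R)) * lg n.
    rewrite -mulnA leq_mul2l; apply/orP; right; apply: (leq_trans hcomp).
    by rewrite /pocket_bound /witness_size mulnAC.
  apply: leq_ltn_trans h2 _.
  by rewrite /msg_budget -/(lg n) /msg_const ltn_pmul2r // addn1 ltnS leq_addl.
pose b := #|Xf| + (id_len n + bs).+1 * 2.
have hb1 u : size (label_code (lb k u)) <= b.
  apply: (leq_trans (size_label_code _)); rewrite /b leq_add2l leq_mul2r ltnS; apply/orP; right.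
  case: (leqP k (col_phases n)) => hkt.
    rewrite labels_col //=; apply: trunc_log_lt2; apply: leq_trans (colors_lt _ _ _) _.
    rewrite leq_exp2l //; apply: leq_trans (hbs _ _) _; rewrite geq_max leq_addl /=.
    by apply: leq_trans (leq_div _ _) (leq_addr _ _).
  have -> : k = (col_phases n).+2 by move/eqP: hk1; lia.
  by rewrite labels_ga.
have h1 := view_code_size_exp ho hb1 j v hp'.
have hj2 : j <= 4 * R + shatter_rad Pi A n0 K' + R.
  move: hj; rewrite /phase_rad; case: ifP => _; first by lia.
  by case: ifP => _; [lia|rewrite (negbTE hk1); lia].
have h2 : (b + 2 * D) * D.+2 ^ j <= (#|Xf| + 2 * (cn + bs + 5) + 2 * D) * lg n * D.+2 ^ (4 * R + shatter_rad Pi A n0 K' + R).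
  apply: leq_mul; last by rewrite leq_exp2l.
  by rewrite /b /id_len; move: hlg; move: (lg n) #|_| => x y; nia.
apply: leq_ltn_trans (leq_trans h1 h2) _.
by rewrite mulnAC /msg_budget -/(lg n) /msg_const ltn_pmul2r // addn1 ltnS leq_addr.
Qed.

Lemma fast_algo_ok : injective ib -> ~~ bigpocket ib wb ->
  lcl_valid Pi e inp (outl fast_algo n e pn inp beta).
Proof.
move=> hi hb; have hfin := finish_ok hi hb.
apply: (@lcl_valid_ext _ _ Pi V e inp (fun x y => xout e pn I wf x (pn x y))); last first.
  by apply/(bad_valid Pi inp wf hp).
move=> x y hxy; rewrite sim_algo_out //.
- by rewrite addn3 labels_out //; case: (hpn x) => h1 _; apply: leq_trans (h1 _ hxy) (hD x).
- exact: phase_rad_gt0.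
- exact: phase_fun_local.
- by move=> k j v p h1 h2 h3 h4; apply: budget.
Qed.
End Run.
End Tree.
End Inst.

(** * Failure probability and running time *)

Lemma collision_count (V T : finType) :
  #|[set i : {ffun V -> T} | ~~ injectiveb i]| * #|T| <= #|V| ^ 2 * #|{ffun V -> T}|.
Proof.
pose C (u : V * V) := [set i : {ffun V -> T} | (u.1 != u.2) && (i u.1 == i u.2)].
have hC u : #|C u| * #|T| <= #|{ffun V -> T}|.
  case: u => x y; rewrite -[#|T|]cardsT -cardsX.
  (* On [C u] overwriting the value at [x] loses no information, since the old value still stands at
     [y]. *)
  pose f (p : {ffun V -> T} * T) : {ffun V -> T} := [ffun z => if z == x then p.2 else p.1 z].
  rewrite -(@card_in_imset _ _ f); first exact: max_card.
  move=> [i t] [j s]; rewrite !inE /= => /andP[/andP[hxy /eqP hi] _] /andP[/andP[_ /eqP hj] _] h.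
  have hz z : (if z == x then t else i z) = (if z == x then s else j z).
    by move/ffunP: h => /(_ z); rewrite !ffunE.
  have hts : t = s by have := hz x; rewrite eqxx.
  congr pair => //; apply/ffunP => z; have := hz z; case: eqP => [-> _|//].
  by rewrite hi hj; have := hz y; rewrite eq_sym (negbTE hxy).
have hsub : [set i : {ffun V -> T} | ~~ injectiveb i] \subset \bigcup_(u in [set: V * V]) C u.
  apply/subsetP => i; rewrite inE => /injectivePn[x [y h1 h2]].
  by apply/bigcupP; exists (x, y) => //; rewrite inE /= h1 h2 eqxx.
apply: (leq_trans (leq_mul (subset_leq_card hsub) (leqnn _))).
have -> : #|V| ^ 2 = #|[set: V * V]| by rewrite cardsT card_prod expnS expn1.
by apply: card_bigcup_mul.
Qed.

Section Count.
Variables (Si So : finType) (D : nat) (Pi : LCL Si So) (A : algo Si So) (n0 K' cn bs : nat).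
Variable so0 : So.
Notation W := ((a_bits A n0).-tuple bool).
Notation R := (bad_rad Pi A n0).
Notation Dl := (D.+2 ^ (4 * R)).
Notation thr1 := (thr1 D Pi A n0).
Notation fast_algo := (fast_algo D Pi A n0 K' cn bs so0).
Notation T n := ((num_bits A n0 cn n).-tuple bool).
Hypothesis hK : K'.+1 = 2 ^ bs.
Hypothesis hbs : forall b k, iter k (nbits Dl) b <= maxn bs (b %/ 2 ^ k).
Hypothesis hA : fails_rarely D Pi A n0.
Hypothesis hn0 : 2 * thr1 * (D.+2 ^ (14 * R + 1)) ^ 2 <= n0.
Hypothesis hn0' : D.+2 ^ R.+1 <= n0.

Lemma bits_split n (t t' : T n) : id_bits t = id_bits t' -> sample_bits t = sample_bits t' -> t = t'.
Proof.
move=> h1 h2; apply: eq_from_tnth => j; rewrite !(tnth_nth false).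
case: (ltnP j (id_len cn n)) => hj.
  by have := congr1 (fun s => tnth s (Ordinal hj)) h1; rewrite !tnth_mktuple.
have hj2 : j - id_len cn n < a_bits A n0 by have := ltn_ord j; rewrite {2}/num_bits; lia.
have := congr1 (fun s => tnth s (Ordinal hj2)) h2; rewrite !tnth_mktuple /=.
by rewrite subnKC.
Qed.

(** A failing run has colliding identifiers or a large pocket, and each of these has probability at
    most half of [1 / n ^ cn]. Identifier bits and sample bits are independent, so the pocket bound
    is summed over fixed injective identifiers. *)
Lemma fail_count n (V : finType) (e : rel V) pn (inp : V -> V -> Si) :
  0 < #|V| <= n -> is_tree e -> max_deg_le e D -> port_numbering e pn ->
  #|[set beta : {ffun V -> T n} | pb (~ lcl_valid Pi e inp (outl fast_algo n e pn inp beta))]| * n ^ cn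
    <= #|{ffun V -> T n}|.
Proof.
move=> /andP[hV0 hVn] ht hD hpn.
pose idT : finType := (id_len cn n).-tuple bool.
pose F (b : {ffun V -> T n}) : {ffun V -> idT} * {ffun V -> W} := ([ffun v => id_bits (b v)], [ffun v => sample_bits (b v)]).
have hF : injective F.
  move=> b b' [/ffunP h1 /ffunP h2]; apply/ffunP => v; apply: bits_split.
    by have := h1 v; rewrite !ffunE.
  by have := h2 v; rewrite !ffunE.
set M := #|{ffun V -> idT}|; set Q := #|{ffun V -> W}|.
have hcard : #|{ffun V -> T n}| = M * Q.
  by rewrite /M /Q !card_ffun !card_tuple card_bool -expnMn -expnD.
rewrite hcard.
pose big (i : {ffun V -> idT}) (w : {ffun V -> W}) := @bigpocket Si So D Pi A n0 K' cn n V e pn inp i w.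
pose B1 := [set u : {ffun V -> idT} * {ffun V -> W} | ~~ injectiveb u.1 && true].
pose B2 := [set u : {ffun V -> idT} * {ffun V -> W} | injectiveb u.1 && big u.1 u.2].
set Z := [set beta : {ffun V -> T n} | _].
have hZ : #|Z| <= #|B1| + #|B2|.
  apply: leq_trans (leq_card_setU B1 B2); rewrite -(card_imset _ hF).
  apply: subset_leq_card; apply/subsetP => u /imsetP[b]; rewrite inE => /pbP hb ->.
  rewrite !inE andbT; case: (boolP (injectiveb (F b).1)) => //= hi.
  apply: contraT => hnb; case: hb.
  have e1 : (fun v => id_bits (b v)) = (F b).1 by apply: functional_extensionality => v; rewrite ffunE.
  have e2 : (fun v => sample_bits (b v)) = (F b).2 by apply: functional_extensionality => v; rewrite ffunE.
  have hVV : 0 < #|V| <= n by rewrite hV0.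
  have h := @fast_algo_ok Si So D Pi A n0 K' cn bs so0 hK hbs hA hn0 hn0' n V e pn inp hVV ht hD hpn b.
  rewrite e1 e2 in h; apply: h; first exact/injectiveP.
  exact: hnb.
have hB1 : #|B1| * 2 ^ id_len cn n <= #|V| ^ 2 * (M * Q).
  have -> : #|B1| = #|[set i : {ffun V -> idT} | ~~ injectiveb i]| * Q.
    rewrite /B1 (card_pair_sum (fun (i : {ffun V -> idT}) (w : {ffun V -> W}) => ~~ injectiveb i && true)).
    rewrite -sum_nat_const [RHS]big_mkcond; apply: eq_bigr => i _; rewrite inE andbT.
    case: (injectiveb i) => /=; first by rewrite (_ : [set _ | _] = set0) ?cards0 //; apply/setP => w; rewrite !inE.
    by rewrite /Q -cardsT; apply: eq_card => w; rewrite !inE.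
  have := collision_count V idT; rewrite card_tuple card_bool -/M => h.
  by rewrite mulnAC mulnA leq_mul2r h orbT.
have hB2 : #|B2| * 2 ^ witness_size cn n <= #|V| * (M * Q).
  rewrite /B2 (card_pair_sum (fun (i : {ffun V -> idT}) (w : {ffun V -> W}) => injectiveb i && big i w)) big_distrl /=.
  apply: (@leq_trans (\sum_(i : {ffun V -> idT}) #|V| * Q)); last first.
    by rewrite sum_nat_const -/M mulnCA.
  apply: leq_sum => i _; case: (boolP (injectiveb i)) => hi; last first.
    by rewrite (_ : [set _ | _] = set0) ?cards0 //; apply/setP => w; rewrite !inE.
  have hVV : 0 < #|V| <= n by rewrite hV0.
  exact: (@bigpocket_prob Si So D Pi A n0 K' cn bs hK hbs hA hn0 hn0' n V e pn inp hVV ht hD hpn i (injectiveP _ hi)).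
have hn : 0 < n by apply: leq_trans hVn.
have hP := lg_gt n; set P := 2 ^ lg n in hP.
have hP2 : 2 <= P by rewrite /P /lg expnS -[X in X <= _]muln1 leq_mul2l /= expn_gt0.
have e1 : 2 ^ id_len cn n = P ^ (cn + 3) by rewrite /id_len mulnC expnM.
have e2 : 2 ^ witness_size cn n = P ^ (cn + 2) by rewrite /witness_size mulnC expnM.
(* Since [P] exceeds [n] and is at least 2, one extra power of [P] absorbs the factor 2. *)
have hpow m : 2 * n ^ m <= P ^ m.+1.
  by rewrite expnS leq_mul //; case: m => // m; rewrite leq_exp2r // ltnW.
have h1 : 2 * (#|B1| * n ^ cn) <= M * Q.
  have hn2 : 0 < n ^ 2 by rewrite expn_gt0 hn.
  rewrite -(leq_pmul2r hn2).
  apply: (@leq_trans (#|B1| * P ^ (cn + 3))).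
    have := hpow (cn + 2); rewrite expnD addn2 -addn3 => h.
    by rewrite mulnCA -!mulnA leq_mul2l h orbT.
  rewrite -e1; apply: (leq_trans hB1); rewrite mulnC leq_mul2l leq_exp2r // hVn orbT //.
have h2 : 2 * (#|B2| * n ^ cn) <= M * Q.
  rewrite -(leq_pmul2r hn).
  apply: (@leq_trans (#|B2| * P ^ (cn + 2))).
    have := hpow (cn + 1); rewrite [n ^ _]expnD expn1 (_ : (cn + 1).+1 = cn + 2); last by lia.
    move=> h;
    by rewrite mulnCA -!mulnA leq_mul2l h orbT.
  by rewrite -e2; apply: (leq_trans hB2); rewrite mulnC leq_mul2l hVn orbT.
have h3 : #|Z| * n ^ cn <= (#|B1| + #|B2|) * n ^ cn by rewrite leq_mul2r hZ orbT.
move: h1 h2 h3; rewrite mulnDl; move: (_ * n ^ cn) (_ * n ^ cn) (_ * n ^ cn) => x y z; lia.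
Qed.
End Count.

Lemma trunc_log_mul a b : trunc_log 2 (a * b) <= trunc_log 2 a + trunc_log 2 b + 2.
Proof.
case: (posnP (a * b)) => [->|h]; first by rewrite trunc_log0.
have : a * b < 2 ^ ((trunc_log 2 a).+1 + (trunc_log 2 b).+1).
  by rewrite expnD ltn_mul // trunc_log_ltn.
move/trunc_log_lt2; lia.
Qed.

Lemma sum_split3 (f : nat -> nat) m :
  \sum_(k < m.+3) f k = \sum_(k < m) f k + f m + f m.+1 + f m.+2.
Proof. by rewrite !big_ord_recr. Qed.

Section Time.
Variables (Si So : finType) (D : nat) (Pi : LCL Si So) (A : algo Si So) (n0 K' cn bs : nat).
Variable so0 : So.
Notation R := (bad_rad Pi A n0).

Lemma fast_algo_time : exists C, forall n,
  a_time (fast_algo D Pi A n0 K' cn bs so0) n <= C * (trunc_log 2 (lg n)).+1.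
Proof.
pose a1 := trunc_log 2 (cn + 3) + 3.
pose Cs := 4 * D.+2 ^ (4 * R).+1 * K'.+1.
pose a2 := (trunc_log 2 ((cn + 2) * D.+2 ^ (7 * R)) + 3) * Cs.
exists (a1 * (4 * R) + shatter_rad Pi A n0 K' + ((a2 + 1) * (4 * R).+1 + 4 * R + (3 * a2 + 2 * R)) + R) => n.
set y := trunc_log 2 (lg n).
have h1 : col_phases cn n <= a1 * y.+1.
  have := trunc_log_mul (cn + 3) (lg n); rewrite /col_phases /id_len /a1 -/y.
  move: (trunc_log 2 (cn + 3)) (trunc_log 2 ((cn + 3) * lg n)) => u v; nia.
have h2 : num_layers D Pi A n0 K' cn n <= a2 * y.+1.
  rewrite /num_layers -/Cs /a2 [_ * Cs * _]mulnAC leq_mul2r; apply/orP; right.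
  have := trunc_log_mul ((cn + 2) * D.+2 ^ (7 * R)) (lg n); rewrite /pocket_bound /witness_size [_ * lg n * _]mulnAC -/y.
  move: (trunc_log 2 ((cn + 2) * D.+2 ^ (7 * R))) (trunc_log 2 _) => u v; nia.
have -> : a_time (fast_algo D Pi A n0 K' cn bs so0) n =
  col_phases cn n * (4 * R) + shatter_rad Pi A n0 K' + finish_rad Pi A n0 (num_layers D Pi A n0 K' cn n) + R.
  rewrite -[LHS]/(\sum_(k < col_phases cn n + 3) phase_rad D Pi A n0 K' cn n k) addn3.
  rewrite (sum_split3 (phase_rad D Pi A n0 K' cn n)).
  have -> : \sum_(i < col_phases cn n) phase_rad D Pi A n0 K' cn n i = col_phases cn n * (4 * R).
    rewrite -[X in _ = X * _]card_ord -sum_nat_const; apply: eq_bigr => i _.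
    by rewrite /phase_rad ltn_ord.
  have -> : phase_rad D Pi A n0 K' cn n (col_phases cn n) = shatter_rad Pi A n0 K' by rewrite /phase_rad ltnn eqxx.
  have e1 : ((col_phases cn n).+1 < col_phases cn n) = false by lia.
  have e2 : ((col_phases cn n).+1 == col_phases cn n) = false by lia.
  have e3 : ((col_phases cn n).+2 < col_phases cn n) = false by lia.
  have e4 : ((col_phases cn n).+2 == col_phases cn n) = false by lia.
  have e5 : ((col_phases cn n).+2 == (col_phases cn n).+1) = false by lia.
  by rewrite /phase_rad e1 e2 e3 e4 e5 eqxx.
rewrite /finish_rad; move: h1 h2.
move: (col_phases cn n) (num_layers D Pi A n0 K' cn n) (shatter_rad Pi A n0 K') => t N s; clear.
move: R a1 a2 y => r b1 b2 y h1 h2.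
have h3 : t * (4 * r) <= b1 * (4 * r) * y.+1 by rewrite mulnAC leq_mul2r h1 orbT.
have h4 : N.+1 * (4 * r).+1 <= (b2 + 1) * (4 * r).+1 * y.+1.
  by rewrite mulnAC leq_mul2r; apply/orP; right; lia.
move: (b1 * (4 * r)) (t * (4 * r)) ((b2 + 1) * (4 * r).+1) (N.+1 * (4 * r).+1) h3 h4 => a b c d; nia.
Qed.
End Time.

Lemma INR_expn a k : INR (a ^ k) = pow (INR a) k.
Proof. by elim: k => [|k IH] //; rewrite expnS mult_INR IH. Qed.

(** From 27 on, [ln n] is at least 3 and hence at least [exp 1], so [ln (ln n)] is at least 1 and
    absorbs the additive constants. *)
Lemma loglog_bound n : 27 <= n ->
  Rle (INR (trunc_log 2 (lg n)).+1) (Rmult 5 (ln (ln (INR n)))).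
Proof.
move=> hn; set y := trunc_log 2 (lg n).
have hln2 := ln_lt_2.
have hexp : Rle (exp 1) 3 by apply: exp_le_3.
have hn27 : Rle (INR 27) (INR n) by apply: le_INR; lia.
rewrite [INR 27]/= in hn27.
have hlnn : Rle 3 (ln (INR n)).
  apply: Rnot_lt_le => h; have := exp_increasing _ _ h; rewrite exp_ln; last by lra.
  have -> : (3 = 1 + (1 + 1))%Re by lra.
  rewrite !exp_plus => h1.
  have h2 := exp_pos 1.
  have : (exp 1 * (exp 1 * exp 1) <= 27)%Re by nra.
  lra.
have hll : Rle 1 (ln (ln (INR n))).
  apply: Rnot_lt_le => h; have := exp_increasing _ _ h; rewrite exp_ln; lra.
have e2 : INR 2 = 2%Re by rewrite /=; lra.
have hlg : (INR (trunc_log 2 n) * ln 2 <= ln (INR n))%Re.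
  have h1 : 2 ^ trunc_log 2 n <= n by apply: trunc_logP => //; lia.
  have h2 : Rle (INR (2 ^ trunc_log 2 n)) (INR n) by apply: le_INR; lia.
  rewrite INR_expn e2 in h2; rewrite -ln_pow; last by lra.
  have hpos : (0 < 2 ^ trunc_log 2 n)%Re by apply: pow_lt; lra.
  case: h2 => [h2|h2]; last by rewrite h2; lra.
  by left; apply: ln_increasing.
have htl : 1 <= trunc_log 2 n.
  by rewrite -[1](trunc_expnK 1 (isT : 1 < 2)); apply: leq_trunc_log; lia.
have htlR : Rle 1 (INR (trunc_log 2 n)) by apply: (le_INR 1); lia.
have hy : (INR y * ln 2 <= ln 2 + ln (INR (trunc_log 2 n)))%Re.
  have h1 : 2 ^ y <= 2 * trunc_log 2 n.
    by apply: leq_trans (trunc_logP (isT : 1 < 2) _) _; rewrite /lg; lia.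
  have h2 : Rle (INR (2 ^ y)) (INR (2 * trunc_log 2 n)) by apply: le_INR; lia.
  rewrite INR_expn mult_INR e2 in h2; rewrite -ln_pow; last by lra.
  rewrite -ln_mult; [|lra|lra].
  have hpos : (0 < 2 ^ y)%Re by apply: pow_lt; lra.
  case: h2 => [h2|h2]; last by rewrite h2; lra.
  by left; apply: ln_increasing.
have hlt : (ln (INR (trunc_log 2 n)) <= ln 2 + ln (ln (INR n)))%Re.
  rewrite -ln_mult; [|lra|lra].
  have h1 : (INR (trunc_log 2 n) <= 2 * ln (INR n))%Re by nra.
  case: h1 => [h1|h1]; last by rewrite h1; lra.
  by left; apply: ln_increasing; lra.
rewrite S_INR.
have : (INR y <= 2 + 2 * ln (ln (INR n)))%Re by have := pos_INR y; nra.
lra.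
Qed.

(** Each of the two factors [E ^ (a * t n0)] and [E ^ b] is kept below the square root of [n0]: the
    first by the growth of [t], the second by taking [n0] at least [E ^ (2 * b)]. *)
Lemma little_o_choose (t : nat -> nat) E a b : 2 <= E -> little_o_log t ->
  exists n0, E ^ (a * t n0 + b) <= n0 /\ 0 < n0.
Proof.
move=> hE ht; have hE1 : (1 < INR E)%Re by apply: (lt_INR 1); lia.
have hlE : (0 < ln (INR E))%Re by rewrite -ln_1; apply: ln_increasing; lra.
(* [a + 1] instead of [a], so that the division below also makes sense for [a = 0]. *)
pose ar := (INR a + 1)%Re.
have har : (0 < ar)%Re by have := pos_INR a; rewrite /ar; lra.
have heps : (0 < / (2 * ar * ln (INR E)))%Re.
  by apply: Rinv_0_lt_compat; apply: Rmult_lt_0_compat => //; lra.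
case: (ht _ heps) => N hN.
pose n0 := maxn N (E ^ (2 * b)).
have hpE : 0 < E ^ (2 * b) by rewrite expn_gt0; lia.
exists n0; split; last by rewrite /n0 leq_max hpE orbT.
have h1 := hN n0 (leq_maxl _ _).
have hn0 : (0 < INR n0)%Re by apply: (lt_INR 0); have := leq_maxr N (E ^ (2 * b)); rewrite -/n0; lia.
have h2 : (2 * INR b * ln (INR E) <= ln (INR n0))%Re.
  have h3 : Rle (INR (E ^ (2 * b))) (INR n0) by apply: le_INR; have := leq_maxr N (E ^ (2 * b)); rewrite -/n0; lia.
  rewrite INR_expn in h3.
  have -> : (2 * INR b = INR (2 * b))%Re by rewrite mult_INR.
  rewrite -ln_pow; last by lra.
  have hpos : (0 < INR E ^ (2 * b))%Re by apply: pow_lt; lra.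
  case: h3 => [h3|h3]; last by rewrite h3; lra.
  by left; apply: ln_increasing.
have h4 : (2 * (INR a * INR (t n0)) * ln (INR E) <= ln (INR n0))%Re.
  have h5 : (INR (t n0) * (2 * ar * ln (INR E)) <= ln (INR n0))%Re.
    apply: (Rmult_le_reg_l _ _ _ heps).
    by rewrite [X in Rle X _](_ : _ = INR (t n0)) //; field; lra.
  have h6 := pos_INR (t n0); have h7 := pos_INR a.
  have h8 : (0 <= INR (t n0) * ln (INR E))%Re by apply: Rmult_le_pos; lra.
  by rewrite /ar in h5; nra.
rewrite leqNgt; apply/negP => h.
have h9 : (INR n0 < INR (E ^ (a * t n0 + b)))%Re by apply: lt_INR; lia.
have := ln_increasing _ _ hn0 h9; rewrite INR_expn ln_pow; last by lra.
rewrite plus_INR mult_INR; nra.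
Qed.

Theorem mainTheorem3 (c : R) (Si So : finType) (D : nat) (Pi : LCL Si So) :
  Rle 1 c ->
  (exists A : algo Si So,
      little_o_log (a_time A) /\ solves_on_trees D Pi A (fun n => Rinv (INR n))) ->
  exists A : algo Si So,
    congest A /\ big_O_loglog (a_time A) /\
    solves_on_trees D Pi A (fun n => Rinv (Rpower (INR n) c)).
Proof.
move=> hc [A [ht hA]].
have hE : 2 <= D.+2 by [].
(* The exponent is [32 * R + 5] for the bad radius [R]: [28 * R + 2] for two steps of a witness
   walk, [4 * R] from [thr1], and 3 because [D.+2 ^ 3] covers the constant 8. *)
case: (@little_o_choose (a_time A) D.+2 32 (32 * (lcl_r Pi + 1) + 5) hE ht) => n0 [hn0 hn00].
pose R0 := bad_rad Pi A n0.
have hn0c : D.+2 ^ (32 * R0 + 5) <= n0.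
  by apply: leq_trans hn0; rewrite leq_exp2l // /R0 /bad_rad; lia.
have hn0b : D.+2 ^ R0.+1 <= n0 by apply: leq_trans hn0c; rewrite leq_exp2l //; lia.
have hn0a : 2 * thr1 D Pi A n0 * (D.+2 ^ (14 * R0 + 1)) ^ 2 <= n0.
  apply: leq_trans hn0c; rewrite /thr1 /thr2 -/R0.
  have -> : D.+2 ^ (32 * R0 + 5) = D.+2 ^ 3 * (D.+2 ^ (2 * R0) * D.+2 ^ (2 * R0) * (D.+2 ^ (14 * R0 + 1)) ^ 2).
    by rewrite -expnM -!expnD; congr (_ ^ _); lia.
  have h3 : 8 <= D.+2 ^ 3 by rewrite (_ : 8 = 2 ^ 3) // leq_exp2r.
  rewrite mulnA [X in X <= _](_ : _ = 8 * (D.+2 ^ (2 * R0) * D.+2 ^ (2 * R0) * (D.+2 ^ (14 * R0 + 1)) ^ 2)).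
    by rewrite leq_mul2r h3 orbT.
  by rewrite !mulnA.
have hAn : fails_rarely D Pi A n0.
  move=> V e pn inp h1 h2 h3 h4; have := hA n0 V e pn inp h1 h2 h3 h4; rewrite /fail_prob.
  set x := #|_|; set q := #|_| => h.
  have hq : 0 < q by apply/card_gt0P; exists [ffun=> w0 A n0].
  have hqR : (0 < INR q)%Re by apply: (lt_INR 0); lia.
  have hnR : (0 < INR n0)%Re by apply: (lt_INR 0); lia.
  have h5 : (INR x * INR n0 <= INR q)%Re.
    have := Rmult_le_compat_r (INR q * INR n0) _ _ _ h.
    have -> : (INR x / INR q * (INR q * INR n0) = INR x * INR n0)%Re by field; lra.
    have -> : (/ INR n0 * (INR q * INR n0) = INR q)%Re by field; lra.
    by apply; nra.
  by rewrite -mult_INR in h5; have := INR_le _ _ h5; lia.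
case: (nbits_fix (D.+2 ^ (4 * R0))) => bs hbs.
(* The lengths of identifiers and witnesses call for an integer exponent, so [c] is replaced by a
   larger [cn]. *)
case: (INR_unbounded c) => cn hcn.
pose K' := (2 ^ bs).-1.
have hK : K'.+1 = 2 ^ bs by rewrite /K' prednK // expn_gt0.
pose so0 : So := a_out A 0 (a_init A 0 0 (fun=> None) (w0 A 0)) 0.
exists (fast_algo D Pi A n0 K' cn bs so0); split; first exact: sim_algo_congest.
split.
  case: (fast_algo_time D Pi A n0 K' cn bs so0) => C hC.
  exists (INR C * 5)%Re, 27 => n hn; have := loglog_bound hn.
  have h1 : Rle (INR (a_time (fast_algo D Pi A n0 K' cn bs so0) n)) (INR C * INR (trunc_log 2 (lg n)).+1)%Re.
    by rewrite -mult_INR; apply: le_INR; have := hC n; lia.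
  have := pos_INR C; move: (INR C) h1 => Cr h1 h2 h3.
  apply: Rle_trans h1 _; rewrite Rmult_assoc; exact: Rmult_le_compat_l.
move=> n V e pn inp hV he hD hpn.
have := @fail_count Si So D Pi A n0 K' cn bs so0 hK hbs hAn hn0a hn0b n V e pn inp hV he hD hpn; rewrite /fail_prob.
change (num_bits A n0 cn n) with (a_bits (fast_algo D Pi A n0 K' cn bs so0) n).
set x := #|_|; set q := #|_| => h.
have hq : 0 < q by apply/card_gt0P; exists [ffun=> [tuple of nseq _ false]].
have hn : 0 < n by case/andP: hV => h1 h2; apply: leq_trans h2.
have hqR : (0 < INR q)%Re by apply: (lt_INR 0); lia.
have hn1 : (1 <= INR n)%Re by apply: (le_INR 1); lia.
have hpw : (Rpower (INR n) c <= INR n ^ cn)%Re.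
  by rewrite -Rpower_pow; [apply: Rle_Rpower; lra|lra].
have hpw0 : (0 < Rpower (INR n) c)%Re by apply: exp_pos.
have hx : (INR x * INR n ^ cn <= INR q)%Re.
  by rewrite -INR_expn -mult_INR; apply: le_INR; lia.
apply: (Rmult_le_reg_r (INR q * Rpower (INR n) c)); first by apply: Rmult_lt_0_compat.
have -> : (INR x / INR q * (INR q * Rpower (INR n) c) = INR x * Rpower (INR n) c)%Re by field; lra.
have -> : (/ Rpower (INR n) c * (INR q * Rpower (INR n) c) = INR q)%Re by field; lra.
apply: Rle_trans hx; apply: Rmult_le_compat_l => //; exact: pos_INR.
Qed.
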